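(* Let $\lambda>0$ and let $c_1,c_2:\mathbb{R}\to(0,\infty)$ be such that $\int_0^x\frac{dx'}{c_1(x')}$ and $\int_0^y\frac{dy'}{c_2(y')}$ are finite for all $x,y\in\mathbb{R}$. Let $(X(t),Y(t))$ be the planar random motion with space-varying velocities $c_1,c_2$ driven by a homogeneous Poisson process $N(t)$ of rate $\lambda$, as described in the context. Then for $t>0$ the absolutely continuous component of the probability law of $(X(t),Y(t))$ is $$p(x,y,t)=\frac{\lambda}{2\pi c_1(x)c_2(y)}\,\frac{\exp\left\{-\lambda t+\lambda\sqrt{t^2-\left|\int_0^x\frac{dx'}{c_1(x')}\right|^2-\left|\int_0^y\frac{dy'}{c_2(y')}\right|^2}\right\}}{\sqrt{t^2-\left|\int_0^x\frac{dx'}{c_1(x')}\right|^2-\left|\int_0^y\frac{dy'}{c_2(y')}\right|^2}},$$ with support the set $$\mathcal{D}=\left\{(x,y):\left|\int_0^x\frac{dx'}{c_1(x')}\right|^2+\left|\int_0^y\frac{dy'}{c_2(y')}\right|^2<t^2\right\},$$ and, for $n\ge1$, the conditional distribution of $(X(t),Y(t))$ given $N(t)=n$ is, on $\mathcal{D}$, $$P\{X(t)\in dx,Y(t)\in dy\mid N(t)=n\}=\frac{n}{2\pi t^n}\left[t^2-\left|\int_0^x\frac{dx'}{c_1(x')}\right|^2-\left|\int_0^y\frac{dy'}{c_2(y')}\right|^2\right]^{\frac n2-1}\frac{dx\,dy}{c_1(x)c_2(y)}.$$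
   Context: The particle starts from the origin at time $0$. Let $0=t_0<t_1<\dots<t_n<t_{n+1}=t$, where $t_1,\dots,t_n$ are the epochs in $(0,t)$ of the homogeneous Poisson process $N$ of rate $\lambda$ and $n=N(t)$. The directions $\theta_1,\theta_2,\dots$ are i.i.d., uniformly distributed in $[0,2\pi)$ and independent of $N$; the direction $\theta_j$ is in force during the time interval $(t_{j-1},t_j)$. The motion with $n$ changes of direction in $[0,t]$ is described by $$X(t)=\sum_{j=1}^{n+1}\left(\int_{t_{j-1}}^{t_j}c_1(X(s))\,ds\right)\cos\theta_j,\qquad Y(t)=\sum_{j=1}^{n+1}\left(\int_{t_{j-1}}^{t_j}c_2(Y(s))\,ds\right)\sin\theta_j.$$ *)

(* Defs.v *)
From HB Require Import structures.
From mathcomp Require Import all_boot all_order all_algebra.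
From mathcomp Require Import all_classical all_reals all_analysis.

Set Implicit Arguments.
Unset Strict Implicit.
Unset Printing Implicit Defensive.

Import Order.TTheory GRing.Theory Num.Theory.
Import numFieldNormedType.Exports.

Local Open Scope classical_set_scope.
Local Open Scope ring_scope.

Section Probability.
Context {d : measure_display} {T : measurableType d} {R : realType}.
Variable P : probability T R.

(* The law is only compared on measurable sets: on the other sets the library's
   distributions take meaningless values. *)
Definition has_law {d' : measure_display} {E : measurableType d'}
    (Z : T -> E) (nu : set E -> \bar R) : Prop :=
  forall A : set E, measurable A -> P (Z @^-1` A) = nu A.

Definition mutually_independent {d' : measure_display} {E : measurableType d'}
    (Z : nat -> T -> E) : Prop :=
  forall (s : seq nat) (B : nat -> set E), uniq s ->
    (forall i, measurable (B i)) ->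
    P (\bigcap_(i in [set` s]) (Z i @^-1` B i)) =
    (\prod_(i <- s) P (Z i @^-1` B i))%E.

Definition generated_sigma_algebra {I : Type} {d' : measure_display}
    {E : measurableType d'} (D : set I) (Z : I -> T -> E) : set (set T) :=
  <<s \bigcup_(i in D) preimage_set_system setT (Z i) measurable >>.

Definition independent_sigma_algebras (F G : set (set T)) : Prop :=
  forall A B : set T, F A -> G B -> P (A `&` B) = (P A * P B)%E.

Definition conditional_probability (A B : set T) : \bar R :=
  (P (A `&` B) * ((fine (P B))^-1)%:E)%E.

(* [N s] is the number of events in [0, s] and, for [k > 0], [tau k] is the
   epoch of the [k]-th event; [tau 0] is the starting time.  The process is
   defined by i.i.d. exponential times between consecutive events. *)
Record poisson_process (lam : R) (N : R -> {RV P >-> nat})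
    (tau : nat -> {RV P >-> R}) : Prop := {
  epoch0 : forall w, tau 0%N w = 0 ;
  interarrival_law : forall k,
    has_law (fun w => tau k.+1 w - tau k w) (exponential_prob lam) ;
  interarrival_independent :
    mutually_independent (fun k w => tau k.+1 w - tau k w) ;
  counting_epochs : {ae P, forall w, forall s : R, 0 <= s ->
    forall k, (k <= N s w)%N = (tau k w <= s)} }.

Lemma two_pi_gt0 : 0 < 2 * pi :> R.
Proof. by rewrite mulr_gt0 ?pi_gt0. Qed.

(* [theta j] is the direction in force between [tau j] and [tau j.+1]: the
   directions are numbered from 0. *)
Record random_directions (N : R -> {RV P >-> nat})
    (theta : nat -> {RV P >-> R}) : Prop := {
  direction_law : forall j, has_law (theta j) (uniform_prob two_pi_gt0) ;
  direction_independent : mutually_independent (fun j => theta j : T -> R) ;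
  direction_independent_of_process : independent_sigma_algebras
    (generated_sigma_algebra setT (fun j => theta j : T -> R))
    (generated_sigma_algebra [set s : R | 0 <= s] (fun s => N s : T -> nat)) }.

(* With [n = N s], the points [t_0 < t_1 < ... < t_n < t_(n+1) = s]. *)
Definition stage_time (N : R -> T -> nat) (tau : nat -> T -> R)
    (s : R) (w : T) (j : nat) : R :=
  if (j <= N s w)%N then tau j w else s.

(* One coordinate [Z] of the motion during [0, t], with velocity [c] and with
   [proj] equal to [cos] or [sin].  [Rintegral] is 0 when the integral
   diverges, whence the integrability condition. *)
Definition coordinate_motion (N : R -> T -> nat) (tau theta : nat -> T -> R)
    (c proj : R -> R) (t : R) (Z : R -> T -> R) : Prop :=
  {ae P, forall w,
    lebesgue_measure.-integrable `[0, t] (EFin \o (fun r => c (Z r w))) /\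
    forall s : R, 0 <= s <= t ->
      Z s w = \sum_(0 <= j < (N s w).+1)
        (\int[lebesgue_measure]_(r in `]stage_time N tau s w j,
                                       stage_time N tau s w j.+1[) c (Z r w))
        * proj (theta j w)}.

End Probability.

Section LebesgueDecomposition.
Context {d : measure_display} {E : measurableType d} {R : realType}.

Definition mutually_singular (mu nu : set E -> \bar R) : Prop :=
  exists S : set E, [/\ measurable S, mu S = 0%E & nu (~` S) = 0%E].

(* The absolutely continuous part, in the Lebesgue decomposition of [law] with
   respect to [mu], has density [f]. *)
Definition ac_component_density (mu : {measure set E -> \bar R})
    (law : set E -> \bar R) (f : E -> R) : Prop :=
  [/\ measurable_fun setT f, forall z, 0 <= f z &
      exists nu : {measure set E -> \bar R}, mutually_singular mu nu /\
        forall A, measurable A -> law A = (\int[mu]_(z in A) (f z)%:E + nu A)%E].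

End LebesgueDecomposition.

Section Densities.
Context {R : realType}.

(* The oriented integral of [1 / c] from 0 to [x]. *)
Definition travel_time (c : R -> R) (x : R) : R :=
  if 0 <= x then \int[lebesgue_measure]_(x' in `[0, x]) (c x')^-1
  else - \int[lebesgue_measure]_(x' in `[x, 0]) (c x')^-1.

Definition finite_travel_time (c : R -> R) : Prop :=
  forall x, lebesgue_measure.-integrable `[Num.min 0 x, Num.max 0 x]
              (EFin \o (fun x' => (c x')^-1)).

Definition lebesgue_measure2 :=
  (@lebesgue_measure R \x @lebesgue_measure R)%E.

Definition reachable (c1 c2 : R -> R) (t : R) : set (R * R) :=
  [set z | `|travel_time c1 z.1| ^+ 2 + `|travel_time c2 z.2| ^+ 2 < t ^+ 2].

Definition residual (c1 c2 : R -> R) (t : R) (z : R * R) : R :=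
  t ^+ 2 - `|travel_time c1 z.1| ^+ 2 - `|travel_time c2 z.2| ^+ 2.

Definition zero_outside (D : set (R * R)) (f : R * R -> R) : R * R -> R :=
  patch (fun=> 0) D f.

Definition motion_density (lam : R) (c1 c2 : R -> R) (t : R) (z : R * R) : R :=
  lam / (2 * pi * c1 z.1 * c2 z.2) *
  (expR (- lam * t + lam * Num.sqrt (residual c1 c2 t z)) /
   Num.sqrt (residual c1 c2 t z)).

Definition conditional_density (n : nat) (c1 c2 : R -> R) (t : R)
    (z : R * R) : R :=
  n%:R / (2 * pi * t ^+ n) * residual c1 c2 t z `^ (n%:R / 2 - 1) /
  (c1 z.1 * c2 z.2).

End Densities.

(* Main.v *)
Require Import Defs.
From HB Require Import structures.
From mathcomp Require Import all_boot all_order all_algebra.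
From mathcomp Require Import all_classical all_reals all_analysis.
From mathcomp Require Import measurable_realfun ring lra.

Set Implicit Arguments.
Unset Strict Implicit.
Unset Printing Implicit Defensive.

Import Order.TTheory GRing.Theory Num.Theory.
Import numFieldNormedType.Exports.

Local Open Scope classical_set_scope.
Local Open Scope ring_scope.

(** The functions G1 = [travel_time c1] and G2 = [travel_time c2] straighten the
paths: while the direction theta is in force, X moves with velocity
c1 (X) cos theta, so that G1 (X) moves with the constant velocity cos theta, and
G2 (Y) with the constant velocity sin theta.  Hence (G1 (X t), G2 (Y t)) is the
end of a planar walk of unit speed with the same epochs and the same directions
([path_travel_time]).  As G1 and G2 are increasing, with derivatives 1 / c1 and
1 / c2 in the integrated sense, a density f of this end on an event becomes the
density f (G1 x, G2 y) / (c1 x * c2 y) of the position on the same event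
([travel_times_density]).

For the walk of unit speed, let [flight_value lam h k u z] be the expectation of
h at the end of a walk that starts from z and lasts for the time u, on the event
that the direction changes exactly k times.  Conditioning on the first flight
gives a recursion on k, and [flight_valueE] solves it: for k >= 1 the density of
the displacement is a constant times (u^2 - |z|^2)^(k/2 - 1) on the disk of
radius u.  For k = 1 the mean over two directions and the intermediate time is
computed in polar coordinates ([integral_two_directions]).  For the step from k
to k + 1, the kernel is integrated along the rays of the first flight, where
u^2 - |z|^2 is an affine function of the duration; what remains is the mean over
the circle of 1 / (u - z.e), which is 1 / sqrt (u^2 - |z|^2)
([integral_angle], [flight_kernel_step]).

The recursion does describe the random motion.  Up to null events, the epochs are
functions of the counting process, so that the interarrival times and the
directions, taken alternately, form a sequence of independent variables
([alternating_independent]); the state after n flights depends on the first 2 n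
of them.  Therefore the expectation of [flight_value] for the remaining time,
started from the state after n flights, does not depend on how the total number
of flights is divided into past and future ones ([expected_flight_value]), and
[integral_flight_end] gives the law of the end on the event N t = n.  With h = 1
it yields the Poisson probability of this event, whence the conditional density.

The sum over n >= 1 of the densities is an exponential series in
lam * sqrt (t^2 - G1^2 - G2^2), whose value is the density of the absolutely
continuous component ([motion_densityE]).  On the event N t = 0 the position lies
on the curve G1^2 + G2^2 = t^2, which is a null set because each of its sections
has at most two points ([wave_front_null]): this event carries the singular
component. *)

(** * Measurability of explicit functions *)

(** The rules are stated for functions written as abstractions, so that [meas] can
choose among them from the head symbol of the body. *)
Lemma fun_measurableD d (T : measurableType d) (R : realType) (f g : T -> R) :
  measurable_fun setT f -> measurable_fun setT g ->
  measurable_fun setT (fun x => f x + g x).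
Proof. exact: measurable_funD. Qed.

Lemma fun_measurableM d (T : measurableType d) (R : realType) (f g : T -> R) :
  measurable_fun setT f -> measurable_fun setT g ->
  measurable_fun setT (fun x => f x * g x).
Proof. exact: measurable_funM. Qed.

Lemma fun_measurableN d (T : measurableType d) (R : realType) (f : T -> R) :
  measurable_fun setT f -> measurable_fun setT (fun x => - f x).
Proof. exact: measurable_funN. Qed.

Lemma fun_measurableX d (T : measurableType d) (R : realType) (f : T -> R) n :
  measurable_fun setT f -> measurable_fun setT (fun x => f x ^+ n).
Proof. exact: measurable_funX. Qed.

Lemma fun_measurableV d (T : measurableType d) (R : realType) (f : T -> R) :
  measurable_fun setT f -> measurable_fun setT (fun x => (f x)^-1).
Proof.
move=> mf.
have mi : measurable_fun setT (@GRing.inv R).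
  have -> : [set: R] = [set~ 0] `|` [set 0] by rewrite setUC setUv.
  apply/measurable_funU => //; [exact: measurableC|split].
    apply: open_continuous_measurable_fun.
      by apply: closed_openC; exact: closed_eq.
    move=> x; rewrite inE/= => /eqP x0; exact: inv_continuous.
  exact: measurable_fun_set1.
exact: (measurableT_comp mi).
Qed.

Lemma fun_measurable_sqrt d (T : measurableType d) (R : realType) (f : T -> R) :
  measurable_fun setT f -> measurable_fun setT (fun x => Num.sqrt (f x)).
Proof.
move=> mf; apply: (measurableT_comp (f := @Num.sqrt R)) => //.
by apply: continuous_measurable_fun; exact: sqrt_continuous.
Qed.

Lemma fun_measurable_cos d (T : measurableType d) (R : realType) (f : T -> R) :
  measurable_fun setT f -> measurable_fun setT (fun x => cos (f x)).
Proof.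
move=> mf; apply: (measurableT_comp (f := @cos R)) => //.
by apply: continuous_measurable_fun; exact: continuous_cos.
Qed.

Lemma fun_measurable_sin d (T : measurableType d) (R : realType) (f : T -> R) :
  measurable_fun setT f -> measurable_fun setT (fun x => sin (f x)).
Proof.
move=> mf; apply: (measurableT_comp (f := @sin R)) => //.
by apply: continuous_measurable_fun; exact: continuous_sin.
Qed.

Lemma fun_measurable_expR d (T : measurableType d) (R : realType) (f : T -> R) :
  measurable_fun setT f -> measurable_fun setT (fun x => expR (f x)).
Proof. by move=> mf; apply: (measurableT_comp (f := @expR R)). Qed.

Lemma fun_measurable_EFin d (T : measurableType d) (R : realType) (f : T -> R) :
  measurable_fun setT f -> measurable_fun setT (fun x => (f x)%:E).
Proof. by move=> mf; apply/measurable_EFinP. Qed.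

Lemma fun_measurableMe d (T : measurableType d) (R : realType)
    (f g : T -> \bar R) :
  measurable_fun setT f -> measurable_fun setT g ->
  measurable_fun setT (fun x => f x * g x)%E.
Proof. exact: emeasurable_funM. Qed.

Lemma fun_measurable_if d (T : measurableType d) d' (U : measurableType d')
    (b : T -> bool) (f g : T -> U) :
  measurable_fun setT b -> measurable_fun setT f -> measurable_fun setT g ->
  measurable_fun setT (fun x => if b x then f x else g x).
Proof. exact: measurable_fun_ifT. Qed.

Lemma fun_measurable_and d (T : measurableType d) (f g : T -> bool) :
  measurable_fun setT f -> measurable_fun setT g ->
  measurable_fun setT (fun x => f x && g x).
Proof. exact: measurable_and. Qed.

Lemma fun_measurable_pair d (T : measurableType d) d1 (U : measurableType d1)
    d2 (V : measurableType d2) (f : T -> U) (g : T -> V) :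
  measurable_fun setT f -> measurable_fun setT g ->
  measurable_fun setT (fun x => (f x, g x)).
Proof. exact: measurable_fun_pair. Qed.

Lemma fun_measurable_fst d (T : measurableType d) d1 (U : measurableType d1)
    d2 (V : measurableType d2) (f : T -> U * V) :
  measurable_fun setT f -> measurable_fun setT (fun x => (f x).1).
Proof. by move=> mf; apply: (measurableT_comp measurable_fst). Qed.

Lemma fun_measurable_snd d (T : measurableType d) d1 (U : measurableType d1)
    d2 (V : measurableType d2) (f : T -> U * V) :
  measurable_fun setT f -> measurable_fun setT (fun x => (f x).2).
Proof. by move=> mf; apply: (measurableT_comp measurable_snd). Qed.

Ltac meas1 := match goal with
  | H : measurable_fun setT ?f |- measurable_fun _ ?f => exact H
  | |- measurable_fun _ fst => exact: measurable_fst
  | |- measurable_fun _ snd => exact: measurable_snd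
  | |- measurable_fun _ (fun x => x) => exact: measurable_id
  | |- measurable_fun _ (fun x => ?c) => exact: measurable_cst
  | |- measurable_fun _ (fun x => (_, _)) => apply: fun_measurable_pair
  | |- measurable_fun _ (fun x => (_).1) => apply: fun_measurable_fst
  | |- measurable_fun _ (fun x => (_).2) => apply: fun_measurable_snd
  | |- measurable_fun _ (fun x => EFin _) => apply: fun_measurable_EFin
  | |- measurable_fun _ (fun x => mule _ _) => apply: fun_measurableMe
  | |- measurable_fun _ (fun x => GRing.mul _ _) => apply: fun_measurableM
  | |- measurable_fun _ (fun x => GRing.opp _) => apply: fun_measurableN
  | |- measurable_fun _ (fun x => GRing.inv _) => apply: fun_measurableV
  | |- measurable_fun _ (fun x => GRing.exp _ _) => apply: fun_measurableX
  | |- measurable_fun _ (fun x => Num.sqrt _) => apply: fun_measurable_sqrt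
  | |- measurable_fun _ (fun x => cos _) => apply: fun_measurable_cos
  | |- measurable_fun _ (fun x => sin _) => apply: fun_measurable_sin
  | |- measurable_fun _ (fun x => expR _) => apply: fun_measurable_expR
  | |- measurable_fun _ (fun x => andb _ _) => apply: fun_measurable_and
  | |- measurable_fun _ (fun x => (_ < _)%R) => apply: measurable_fun_ltr
  | |- measurable_fun _ (fun x => (_ <= _)%R) => apply: measurable_fun_ler
  | H : measurable_fun setT ?h |- measurable_fun _ (fun x => ?h _) =>
      apply: (measurableT_comp H)
  | |- measurable_fun _ (fun x => Algebra.add _ _) =>
      apply: fun_measurableD
  | |- measurable_fun _ (fun x => match _ with true => _ | false => _ end) =>
      apply: fun_measurable_if
  | |- @measurable_fun _ _ ?T _ _ ?f =>
      lazymatch f with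
      | (fun _ => _) => fail
      | _ => change f with (fun x : T => f x)
      end
  end.
Ltac meas := repeat meas1.

(** * Measures given by a density or as an image *)

Section weighted.
Local Open Scope ereal_scope.
Context d (T : measurableType d) (R : realType).
Variables (mu : {measure set T -> \bar R}) (p : T -> R).
Hypothesis (mp : measurable_fun setT p) (p0 : forall x, (0 <= p x)%R).

Definition weighted_set (A : set T) : \bar R := \int[mu]_(x in A) (p x)%:E.

Let weighted0 : weighted_set set0 = 0.
Proof. by rewrite /weighted_set integral_set0. Qed.

Let weighted_ge0 A : 0 <= weighted_set A.
Proof. by apply: integral_ge0 => x _; rewrite lee_fin. Qed.

Let weighted_sigma_additive : semi_sigma_additive weighted_set.
Proof.
move=> /= F mF tF mUF; rewrite /weighted_set; apply: cvg_toP.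
  apply: ereal_nondecreasing_is_cvgn => m n mn.
  apply: lee_sum_nneg_natr => // k _ _; apply: integral_ge0 => /= x Fkx.
  by rewrite lee_fin.
rewrite ge0_integral_bigcup//=.
- by apply/measurable_funTS/measurable_EFinP.
- by move=> x _; rewrite lee_fin.
Qed.

(** A density turned into a measure, so that two measures given by densities can
be compared by the uniqueness theorem for measures. *)
Definition weighted : {measure set T -> \bar R} :=
  HB.pack weighted_set
    (isMeasure.Build _ _ _ weighted_set weighted0 weighted_ge0
       weighted_sigma_additive).

End weighted.

Section density.
Local Open Scope ereal_scope.
Context d (T : measurableType d) (R : realType).
Variables (mu nu : {measure set T -> \bar R}) (p : T -> R).
Hypothesis (mp : measurable_fun setT p) (p0 : forall x, (0 <= p x)%R).
Hypothesis nuE : forall A, measurable A -> nu A = \int[mu]_(x in A) (p x)%:E.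

Import HBNNSimple.

Let integral_density_indic E : measurable E ->
  \int[nu]_x (\1_E x)%:E = \int[mu]_x ((p x)%:E * (\1_E x)%:E).
Proof.
move=> mE; rewrite integral_indic//= setIT nuE//.
rewrite integral_mkcond; apply: eq_integral => x _.
by rewrite patchE indicE; case: ifPn => _; rewrite ?mule1 ?mule0.
Qed.

Let integral_density_nnsfun (f : {nnsfun T >-> R}) :
  \int[nu]_x (f x)%:E = \int[mu]_x ((p x)%:E * (f x)%:E).
Proof.
under [LHS]eq_integral do rewrite fimfunE -fsumEFin//.
rewrite [LHS]ge0_integral_fsum//; last 2 first.
  - by move=> r; exact/measurable_EFinP/measurableT_comp.
  - by move=> n x _; rewrite EFinM nnfun_muleindic_ge0.
under [RHS]eq_integral.
  move=> x xD; rewrite fimfunE -fsumEFin// ge0_mule_fsumr; last first.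
    by move=> r; rewrite EFinM nnfun_muleindic_ge0.
  over.
rewrite [RHS]ge0_integral_fsum//; last 2 first.
  - move=> r; apply: emeasurable_funM; first exact/measurable_EFinP.
    exact/measurable_EFinP/measurableT_comp.
  - move=> n x _; apply: mule_ge0; first by rewrite lee_fin.
    by rewrite EFinM nnfun_muleindic_ge0.
apply: eq_fsbigr => r _.
rewrite integralZl_indic_nnsfun//= integral_density_indic//.
under [RHS]eq_integral do rewrite EFinM muleCA.
have [r0|r0] := leP 0%R r.
  rewrite ge0_integralZl//.
  - by apply: emeasurable_funM; exact/measurable_EFinP.
  - by move=> x _; rewrite mule_ge0 ?lee_fin.
rewrite preimage_nnfun0//; under eq_integral do rewrite indic0 mule0.
by under [RHS]eq_integral do rewrite indic0 !mule0; rewrite integral0 mule0.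
Qed.

(** By linearity from indicators to simple functions, then by monotone
convergence. *)
Lemma ge0_integral_density (f : T -> \bar R) :
  measurable_fun setT f -> (forall x, 0 <= f x) ->
  \int[nu]_x f x = \int[mu]_x ((p x)%:E * f x).
Proof.
move=> mf f0.
pose f_ := nnsfun_approx measurableT mf.
transitivity (limn (fun n => \int[nu]_x (f_ n x)%:E)).
  rewrite -monotone_convergence//=.
  - by apply: eq_integral => x _; apply/esym/cvg_lim => //; exact: cvg_nnsfun_approx.
  - by move=> n; exact/measurable_EFinP/measurable_funTS.
  - by move=> n ? _; rewrite lee_fin.
  - by move=> ? _ ? ? mn; rewrite lee_fin; exact/lefP/nd_nnsfun_approx.
transitivity (limn (fun n => \int[mu]_x ((p x)%:E * (f_ n x)%:E))).
  by apply: congr_lim; apply/funext => n; exact: integral_density_nnsfun.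
rewrite -monotone_convergence//=.
- apply: eq_integral => x _; apply/cvg_lim => //.
  apply: cvgeZl => //; exact: cvg_nnsfun_approx.
- move=> n; apply: emeasurable_funM; first exact/measurable_EFinP.
  exact/measurable_EFinP.
- by move=> n x _; rewrite mule_ge0 ?lee_fin.
- move=> x _ m n mn; rewrite lee_wpmul2l ?lee_fin//.
  exact/lefP/nd_nnsfun_approx.
Qed.

End density.

Section image_measure.
Context d d' (T : measurableType d) (U : measurableType d') (R : realType).
Variables (m : {measure set T -> \bar R}) (f : T -> U).
Hypothesis mf : measurable_fun setT f.

Definition image_measure : {measure set U -> \bar R} :=
  measure_function_pushforward__canonical__measure_function_Measure m mf.

Lemma ge0_integral_image (h : U -> \bar R) :
  measurable_fun setT h -> (forall x, 0 <= h x)%E ->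
  (\int[image_measure]_y h y = \int[m]_x h (f x))%E.
Proof. by move=> mh h0; rewrite (ge0_integral_pushforward mf). Qed.

End image_measure.

(** * Substitution in one-dimensional integrals *)

Section ge0_substitution.
Context {R : realType}.
Notation mu := (@lebesgue_measure R).
Variables (a b : R) (F f : R -> R).
Hypotheses (ab : a <= b) (mf : measurable_fun `]a, b] f)
  (f_gt0 : forall x, a < x -> x <= b -> 0 < f x)
  (FE : forall u v, a <= u -> u <= v -> v <= b ->
     (\int[mu]_(x in `]u, v]) (f x)%:E = (F v - F u)%:E)%E).

Let mfuv u v : a <= u -> v <= b -> measurable_fun `]u, v] (EFin \o f).
Proof.
move=> au vb; apply/measurable_EFinP; apply: measurable_funS mf => //.
move=> x /=; rewrite !in_itv/= => /andP[ux xv].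
by rewrite (le_lt_trans au)// (le_trans xv).
Qed.

(** If F did not increase from u to v, the positive function f would vanish almost
everywhere on an interval of positive length. *)
Lemma primitive_increasing u v : a <= u -> u < v -> v <= b -> F u < F v.
Proof.
move=> au uv vb; rewrite -subr_gt0 -lte_fin -FE ?(ltW uv)// lt0e.
apply/andP; split; last first.
  apply: integral_ge0 => x /=; rewrite in_itv/= => /andP[ux xv].
  by rewrite lee_fin ltW// f_gt0 ?(le_lt_trans au)// (le_trans xv).
apply/eqP => I0.
have : ae_eq mu `]u, v]%classic (EFin \o f) (cst 0%E).
  apply/ae_eq_integral_abs => //; first exact: mfuv.
  rewrite -[RHS]I0; apply: eq_integral => x; rewrite inE/= in_itv/=.
  move=> /andP[ux xv]; rewrite gtr0_norm//.
  by rewrite f_gt0 ?(le_lt_trans au)// (le_trans xv).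
move=> [N [mN N0 sub]].
have : (mu `]u, v]%classic <= mu N)%E.
  apply: le_measure; rewrite ?inE//.
  move=> x /=; rewrite in_itv/= => /andP[ux xv]; apply: sub => /=.
  rewrite in_itv/= ux xv => /(_ isT) [fx0].
  have := f_gt0 (le_lt_trans au ux) (le_trans xv vb).
  by rewrite fx0 ltxx.
rewrite N0 lebesgue_measure_itv/= lte_fin uv -EFinD lee_fin.
by rewrite leNgt subr_gt0 uv.
Qed.

Lemma primitive_nondecreasing u v : a <= u -> u <= v -> v <= b -> F u <= F v.
Proof.
rewrite le_eqVlt => au; rewrite le_eqVlt => /predU1P[->//|uv vb].
by rewrite ltW// primitive_increasing// le_eqVlt.
Qed.

Let f_integrable : mu.-integrable `[a, b] (EFin \o f).
Proof.
have H : measurable_fun `[a, b] f.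
  by apply/measurable_fun_itv_obnd_cbndP.
apply/integrableP; split; first exact/measurable_EFinP.
have -> : (\int[mu]_(x in `[a, b]) `|(EFin \o f) x| = (F b - F a)%:E)%E.
  rewrite -(FE (lexx a) ab (lexx b)) integral_itv_obnd_cbnd; last exact: mfuv.
  rewrite -integral_itv_obnd_cbnd; last first.
    by apply: measurableT_comp => //; exact: mfuv.
  rewrite -[RHS]integral_itv_obnd_cbnd; last exact: mfuv.
  apply: eq_integral => x; rewrite inE/= in_itv/= => /andP[ax xb].
  by rewrite gtr0_norm ?f_gt0.
exact: ltry.
Qed.

Lemma primitive_continuous : {within `[a, b], continuous F}.
Proof.
have := parameterized_integral_continuous ab f_integrable.
move=> cI.
have : {within `[a, b], continuous
  ((fun x => F a + parameterized_integral mu a x f) : R -> R)}.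
  move=> x; apply: (@cvgD _ _ _ _ _ (cst (F a)) (parameterized_integral mu a ^~ f)).
    exact: cvg_cst.
  exact: cI.
apply: subspace_eq_continuous => x; rewrite inE/= in_itv/= => /andP[ax xb].
rewrite /from_subspace /parameterized_integral /Rintegral.
rewrite -integral_itv_obnd_cbnd; last exact: mfuv.
by rewrite [X in fine X](FE _ _ _)//= addrC subrK.
Qed.

(** The function f stands for a slowness 1 / c or a speed along a path, which is
only measurable, so that F need not be differentiable everywhere.  The
image under F of the measure of density f on ]a, b] is compared with the Lebesgue
measure on ]F a, F b]: by the intermediate value theorem they agree on all
half-lines, so they are equal. *)
Lemma ge0_integral_substitution (h : R -> \bar R) :
  measurable_fun setT h -> (forall x, 0 <= h x)%E ->
  (\int[mu]_(x in `]a, b]) ((f x)%:E * h (F x)) =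
   \int[mu]_(u in `]F a, F b]) h u)%E.
Proof.
move=> mh h0.
(* F is extended by constants outside [a, b], to be monotone, hence measurable,
   on the whole line. *)
pose Fc x := F (Num.max a (Num.min x b)).
have Fc_nd : nondecreasing_fun Fc.
  move=> x y xy; apply: primitive_nondecreasing.
  - by rewrite le_max lexx.
  - rewrite ge_max le_max lexx/= le_max; apply/orP; right.
    by rewrite le_min !ge_min xy lexx orbT.
  - by rewrite ge_max ab ge_min lexx orbT.
have mFc : measurable_fun setT Fc by exact: nondecreasing_measurable.
have FcE x : a < x -> x <= b -> Fc x = F x.
  by move=> ax xb; rewrite /Fc min_l// max_r// ltW.
pose f1 := f \_ `]a, b].
have mf1 : measurable_fun setT f1 by apply/(measurable_restrictT f) => //; exact: mf.
have f10 x : 0 <= f1 x.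
  rewrite /f1 patchE; case: ifPn => //; rewrite inE/= in_itv/=.
  by move=> /andP[ax xb]; rewrite ltW// f_gt0.
pose m := weighted mu mf1 f10.
have mE A : m A = (\int[mu]_(x in A `&` `]a, b]) (f x)%:E)%E.
  rewrite /m /= /weighted_set integral_mkcondr; apply: eq_integral => x xA.
  by rewrite /f1 !patchE; case: ifPn.
pose nu' := mrestr mu (measurable_itv `]F a, F b]).
have FaFb : F a <= F b by exact: primitive_nondecreasing.
pose nu := @image_measure _ _ (measurableTypeR R) (measurableTypeR R) R m Fc mFc.
have finE q : nu `]-oo, q[%classic = nu' `]-oo, q[%classic.
  rewrite -[LHS]/(m (Fc @^-1` `]-oo, q[)) mE /nu' /mrestr.
  have [qa|aq] := leP q (F a).
    rewrite (_ : _ `&` _ = set0) ?integral_set0; last first.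
      apply/seteqP; split => // x /=; rewrite !in_itv/= => -[xq /andP[ax xb]].
      move: xq; rewrite FcE//; apply/negP; rewrite -leNgt (le_trans qa)//.
      by rewrite ltW// primitive_increasing.
    rewrite (_ : _ `&` _ = set0) ?measure0//.
    apply/seteqP; split => // x /=; rewrite !in_itv/= => -[xq /andP[ax xb]].
    by have := le_lt_trans qa (lt_trans ax xq); rewrite ltxx.
  have [bq|qb] := ltP (F b) q.
    rewrite (_ : _ `&` _ = `]a, b]%classic); last first.
      apply/seteqP; split => x /=; rewrite !in_itv/=; [by case|move=> /andP[ax xb]].
      rewrite FcE// ax xb; split=> //; rewrite (le_lt_trans _ bq)//.
      by rewrite primitive_nondecreasing// ltW.
    rewrite FE// (_ : _ `&` _ = `]F a, F b]%classic); last first.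
      apply/seteqP; split => x /=; rewrite !in_itv/=; [by case|move=> /andP[ax xb]].
      by rewrite ax xb; split=> //; rewrite (le_lt_trans _ bq).
    rewrite lebesgue_measure_itv/= lte_fin; case: ltP => //.
    by move=> ba; rewrite (_ : F b = F a) ?subrr//; apply/eqP; rewrite eq_le ba FaFb.
  have [v vab Fv] : exists2 v, v \in `[a, b]%R & F v = q.
    apply: (IVT ab primitive_continuous).
    by rewrite (min_l FaFb) (max_r FaFb) (ltW aq) qb.
  move: vab; rewrite in_itv/= => /andP[av vb].
  have av' : a < v.
    rewrite lt_neqAle av andbT; apply/eqP => av'.
    by move: aq; rewrite -Fv av' ltxx.
  rewrite (_ : _ `&` _ = `]a, v[%classic); last first.
    apply/seteqP; split => x /=; rewrite !in_itv/=.
      move=> [+ /andP[ax xb]]; rewrite FcE// ax/= -Fv => Fxv.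
      rewrite ltNge; apply/negP => vx; have := lt_le_trans Fxv.
      by move=> /(_ _ (primitive_nondecreasing av vx xb)); rewrite ltxx.
    move=> /andP[ax xv]; have xb := le_trans (ltW xv) vb.
    by rewrite FcE// ax xb -Fv primitive_increasing// ltW.
  rewrite integral_itv_bndo_bndc; last first.
    apply: measurable_funS (mfuv (lexx a) vb) => //.
    by move=> x /=; rewrite !in_itv/= => /andP[-> /ltW].
  rewrite FE// (_ : _ `&` _ = `]F a, F v[%classic); last first.
    apply/seteqP; split => x /=; rewrite !in_itv/= Fv.
      by move=> [-> /andP[-> _]].
    by move=> /andP[ax xq]; rewrite xq ax (le_trans (ltW xq) qb).
  by rewrite lebesgue_measure_itv/= lte_fin Fv aq.
have nuE A : measurable A -> nu A = nu' A.
  move=> mA; refine (@measure_unique _ R (measurableTypeR R) _ (fun n => `]-oo, n%:R[%classic) (RGenInftyO.measurableE R) _ _ _ nu nu' _ _ A mA).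
  - move=> _ _ [x ->] [y ->]; exists (Num.min x y).
    apply/seteqP; split => z /=; rewrite !in_itv/= lt_min.
      by move=> [-> ->].
    by move=> /andP[].
  - by move=> n; exists n%:R.
  - apply/seteqP; split => // x _; exists (Num.truncn `|x|).+1 => //=; rewrite in_itv/=.
    by rewrite (le_lt_trans (ler_norm x))// truncnS_gt.
  - by move=> _ [x ->]; exact: finE.
  - move=> n; rewrite finE /nu' /mrestr.
    apply: (@le_lt_trans _ _ (mu `]F a, F b]%classic)).
      by apply: le_measure; rewrite ?inE//; exact: measurableI.
    by rewrite lebesgue_measure_itv/=; case: ifP => _; rewrite ?ltry// -EFinD ltry.
transitivity (\int[m]_x h (Fc x))%E.
  rewrite (@ge0_integral_density _ _ _ mu m f1)//; last first.
    exact: measurableT_comp.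
  rewrite [LHS]integral_mkcond; apply: eq_integral => x _.
  rewrite /f1 !patchE; case: ifPn => [|_]; last by rewrite mul0e.
  by rewrite inE/= in_itv/= => /andP[ax xb]; rewrite FcE.
transitivity (\int[nu]_y h y)%E.
  by rewrite ge0_integral_image.
transitivity (\int[nu']_y h y)%E.
  by apply: eq_measure_integral => A mA _; exact: nuE.
have mI : measurable `]F a, F b]%classic by exact: measurable_itv.
rewrite (@ge0_integral_density _ _ _ mu nu' (\1_(`]F a, F b]%classic)))//; last first.
  by move=> A mA; rewrite integral_indic// setIC.
rewrite [RHS]integral_mkcond; apply: eq_integral => x _.
by rewrite patchE indicE; case: ifPn => _; rewrite ?mul1e ?mul0e.
Qed.
End ge0_substitution.

Section smooth_substitution.
Context {R : realType}.
Notation mu := (@lebesgue_measure R).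
Implicit Types (F f : R -> R) (h : R -> \bar R).

Lemma integral_is_derive F f (u v : R) :
  (forall x : R, is_derive x (1 : R) F (f x)) -> continuous f -> u <= v ->
  (\int[mu]_(x in `]u, v]) (f x)%:E = (F v - F u)%:E)%E.
Proof.
move=> dF cf; rewrite le_eqVlt => /predU1P[->|uv].
  by rewrite set_itvoc0 integral_set0 subrr.
have mf : measurable_fun setT f by exact: continuous_measurable_fun.
rewrite integral_itv_obnd_cbnd; last first.
  by apply/measurable_EFinP; exact: measurable_funTS.
have cF : continuous F.
  move=> x; apply: differentiable_continuous; apply/derivable1_diffP.
  by have [] := dF x.
rewrite (@continuous_FTC2 _ f F)//.
- exact: continuous_subspaceT.
- split.
  + by move=> x _; have [] := dF x.
  + by apply/cvg_at_right_filter; exact: cF.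
  + by apply/cvg_at_left_filter; exact: cF.
- by move=> x _; rewrite derive1E; have [_] := dF x.
Qed.

Lemma ge0_integral_substitution_smooth F f (a b : R) h :
  (forall x : R, is_derive x (1 : R) F (f x)) -> continuous f ->
  a <= b -> (forall x, a < x -> x <= b -> 0 < f x) ->
  measurable_fun setT h -> (forall x, 0 <= h x)%E ->
  (\int[mu]_(x in `]a, b]) ((f x)%:E * h (F x)) =
   \int[mu]_(u in `]F a, F b]) h u)%E.
Proof.
move=> dF cf ab f0 mh h0; apply: ge0_integral_substitution => //.
  by apply: measurable_funTS; exact: continuous_measurable_fun.
by move=> u v _ uv _; exact: integral_is_derive.
Qed.

(** The line is the increasing union of the intervals ]-n, n], and the range of F
that of the intervals ]F (-n), F n]. *)
Lemma ge0_integral_primitiveT F f h :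
  measurable_fun setT f -> (forall x, 0 < f x) ->
  (forall u v, u <= v ->
     (\int[mu]_(x in `]u, v]) (f x)%:E = (F v - F u)%:E)%E) ->
  measurable_fun setT h -> (forall x, 0 <= h x)%E ->
  (\int[mu]_x ((f x)%:E * h (F x)) = \int[mu]_(u in range F) h u)%E.
Proof.
move=> mf f0 FE mh h0.
have mfD (D : set R) : measurable_fun D f by exact: measurable_funTS.
have incF u v : u < v -> F u < F v.
  move=> uv; apply: (@primitive_increasing _ u v F f) => // w z _ wz _; exact: FE.
have ndF u v : u <= v -> F u <= F v.
  by rewrite le_eqVlt => /predU1P[->//|/incF/ltW].
have mF : measurable_fun setT F by exact: nondecreasing_measurable.
pose J (n : nat) := `](- n%:R : R), n%:R]%classic.
pose K (n : nat) := `]F (- n%:R), F n%:R]%classic.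
have JT : \bigcup_n J n = setT.
  apply/seteqP; split => // x _; exists (Num.truncn `|x|).+1 => //=.
  have := truncnS_gt `|x|; rewrite /J/= in_itv/= ltr_norml => /andP[-> /ltW].
  by [].
have KT : \bigcup_n K n = range F.
  apply/seteqP; split => [y [n _]|_ [x _ <-]].
    rewrite /K/= in_itv/= => /andP[ay yb].
    have [c _ <-] : exists2 c, c \in `[- n%:R : R, n%:R]%R & F c = y.
      apply: IVT; first by rewrite ge0_cp.
        by apply: (@primitive_continuous _ _ _ F f) => // [|*];
          [rewrite ge0_cp|exact: FE].
      by rewrite ge_min le_max (ltW ay) yb orbT.
    by exists c.
  have : (\bigcup_n J n) x by rewrite JT.
  move=> [n _]; rewrite /J/= in_itv/= => /andP[nx xn]; exists n => //=.
  by rewrite /K/= in_itv/= incF//= ndF.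
have natd m n : (m <= n)%N -> (m%:R <= n%:R :> R) by rewrite ler_nat.
have Jnd : nondecreasing_seq J.
  move=> m n mn; apply/subsetPset => x; rewrite /J/= !in_itv/= => /andP[mx xm].
  by rewrite (le_lt_trans _ mx) ?lerN2 ?natd// (le_trans xm)// natd.
have Knd : nondecreasing_seq K.
  move=> m n mn; apply/subsetPset => x; rewrite /K/= !in_itv/= => /andP[mx xm].
  rewrite (le_lt_trans _ mx) ?ndF ?lerN2 ?natd// (le_trans xm)//.
  by rewrite ndF// natd.
have mfh : measurable_fun setT (fun x => (f x)%:E * h (F x))%E.
  apply: emeasurable_funM; first exact/measurable_EFinP.
  exact: measurableT_comp.
have cJ : (\int[mu]_(x in J n) ((f x)%:E * h (F x)))%E @[n --> \oo] -->
    (\int[mu]_x ((f x)%:E * h (F x)))%E.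
  rewrite -JT; apply: ge0_nondecreasing_set_cvg_integral => //.
    by move=> i; exact: measurable_itv.
    by move=> i; exact: measurable_funTS.
  by move=> i x _; rewrite mule_ge0// lee_fin ltW.
have cK : (\int[mu]_(x in K n) h x)%E @[n --> \oo] -->
    (\int[mu]_(x in range F) h x)%E.
  rewrite -KT; apply: ge0_nondecreasing_set_cvg_integral => //.
    by move=> i; exact: measurable_itv.
  by move=> i; exact: measurable_funTS.
rewrite (_ : (fun n => _) = (fun n => \int[mu]_(x in K n) h x)%E) in cJ.
  exact: (cvg_unique (@ereal_hausdorff R) cJ cK).
apply/funext => n; apply: ge0_integral_substitution => //.
- by rewrite ge0_cp.
- by move=> *; exact: FE.
Qed.

Lemma ge0_integral_substitutionT F f h :
  (forall x : R, is_derive x (1 : R) F (f x)) -> continuous f -> (forall x, 0 < f x) ->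
  measurable_fun setT h -> (forall x, 0 <= h x)%E ->
  (\int[mu]_x ((f x)%:E * h (F x)) = \int[mu]_(u in range F) h u)%E.
Proof.
move=> dF cf f0 mh h0; apply: ge0_integral_primitiveT => //.
  exact: continuous_measurable_fun.
by move=> u v; exact: integral_is_derive.
Qed.

End smooth_substitution.

(** * Iterated integrals and invariances of the Lebesgue measure *)

Section tonelli_on.
Local Open Scope ereal_scope.
Context d1 d2 (T1 : measurableType d1) (T2 : measurableType d2) (R : realType).
Variables (m1 : {sigma_finite_measure set T1 -> \bar R})
  (m2 : {sigma_finite_measure set T2 -> \bar R}).
Variables (D1 : set T1) (D2 : set T2) (f : T1 -> T2 -> \bar R).
Hypotheses (mD1 : measurable D1) (mD2 : measurable D2).
Hypotheses (mf : measurable_fun setT (fun p : T1 * T2 => f p.1 p.2))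
  (f0 : forall x y, 0 <= f x y).

Let g := (fun p : T1 * T2 => f p.1 p.2) \_ (D1 `*` D2).

Let mg : measurable_fun setT g.
Proof.
apply/(measurable_restrictT _ _).1; first exact: measurableX.
exact: measurable_funTS.
Qed.

Let g0 p : 0 <= g p.
Proof. by rewrite /g patchE; case: ifPn. Qed.

(** The integrand is extended by 0 outside the rectangle. *)
Lemma tonelli_on :
  \int[m1]_(x in D1) \int[m2]_(y in D2) f x y =
  \int[m2]_(y in D2) \int[m1]_(x in D1) f x y.
Proof.
transitivity (\int[m1]_x \int[m2]_y g (x, y)).
  rewrite integral_mkcond; apply: eq_integral => x _.
  rewrite patchE; case: ifPn => xD.
    rewrite integral_mkcond; apply: eq_integral => y _.
    by rewrite /g !patchE in_setX xD.
  rewrite integral0_eq// => y _.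
  by rewrite /g patchE in_setX (negbTE xD).
rewrite (fubini_tonelli g mg g0).
rewrite [RHS]integral_mkcond; apply: eq_integral => y _.
rewrite patchE; case: ifPn => yD.
  rewrite [RHS]integral_mkcond; apply: eq_integral => x _.
  by rewrite /g !patchE in_setX yD andbT.
by rewrite integral0_eq// => x _; rewrite /g patchE in_setX (negbTE yD) andbF.
Qed.

End tonelli_on.

Lemma measurable_integral_param d1 d2 (T1 : measurableType d1)
    (T2 : measurableType d2) (R : realType)
    (m2 : {sigma_finite_measure set T2 -> \bar R}) (D2 : set T2)
    (f : T1 -> T2 -> \bar R) :
  measurable D2 -> measurable_fun setT (fun p : T1 * T2 => f p.1 p.2) ->
  (forall x y, 0 <= f x y)%E ->
  measurable_fun setT (fun x => \int[m2]_(y in D2) f x y)%E.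
Proof.
move=> mD2 mf f0.
pose g := (fun p : T1 * T2 => f p.1 p.2) \_ (setT `*` D2).
have mg : measurable_fun setT g.
  apply/(measurable_restrictT _ _).1; first exact: measurableX.
  exact: measurable_funTS.
have g0 p : (0 <= g p)%E by rewrite /g patchE; case: ifPn.
rewrite (_ : (fun _ => _) = fubini_F m2 g).
  exact: measurable_fun_fubini_tonelli_F.
apply/funext => x; rewrite integral_mkcond; apply: eq_integral => y _.
by rewrite /g !patchE in_setX in_setT.
Qed.

Section invariance.
Context {R : realType}.
Notation mu := (@lebesgue_measure R).
Implicit Types (h : R -> \bar R).

Lemma ge0_integral_shift_itv h (a u v : R) :
  u <= v -> measurable_fun setT h -> (forall x, 0 <= h x)%E ->
  (\int[mu]_(x in `]u, v]) h (x + a)%R = \int[mu]_(x in `](u + a)%R, (v + a)%R]) h x)%E.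
Proof.
move=> uv mh h0.
have dF (x : R) : is_derive x (1 : R) (fun x => x + a) (1 : R).
  by rewrite -[X in is_derive _ _ _ X]addr0; exact: is_deriveD.
rewrite -(ge0_integral_substitution_smooth dF)//; last exact: cst_continuous.
by apply: eq_integral => x _; rewrite mul1e.
Qed.

Lemma ge0_integral_shift h (a : R) :
  measurable_fun setT h -> (forall x, 0 <= h x)%E ->
  (\int[mu]_x h (x + a)%R = \int[mu]_x h x)%E.
Proof.
move=> mh h0.
have dF (x : R) : is_derive x (1 : R) (fun x => x + a) (1 : R).
  by rewrite -[X in is_derive _ _ _ X]addr0; exact: is_deriveD.
have := @ge0_integral_substitutionT _ _ _ h dF.
have rT : range (fun x : R => x + a) = setT.
  by apply/seteqP; split => // x _; exists (x - a) => //; rewrite subrK.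
rewrite rT.
move=> <-//; last exact: cst_continuous.
by apply: eq_integral => x _; rewrite mul1e.
Qed.

Lemma ge0_integral_scale h (c : R) : 0 < c ->
  measurable_fun setT h -> (forall x, 0 <= h x)%E ->
  (\int[mu]_x (c%:E * h (c * x)%R) = \int[mu]_x h x)%E.
Proof.
move=> c0 mh h0.
have dF (x : R) : is_derive x (1 : R) (fun x => c * x) (c : R).
  have := @is_deriveZ R R R id c x 1 1 (is_derive_id x 1).
  by rewrite /GRing.scale/= mulr1.
have := @ge0_integral_substitutionT _ _ _ h dF.
have rT : range (fun x : R => c * x) = setT.
  by apply/seteqP; split => // x _; exists (c^-1 * x) => //; rewrite mulVKf ?gt_eqF.
rewrite rT.
by move=> <-//; exact: cst_continuous.
Qed.

Lemma ge0_integral_scale_gt0 h (c : R) : 0 < c ->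
  measurable_fun setT h -> (forall x, 0 <= h x)%E ->
  (\int[mu]_(x in `]0%R, +oo[) (c%:E * h (c * x)%R) =
   \int[mu]_(x in `]0%R, +oo[) h x)%E.
Proof.
move=> c0 mh h0.
rewrite [LHS]integral_mkcond [RHS]integral_mkcond.
rewrite -[RHS](@ge0_integral_scale _ c)//.
- apply: eq_integral => x _; rewrite !patchE !mem_setE !in_itv/= !andbT.
  by rewrite pmulr_rgt0//; case: ifPn => //; rewrite mule0.
- by apply/(measurable_restrictT _ _).1 => //; exact: measurable_funTS.
- by move=> x; rewrite patchE; case: ifPn.
Qed.

Lemma ge0_integral_opp h :
  measurable_fun setT h -> (forall x, 0 <= h x)%E ->
  (\int[mu]_x h (- x)%R = \int[mu]_x h x)%E.
Proof.
move=> mh h0.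
have mN : measurable_fun [set: measurableTypeR R] (-%R : R -> measurableTypeR R).
  exact: oppr_measurable.
transitivity (\int[image_measure mu mN]_x h x)%E.
  by rewrite ge0_integral_image.
by apply: eq_measure_integral => A mA _; exact: lebesgue_measureN.
Qed.

Lemma ge0_integral_opp_itv h (a b : R) :
  measurable_fun setT h -> (forall x, 0 <= h x)%E ->
  (\int[mu]_(x in `]a, b]) h (- x)%R = \int[mu]_(x in `](- b)%R, (- a)%R]) h x)%E.
Proof.
move=> mh h0.
have mhN : measurable_fun setT (fun x : R => h (- x)) by meas.
rewrite -[LHS]integral_itv_bndo_bndc; last exact: measurable_funTS.
rewrite -[RHS]integral_itv_bndo_bndc; last exact: measurable_funTS.
rewrite [LHS]integral_mkcond [RHS]integral_mkcond -[RHS]ge0_integral_opp; last 2 first.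
- by apply/(measurable_restrictT _ _).1 => //; exact: measurable_funTS.
- by move=> x; rewrite patchE; case: ifPn.
apply: eq_integral => x _; rewrite !patchE !mem_setE !in_itv/=.
by rewrite !ltrN2 andbC.
Qed.

Lemma ge0_integral_atan h :
  measurable_fun setT h -> (forall x, 0 <= h x)%E ->
  (\int[mu]_x ((1 + x ^+ 2)^-1%:E * h (atan x)) =
   \int[mu]_(x in `](- (pi / 2))%R, (pi / 2)%R[) h x)%E.
Proof.
move=> mh h0.
rewrite (ge0_integral_substitutionT (@is_derive1_atan R))//.
- congr (integral mu _ h); apply/seteqP; split => [_ [x _ <-]|x /=].
    by rewrite /= in_itv/= atan_gtNpi2 atan_ltpi2.
  by move=> xpi; exists (tan x) => //; exact: tanK.
- move=> x; apply: (@continuous_comp _ _ _ (fun x : R => 1 + x ^+ 2) GRing.inv).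
    by apply: continuousD; [exact: cst_continuous|exact: exprn_continuous].
  by apply: inv_continuous; rewrite gt_eqF// ltr_pwDl// sqr_ge0.
- by move=> x; rewrite invr_gt0 ltr_pwDl// sqr_ge0.
Qed.

Lemma ge0_integral_itv_split h (u v w : R) : u <= v -> v <= w ->
  measurable_fun setT h -> (forall x, 0 <= h x)%E ->
  (\int[mu]_(x in `]u, w]) h x =
   \int[mu]_(x in `]u, v]) h x + \int[mu]_(x in `]v, w]) h x)%E.
Proof.
move=> uv vw mh h0; rewrite -ge0_integral_setU//=.
- by rewrite -itv_bndbnd_setU// bnd_simp.
- exact: measurable_funTS.
- rewrite disj_set2E; apply/eqP; rewrite -subset0 => x []/=.
  by rewrite !in_itv/= => /andP[_ xv] /andP[/lt_le_trans/(_ xv)]; rewrite ltxx.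
Qed.

Lemma ge0_integral_periodic h (p a : R) : 0 <= a -> a <= p ->
  measurable_fun setT h -> (forall x, 0 <= h x)%E ->
  (forall x, h (x + p)%R = h x) ->
  (\int[mu]_(x in `]0%R, p]) h (x + a)%R = \int[mu]_(x in `]0%R, p]) h x)%E.
Proof.
move=> a0 ap mh h0 hp.
have p0 := le_trans a0 ap.
rewrite ge0_integral_shift_itv// add0r (@ge0_integral_itv_split h a p)//; last first.
  by rewrite lerDl.
rewrite (@ge0_integral_itv_split h 0 a p)// addeC; congr (_ + _)%E.
rewrite -{1}[p]add0r [p + a]addrC -ge0_integral_shift_itv//.
by apply: eq_integral => x _; rewrite hp.
Qed.

Lemma ge0_integral_half_lines h :
  measurable_fun setT h -> (forall x, 0 <= h x)%E ->
  (\int[mu]_x h x = \int[mu]_(x in `]0%R, +oo[) h x +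
                    \int[mu]_(x in `]0%R, +oo[) h (- x)%R)%E.
Proof.
move=> mh h0.
rewrite -{1}(setUv `]0%R, +oo[%classic) ge0_integral_setU//=; last 3 first.
- exact: measurableC.
- by rewrite setUv.
- exact/disj_setPCl.
congr (_ + _)%E; rewrite setCitvr.
rewrite -integral_itv_bndo_bndc; last exact: measurable_funTS.
rewrite integral_mkcond -ge0_integral_opp; last 2 first.
- by apply/(measurable_restrictT _ _).1 => //; exact: measurable_funTS.
- by move=> x; rewrite patchE; case: ifPn.
rewrite [RHS]integral_mkcond; apply: eq_integral => x _.
by rewrite !patchE !mem_setE !in_itv/= andbT oppr_lt0.
Qed.

(** The translate by pi of the half turn around 0 completes it to a full turn. *)
Lemma ge0_integral_half_turns h :
  measurable_fun setT h -> (forall x, 0 <= h x)%E ->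
  (forall x, h (x + 2 * pi)%R = h x) ->
  (\int[mu]_(x in `](- (pi / 2))%R, (pi / 2)%R[) h x +
   \int[mu]_(x in `](- (pi / 2))%R, (pi / 2)%R[) h (x + pi)%R =
   \int[mu]_(x in `]0%R, (2 * pi)%R]) h x)%E.
Proof.
move=> mh h0 h2pi.
have pi0 := pi_gt0 R.
have mhpi : measurable_fun setT (fun x : R => h (x + pi)%R) by meas.
rewrite !integral_itv_bndo_bndc; [|exact: measurable_funTS..].
rewrite ge0_integral_shift_itv//; last by lra.
rewrite (_ : - (pi / 2) + pi = pi / 2); last by lra.
rewrite -ge0_integral_itv_split//; [|lra..].
rewrite -(@ge0_integral_periodic h (2 * pi) (2 * pi - pi / 2))//; [|lra..].
rewrite -[in LHS](add0r (- (pi / 2))).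
rewrite (_ : pi / 2 + pi = 2 * pi + - (pi / 2)); last by lra.
rewrite -ge0_integral_shift_itv//; last by lra.
by apply: eq_integral => x _; rewrite -h2pi; congr (h _); lra.
Qed.

End invariance.

(** * Polar coordinates *)

Section polar.
Context {R : realType}.
Notation mu := (@lebesgue_measure R).
Implicit Types (h : R * R -> \bar R).

Let ray h (psi : R) :=
  (\int[mu]_(r in `]0%R, +oo[) (r%:E * h (r * cos psi, r * sin psi)%R))%E.

Let pos_part h r psi := ((if 0 < r then r else 0)%:E * h (r * cos psi, r * sin psi)%R)%E.

Let rayE h psi : ray h psi = (\int[mu]_(r in `]0%R, +oo[) pos_part h r psi)%E.
Proof.
by apply: eq_integral => r; rewrite /pos_part inE/= in_itv/= andbT => ->.
Qed.

Let pos_part_ge0 h r psi : (forall z, 0 <= h z)%E -> (0 <= pos_part h r psi)%E.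
Proof.
move=> h0; apply: mule_ge0 => //.
by rewrite lee_fin; case: ltP => // /ltW.
Qed.

Let measurable_pos_part h : measurable_fun setT h ->
  measurable_fun setT (fun p : R * R => pos_part h p.2 p.1).
Proof. by move=> mh; rewrite /pos_part; meas. Qed.

Let measurable_ray h : measurable_fun setT h -> (forall z, 0 <= h z)%E ->
  measurable_fun setT (ray h).
Proof.
move=> mh h0; rewrite (_ : ray h = fun psi =>
    \int[mu]_(r in `]0%R, +oo[) pos_part h r psi)%E; last first.
  by apply/funext => psi; rewrite rayE.
apply: (@measurable_integral_param _ _ _ _ _ mu _ (fun psi r => pos_part h r psi)) => //.
  exact: measurable_pos_part.
by move=> ? ?; exact: pos_part_ge0.
Qed.

Let ray_ge0 h psi : (forall z, 0 <= h z)%E -> (0 <= ray h psi)%E.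
Proof. by move=> h0; rewrite rayE; apply: integral_ge0 => *; exact: pos_part_ge0. Qed.

(** The substitution y = x v gives the integrand x h (x, x v), and then
x = r cos (atan v) gives cos^2 (atan v) r h (r cos (atan v), r sin (atan v)),
where cos^2 (atan v) = 1 / (1 + v^2) is the derivative of atan. *)
Let half_plane h : measurable_fun setT h -> (forall z, 0 <= h z)%E ->
  (\int[mu]_(x in `]0%R, +oo[) \int[mu]_y h (x, y) =
   \int[mu]_(psi in `](- (pi / 2))%R, (pi / 2)%R[) ray h psi)%E.
Proof.
move=> mh h0.
have cs (v : R) : sin (atan v) = cos (atan v) * v.
  have c0 : cos (atan v) != 0 by rewrite cos_atan invr_neq0// gt_eqF// sqrtr_gt0 ltr_pwDl// sqr_ge0.
  by rewrite -[X in _ = _ * X](atanK v) /tan mulrC divfK.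
have c0 (v : R) : 0 < cos (atan v).
  by rewrite cos_atan invr_gt0 sqrtr_gt0 ltr_pwDl// sqr_ge0.
have c2 (v : R) : (1 + v ^+ 2)^-1 = cos (atan v) * cos (atan v).
  by rewrite -expr2 cos_atan exprVn sqr_sqrtr// addr_ge0// sqr_ge0.
pose g x v := ((if 0 < x then x else 0)%:E * h (x, x * v)%R)%E.
have mg : measurable_fun setT (fun p : R * R => g p.1 p.2) by rewrite /g; meas.
have g0 x v : (0 <= g x v)%E.
  by apply: mule_ge0 => //; rewrite lee_fin; case: ltP => // /ltW.
transitivity (\int[mu]_(x in `]0%R, +oo[) \int[mu]_v g x v)%E.
  apply: eq_integral => x; rewrite inE/= in_itv/= andbT => x0.
  rewrite -(@ge0_integral_scale _ (fun y => h (x, y)) x)//; last by meas.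
  by apply: eq_integral => v _; rewrite /g x0.
rewrite (@tonelli_on _ _ _ _ _ mu mu _ _ g (measurable_itv _) measurableT mg g0).
rewrite -ge0_integral_atan//; last 2 first.
- exact: measurable_ray.
- by move=> psi; exact: ray_ge0.
apply: eq_integral => v _; rewrite rayE c2 EFinM -muleA.
rewrite -(@ge0_integral_scale_gt0 _ (fun x => g x v) (cos (atan v)))//; last first.
  by rewrite /g; meas.
rewrite -(@ge0_integralZl _ _ _ mu _ (measurable_itv _) (fun r => pos_part h r (atan v)))//; last 3 first.
- by apply: measurable_funTS; rewrite /pos_part; meas.
- by move=> r _; exact: pos_part_ge0.
- by rewrite lee_fin ltW.
rewrite -ge0_integralZl//; last 3 first.
- by apply: measurable_funTS; rewrite /pos_part; meas.
- by move=> r _; rewrite mule_ge0 ?pos_part_ge0// lee_fin ltW.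
- by rewrite lee_fin ltW.
apply: eq_integral => r; rewrite inE/= in_itv/= andbT => r0.
rewrite /g /pos_part r0 pmulr_rgt0// r0 cs [(cos _ * r)%R]mulrC mulrA.
by rewrite EFinM [(r%:E * _)%E]muleC !muleA.
Qed.

(** The half planes x > 0 and x < 0 correspond to the half turns around the angles
0 and pi. *)
Lemma ge0_integral_polar h : measurable_fun setT h -> (forall z, 0 <= h z)%E ->
  (\int[mu]_x \int[mu]_y h (x, y) =
   \int[mu]_(psi in `]0%R, (2 * pi)%R])
     \int[mu]_(r in `]0%R, +oo[) (r%:E * h (r * cos psi, r * sin psi)%R))%E.
Proof.
move=> mh h0.
have pi0 := pi_gt0 R.
pose hN (z : R * R) := h (- z.1, - z.2).
have mhN : measurable_fun setT hN by rewrite /hN; meas.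
have hN0 z : (0 <= hN z)%E by exact: h0.
have mi : measurable_fun setT (fun x => \int[mu]_y h (x, y))%E.
  by apply: (@measurable_integral_param _ _ _ _ _ mu setT (fun x y => h (x, y))) => //; meas.
have i0 x : (0 <= \int[mu]_y h (x, y))%E by apply: integral_ge0.
have mr := measurable_ray mh h0.
have r0 psi := ray_ge0 psi h0.
rewrite ge0_integral_half_lines//.
have -> : (\int[mu]_(x in `]0%R, +oo[) \int[mu]_y h (- x, y)%R)%E =
    (\int[mu]_(x in `]0%R, +oo[) \int[mu]_y hN (x, y))%E.
  apply: eq_integral => x _.
  by rewrite /hN/= -(@ge0_integral_opp _ (fun y => h (- x, y)))//; meas.
rewrite !half_plane//.
have raypi psi : ray hN psi = ray h (psi + pi).
  apply: eq_integral => r _; congr (_ * _)%E.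
  by rewrite /hN/= cosDpi sinDpi !mulrN.
have ray2pi psi : ray h (psi + 2 * pi) = ray h psi.
  apply: eq_integral => r _.
  by rewrite mulr_natl cosD2pi sinD2pi.
under [X in (_ + X)%E]eq_integral do rewrite raypi.
exact: ge0_integral_half_turns.
Qed.

End polar.

(** * The mean of 1 / (u - z.e) over the unit vectors e *)

Section angular_integral.
Context {R : realType}.
Notation mu := (@lebesgue_measure R).

(** The Cauchy-Schwarz inequality with a unit vector. *)
Lemma sqr_add_sqr_dot (x y th : R) :
  (x * cos th + y * sin th) ^+ 2 <= x ^+ 2 + y ^+ 2.
Proof.
have := cos2Dsin2 th => H.
rewrite -[leRHS]mulr1 -H -subr_ge0.
rewrite (_ : _ - _ = (x * sin th - y * cos th) ^+ 2); last by ring.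
exact: sqr_ge0.
Qed.

Lemma dot_lt (u x y th : R) : 0 < u -> x ^+ 2 + y ^+ 2 < u ^+ 2 ->
  x * cos th + y * sin th < u.
Proof.
move=> u0 xyu; have := le_lt_trans (sqr_add_sqr_dot x y th) xyu.
set v := _ + _ => vu; rewrite ltNge; apply/negP => uv.
have : u ^+ 2 <= v ^+ 2 by rewrite ler_sqr ?nnegrE ?(ltW u0)// (le_trans (ltW u0)).
by rewrite leNgt vu.
Qed.

(** This identity computes the derivative of the primitive of [integral_angle],
where w and q are the components of the vector (b, c) along and across the
direction th, and a = b^2 + c^2. *)
Let angle_algebra (u s w q a : R) :
  a * (u + s) = u - s -> q ^+ 2 = a - w ^+ 2 -> u + s != 0 -> 1 - w != 0 ->
  u - (u + s) * w != 0 ->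
  1 + 2 * ((1 + (q * (1 - w)^-1) ^+ 2)^-1 *
           (q * (- (1 - w) ^- 2 * q) + (1 - w)^-1 * w)) =
  s / (u - (u + s) * w).
Proof.
move=> au q2 us p0 d0.
have D : (1 - w) ^+ 2 + q ^+ 2 = 2 * (u - (u + s) * w) / (u + s).
  rewrite q2; apply: (mulIf us); rewrite divfK//.
  rewrite (_ : _ * (u + s) = (1 - 2 * w) * (u + s) + a * (u + s)); last by ring.
  by rewrite au; ring.
have D0 : (1 - w) ^+ 2 + q ^+ 2 != 0.
  by rewrite D !mulf_neq0// ?invr_neq0// pnatr_eq0.
have -> : q * (- (1 - w) ^- 2 * q) + (1 - w)^-1 * w =
    ((1 - w) * w - q ^+ 2) / (1 - w) ^+ 2 by field.
have -> : (1 + (q * (1 - w)^-1) ^+ 2)^-1 = (1 - w) ^+ 2 / ((1 - w) ^+ 2 + q ^+ 2).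
  rewrite exprMn exprVn; field.
  by rewrite D0.
have -> : (1 - w) * w - q ^+ 2 = w - a by rewrite q2; ring.
rewrite [X in _ = X / _](_ : s = u - (u + s) * w + (w - a) * (u + s)); last first.
  by rewrite mulrBl au; ring.
rewrite D; field.
by rewrite d0 p0 us.
Qed.

(** Let s = sqrt (u^2 - x^2 - y^2) and (b, c) = (x, y) / (u + s), a vector of norm
less than 1.  Then s / (u - x cos th - y sin th) has the primitive
th + 2 atan ((b sin th - c cos th) / (1 - b cos th - c sin th)), whose denominator
never vanishes: it is smooth over the full turn, in contrast with the primitive
in tan (th / 2), and its periodic part contributes nothing. *)
Lemma integral_angle (u x y : R) : 0 < u -> x ^+ 2 + y ^+ 2 < u ^+ 2 ->
  (\int[mu]_(th in `]0%R, (2 * pi)%R]) ((u - (x * cos th + y * sin th))^-1)%:E =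
   (2 * pi / Num.sqrt (u ^+ 2 - x ^+ 2 - y ^+ 2))%:E)%E.
Proof.
move=> u0 xyu.
set m := u ^+ 2 - x ^+ 2 - y ^+ 2.
have m0 : 0 < m by rewrite /m; lra.
set s := Num.sqrt m.
have s0 : 0 < s by rewrite sqrtr_gt0.
have sE : s ^+ 2 = m by rewrite sqr_sqrtr// ltW.
pose b := x / (u + s); pose c := y / (u + s).
have us0 : u + s != 0 by rewrite gt_eqF// addr_gt0.
have bc : b ^+ 2 + c ^+ 2 < 1.
  rewrite /b /c !expr_div_n -mulrDl ltr_pdivrMr ?exprn_gt0 ?addr_gt0// mul1r.
  rewrite (lt_le_trans xyu)// ler_sqr ?nnegrE ?(ltW u0) ?addr_ge0 ?(ltW u0) ?(ltW s0)//.
  by rewrite lerDl ltW.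
pose p (th : R) := 1 - (b * cos th + c * sin th).
pose q (th : R) := b * sin th - c * cos th.
have p0 th : 0 < p th by rewrite /p subr_gt0 dot_lt// expr1n.
pose F (th : R) := th + 2 * atan (q th / p th).
pose f (th : R) := s / (u - (x * cos th + y * sin th)).
have d0 th : 0 < u - (x * cos th + y * sin th) by rewrite subr_gt0 dot_lt.
have dF th : is_derive th (1 : R) F (f th).
  have dq : is_derive th (1 : R) q (b * cos th + c * sin th).
    rewrite /q; apply: is_derive_eq; rewrite /GRing.scale/=; ring.
  have dp : is_derive th (1 : R) p (b * sin th - c * cos th).
    rewrite /p; apply: is_derive_eq; rewrite /GRing.scale/=; ring.
  have pn0 : p th != 0 by rewrite gt_eqF.
  have dV := is_deriveV pn0 dp.
  have dqp := is_deriveM dq dV.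
  have dat := @is_derive1_comp _ (@atan R) _ th _ _ (is_derive1_atan _) dqp.
  have d2 := is_deriveZ 2 dat.
  have dD := is_deriveD (is_derive_id th (1 : R)) d2.
  have xE : x = b * (u + s) by rewrite /b divfK.
  have yE : y = c * (u + s) by rewrite /c divfK.
  have wE : x * cos th + y * sin th = (u + s) * (b * cos th + c * sin th).
    by rewrite xE yE; ring.
  refine (is_derive_eq dD _); rewrite /f wE; apply: (@angle_algebra _ _ _ _ (b ^+ 2 + c ^+ 2)) => //.
  - apply: (mulIf us0); rewrite -mulrA -expr2.
    rewrite (_ : (u - s) * (u + s) = u ^+ 2 - s ^+ 2); last by ring.
    rewrite sE /m (_ : u ^+ 2 - (u ^+ 2 - x ^+ 2 - y ^+ 2) = x ^+ 2 + y ^+ 2); last by ring.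
    by rewrite [in RHS]xE [in RHS]yE; ring.
  - rewrite /q; have := cos2Dsin2 th => H.
    rewrite -[b ^+ 2 + c ^+ 2]mulr1 -H; ring.
  - by rewrite -wE gt_eqF.
have cf : continuous f.
  move=> th; rewrite /f; apply: (@continuousM _ _ (cst s)
    (fun th => (u - (x * cos th + y * sin th))^-1)); first exact: cst_continuous.
  apply: (@continuous_comp _ _ _ (fun th => u - (x * cos th + y * sin th)) GRing.inv).
    apply: continuousB; first exact: cst_continuous.
    apply: continuousD; apply: continuousM; try exact: cst_continuous.
      exact: continuous_cos.
    exact: continuous_sin.
  by apply: inv_continuous; rewrite gt_eqF.
have pi0 := pi_gt0 R.
transitivity (\int[mu]_(th in `]0%R, (2 * pi)%R]) ((s^-1)%:E * (f th)%:E))%E.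
  apply: eq_integral => th _; rewrite -EFinM /f mulrA mulVf ?mul1r// gt_eqF//.
rewrite ge0_integralZl//; last 3 first.
- apply/measurable_EFinP; apply: measurable_funTS.
  exact: continuous_measurable_fun.
- by move=> th _; rewrite lee_fin /f divr_ge0// ltW.
- by rewrite lee_fin invr_ge0 ltW.
rewrite (integral_is_derive dF)//; last by lra.
rewrite -EFinM /F /q /p mulr_natl cos2pi sin2pi cos0 sin0 -[in LHS]mulr_natl.
by congr (_%:E); rewrite add0r addrK mulrC mulr_natl.
Qed.
End angular_integral.

(** * Two flights of total length u *)

Section fixed_first_direction.
Context {R : realType}.
Notation mu := (@lebesgue_measure R).

Lemma ge0_integral_flip (h : R -> \bar R) (a : R) :
  measurable_fun setT h -> (forall x, 0 <= h x)%E ->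
  (\int[mu]_x h (a - x)%R = \int[mu]_x h x)%E.
Proof.
move=> mh h0; rewrite -[RHS](@ge0_integral_shift _ h a)//.
rewrite -(@ge0_integral_opp _ (fun x => h (x + a)))//; last by meas.
by apply: eq_integral => x _; rewrite addrC.
Qed.

Let is_derive_F (u y x : R) : y != 0 ->
  is_derive x (1 : R) (fun x => u - Num.sqrt (x ^+ 2 + y ^+ 2) + x)
    (1 - x / Num.sqrt (x ^+ 2 + y ^+ 2)).
Proof.
move=> y0; have xy0 : 0 < x ^+ 2 + y ^+ 2.
  by rewrite ltr_wpDl ?sqr_ge0// exprn_even_gt0.
have ds := is_derive1_sqrt xy0.
have d2 : is_derive x (1 : R) (fun x : R => x ^+ 2 + y ^+ 2) (2 * x).
  apply: is_derive_eq; rewrite /GRing.scale/=; ring.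
have dc := @is_derive1_comp _ (@Num.sqrt R) (fun x => x ^+ 2 + y ^+ 2) x _ _ ds d2.
have dB := is_deriveB (is_derive_cst u x (1 : R)) dc.
have dD := is_deriveD dB (is_derive_id x (1 : R)).
refine (is_derive_eq dD _).
by field; rewrite gt_eqF ?sqrtr_gt0.
Qed.

(** Write w = sqrt (x^2 + y^2).  For fixed y, the substitution v = u - w + x
satisfies u - v = w - x, hence dv / (u - v) = dx / w, and it maps the slice
w < u of the disk onto itself, fixing both its ends. *)
Let substitution_slice (g : R * R -> \bar R) (u y : R) : 0 < u -> y != 0 ->
  measurable_fun setT g -> (forall z, 0 <= g z)%E ->
  (\int[mu]_x ((if x ^+ 2 + y ^+ 2 < u ^+ 2 then (Num.sqrt (x ^+ 2 + y ^+ 2))^-1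
       else 0)%:E * g (u - Num.sqrt (x ^+ 2 + y ^+ 2) + x, y)%R) =
   \int[mu]_x ((if x ^+ 2 + y ^+ 2 < u ^+ 2 then (u - x)^-1 else 0)%:E *
       g (x, y)))%E.
Proof.
move=> u0 y0 mg g0.
have [yu|uy] := ltP (y ^+ 2) (u ^+ 2); last first.
  have F (x : R) : (x ^+ 2 + y ^+ 2 < u ^+ 2) = false.
    by apply/negbTE; rewrite -leNgt (le_trans uy)// lerDr sqr_ge0.
  by rewrite !integral0_eq// => x _; rewrite F mul0e.
have b0 : 0 < u ^+ 2 - y ^+ 2 by rewrite subr_gt0.
set b := Num.sqrt (u ^+ 2 - y ^+ 2).
have bE : b ^+ 2 = u ^+ 2 - y ^+ 2 by rewrite sqr_sqrtr// ltW.
have bgt0 : 0 < b by rewrite sqrtr_gt0.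
have diskE x : (x ^+ 2 + y ^+ 2 < u ^+ 2) = (x \in `]- b, b[%R).
  by rewrite -ltrBrDr -bE in_itv/= -ltr_norml -[x ^+ 2]real_normK ?num_real// ltr_sqr ?nnegrE// ltW.
have toI (h : R -> \bar R) (h' : R -> \bar R) :
    (forall x, x \in `]- b, b[%R -> h x = h' x) ->
    (forall x, x \notin `]- b, b[%R -> h x = 0%E) ->
    measurable_fun setT h' ->
    (\int[mu]_x h x = \int[mu]_(x in `](- b)%R, b]) h' x)%E.
  move=> hh' h0' mh'; rewrite -integral_itv_bndo_bndc; last exact: measurable_funTS.
  rewrite [RHS]integral_mkcond; apply: eq_integral => x _.
  by rewrite patchE mem_setE; case: ifPn => [/hh'|/h0'].
have w0 (x : R) : 0 < Num.sqrt (x ^+ 2 + y ^+ 2).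
  by rewrite sqrtr_gt0 ltr_wpDl ?sqr_ge0// exprn_even_gt0.
have xw (x : R) : x < Num.sqrt (x ^+ 2 + y ^+ 2).
  rewrite (le_lt_trans (ler_norm x))// -sqrtr_sqr ltr_sqrt ?ltrDl ?exprn_even_gt0//.
  by rewrite ltr_wpDl ?sqr_ge0// exprn_even_gt0.
pose F x := u - Num.sqrt (x ^+ 2 + y ^+ 2) + x.
pose f x := 1 - x / Num.sqrt (x ^+ 2 + y ^+ 2).
have f0 x : 0 < f x by rewrite /f subr_gt0 ltr_pdivrMr ?mul1r.
pose h v := ((if v < u then (u - v)^-1 else 0)%:E * g (v, y))%E.
have mh : measurable_fun setT h by rewrite /h; meas.
have h0 v : (0 <= h v)%E.
  by rewrite mule_ge0// lee_fin; case: ltP => // vu; rewrite invr_ge0 subr_ge0 ltW.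
have cf : continuous f.
  move=> x; apply: (@cvgB _ _ _ _ _ (cst (1 : R))
    (fun x => x / Num.sqrt (x ^+ 2 + y ^+ 2))); first exact: cvg_cst.
  apply: (@continuousM _ _ id (fun x => (Num.sqrt (x ^+ 2 + y ^+ 2))^-1)) => //.
  apply: (@continuous_comp _ _ _ (fun x : R => Num.sqrt (x ^+ 2 + y ^+ 2)) GRing.inv).
    apply: (@continuous_comp _ _ _ (fun x : R => x ^+ 2 + y ^+ 2) Num.sqrt).
      by apply: continuousD; [exact: exprn_continuous|exact: cst_continuous].
    exact: sqrt_continuous.
  by apply: inv_continuous; rewrite gt_eqF.
rewrite (@toI _ (fun x => (f x)%:E * h (F x))%E); last 3 first.
- move=> x; rewrite -diskE => ->.
  have Fu : F x < u by rewrite /F -addrA gtrDl addrC subr_lt0.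
  rewrite /h Fu muleA -EFinM; congr (_%:E * _)%E.
  rewrite /f /F opprD opprB addrA addrCA subrr addr0.
  have dw : Num.sqrt (x ^+ 2 + y ^+ 2) - x != 0 by rewrite gt_eqF// subr_gt0.
  by field; rewrite dw gt_eqF.
- by move=> x; rewrite -diskE => /negbTE ->; rewrite mul0e.
- by rewrite /f /F /h; meas.
rewrite (@toI _ h); last 3 first.
- move=> x; rewrite -diskE => xu; rewrite xu /h ifT//.
  rewrite (le_lt_trans (ler_norm x))// -ltr_sqr ?nnegrE ?(ltW u0)//.
  by rewrite real_normK ?num_real// (le_lt_trans _ xu)// lerDl sqr_ge0.
- by move=> x; rewrite -diskE => /negbTE ->; rewrite mul0e.
- exact: mh.
have dF x := @is_derive_F u y x y0.
rewrite (ge0_integral_substitution_smooth dF)//; last 2 first.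
- by rewrite ge0_cp// ltW.
- by move=> x _ _; exact: f0.
have wE : Num.sqrt (b ^+ 2 + y ^+ 2) = u.
  by rewrite bE subrK sqrtr_sqr gtr0_norm.
by rewrite sqrrN wE subrr !add0r.
Qed.

(** The first flight, of length r, follows the x axis.  The second one is the
vector of polar coordinates u - r and th; in terms of this vector the end of the
walk is reached by the substitution of [substitution_slice] on every horizontal
line, except on the x axis, which is a null set. *)
Lemma integral_fixed_first_direction (g : R * R -> \bar R) (u : R) : 0 < u ->
  measurable_fun setT g -> (forall z, 0 <= g z)%E ->
  (\int[mu]_(r in `]0%R, u]) \int[mu]_(th in `]0%R, (2 * pi)%R])
     g (r + (u - r) * cos th, (u - r) * sin th)%R =
   \int[mu]_x \int[mu]_y
     ((if x ^+ 2 + y ^+ 2 < u ^+ 2 then (u - x)^-1 else 0)%:E * g (x, y)))%E.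
Proof.
move=> u0 mg g0.
pose w (x y : R) := Num.sqrt (x ^+ 2 + y ^+ 2).
pose k (z : R * R) := ((if z.1 ^+ 2 + z.2 ^+ 2 < u ^+ 2 then (w z.1 z.2)^-1
   else 0)%:E * g (u - w z.1 z.2 + z.1, z.2)%R)%E.
have mk : measurable_fun setT k by rewrite /k /w; meas.
have k0 z : (0 <= k z)%E.
  by rewrite mule_ge0// lee_fin; case: ifP => // _; rewrite invr_ge0 sqrtr_ge0.
pose k' (z : R * R) := ((if z.1 ^+ 2 + z.2 ^+ 2 < u ^+ 2 then (u - z.1)^-1
   else 0)%:E * g z)%E.
have mk' : measurable_fun setT k' by rewrite /k'; meas.
have k'0 z : (0 <= k' z)%E.
  rewrite mule_ge0// lee_fin; case: ifP => // zu; rewrite invr_ge0 subr_ge0.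
  rewrite (le_trans (ler_norm _))// -ler_sqr ?nnegrE ?(ltW u0)//.
  by rewrite real_normK ?num_real// (le_trans _ (ltW zu))// lerDl sqr_ge0.
transitivity (\int[mu]_x \int[mu]_y k (x, y))%E; last first.
  rewrite (@fubini_tonelli _ _ _ _ R mu mu k mk k0).
  rewrite (@fubini_tonelli _ _ _ _ R mu mu _ mk' k'0).
  have int0 (q : R * R -> \bar R) : measurable_fun setT q ->
      (forall z, 0 <= q z)%E ->
      (\int[mu]_y \int[mu]_x q (x, y) =
       \int[mu]_(y in [set~ 0%R]) \int[mu]_x q (x, y))%E.
    move=> mq q0.
    have mi : measurable_fun setT (fun y : R => \int[mu]_x q (x, y))%E.
      by apply: (@measurable_integral_param _ _ _ _ _ mu setT (fun y x => q (x, y))) => //; meas.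
    rewrite -(@integral_setD1 _ _ 0 setT) ?setTD//.
      exact: measurableC.
    exact: measurable_funTS.
  rewrite (int0 _ mk k0) (int0 _ mk' k'0); apply: eq_integral => y; rewrite inE/= => /eqP y0.
  exact: substitution_slice.
rewrite (ge0_integral_polar mk k0).
pose G r th := g (r + (u - r) * cos th, (u - r) * sin th)%R.
have mG : measurable_fun setT (fun p : R * R => G p.1 p.2) by rewrite /G; meas.
rewrite (@tonelli_on _ _ _ _ _ mu mu _ _ G (measurable_itv _) (measurable_itv _) mG); last first.
  by move=> ? ?; exact: g0.
apply: eq_integral => th _.
have mGt : measurable_fun setT (G ^~ th) by rewrite /G; meas.
rewrite -integral_itv_bndo_bndc; last exact: measurable_funTS.
rewrite [LHS]integral_mkcond -(@ge0_integral_flip _ u); last 2 first.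
- by apply/(measurable_restrictT _ _).1 => //; exact: measurable_funTS.
- by move=> x; rewrite patchE; case: ifPn => // _; exact: g0.
rewrite [RHS]integral_mkcond; apply: eq_integral => r _.
rewrite !patchE !mem_setE !in_itv/= andbT subr_gt0 gtrBl.
have [r0|r0] := ltP 0 r; last by rewrite andbF.
rewrite andbT.
have wE : (r * cos th) ^+ 2 + (r * sin th) ^+ 2 = r ^+ 2.
  by rewrite !exprMn -mulrDr cos2Dsin2 mulr1.
rewrite /k/= /w wE sqrtr_sqr gtr0_norm// ltr_sqr ?nnegrE ?ltW//.
case: ifPn => ru; last by rewrite mul0e mule0.
rewrite muleA -EFinM mulfV ?gt_eqF// mul1e /G; congr (g (_, _)); ring.
Qed.

End fixed_first_direction.

Section two_directions.
Context {R : realType}.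
Notation mu := (@lebesgue_measure R).
Variables (h : R * R -> \bar R) (u : R).
Hypotheses (u0 : 0 < u) (mh : measurable_fun setT h) (h0 : forall z, (0 <= h z)%E).

Let turn (phi : R) (z : R * R) :=
  h (z.1 * cos phi - z.2 * sin phi, z.1 * sin phi + z.2 * cos phi).

Let turn_ge0 phi z : (0 <= turn phi z)%E. Proof. exact: h0. Qed.

Let measurable_turn phi : measurable_fun setT (turn phi).
Proof. by rewrite /turn; meas. Qed.

Let ang := `]0%R, (2 * pi)%R]%classic : set R.

Let mang : measurable ang. Proof. exact: measurable_itv. Qed.

(** Angles are only defined up to a full turn, so a shift of the angle does not
change the integral over the circle. *)
Let ang_shift (r psi : R) : psi \in ang ->
  (\int[mu]_(phi in ang) h (r * cos (phi + psi), r * sin (phi + psi))%R =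
   \int[mu]_(phi in ang) h (r * cos phi, r * sin phi)%R)%E.
Proof.
rewrite inE /ang/= in_itv/= => /andP[p0 p2pi].
apply: (@ge0_integral_periodic _ (fun phi => h (r * cos phi, r * sin phi)) (2 * pi)) => //.
- exact: ltW.
- by meas.
- by move=> x; rewrite mulr_natl cosD2pi sinD2pi.
Qed.

Let first_turn (r phi : R) : phi \in ang ->
  (\int[mu]_(th in ang)
    h (r * cos phi + (u - r) * cos th, r * sin phi + (u - r) * sin th)%R =
   \int[mu]_(th in ang)
    turn phi (r + (u - r) * cos th, (u - r) * sin th)%R)%E.
Proof.
rewrite inE /ang/= in_itv/= => /andP[p0 p2pi].
rewrite -(@ge0_integral_periodic _ (fun th =>
  h (r * cos phi + (u - r) * cos th, r * sin phi + (u - r) * sin th)%R)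
  (2 * pi) phi)//; last 3 first.
- exact: ltW.
- by meas.
- by move=> x; rewrite mulr_natl cosD2pi sinD2pi.
apply: eq_integral => th _; rewrite /turn/= cosD sinD.
by congr (h (_, _)); ring.
Qed.

Let c (r psi : R) : R := if (0 < r) && (r < u) then r / (u - r * cos psi) else 0.

Let c_ge0 r psi : 0 <= c r psi.
Proof.
rewrite /c; case: ifP => // /andP[r0 ru].
rewrite divr_ge0 ?(ltW r0)// subr_ge0 (le_trans _ (ltW ru))//.
by rewrite ger_pMr// cos_le1.
Qed.

Let integral_c r :
  (\int[mu]_(psi in ang) (c r psi)%:E =
   (if (0 < r) && (r < u) then r * (2 * pi / Num.sqrt (u ^+ 2 - r ^+ 2)) else 0)%:E)%E.
Proof.
rewrite /c; case: ifPn => [/andP[r0 ru]|_]; last by rewrite integral0_eq.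
have ru2 : r ^+ 2 + 0 ^+ 2 < u ^+ 2.
  by rewrite expr0n addr0 ltr_sqr ?nnegrE ?ltW.
have := integral_angle u0 ru2; rewrite expr0n subr0 => E.
under eq_integral do rewrite EFinM.
rewrite ge0_integralZl//; last 3 first.
- by apply: measurable_funTS; meas.
- move=> psi _; rewrite lee_fin invr_ge0 subr_ge0 (le_trans _ (ltW ru))//.
  by rewrite ger_pMr// cos_le1.
- by rewrite lee_fin ltW.
rewrite EFinM -E; congr (_ * _)%E; apply: eq_integral => psi _.
by rewrite mul0r addr0.
Qed.

Let M (r : R) := (\int[mu]_(phi in ang) h (r * cos phi, r * sin phi)%R)%E.

Let measurable_M : measurable_fun setT M.
Proof.
rewrite /M; apply: (@measurable_integral_param _ _ _ _ _ mu _ (fun r phi : R => h (r * cos phi, r * sin phi)%R)) => //.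
by meas.
Qed.

Let M_ge0 r : (0 <= M r)%E. Proof. exact: integral_ge0. Qed.

(** In the frame where the first direction is the x axis, the end of the walk has
the weight 1 / (u - x).  In the fixed frame, the end at the distance r from the
origin has the weight 1 / (u - r cos psi), where psi is the angle from the first
direction to the end; psi is uniform, and [integral_angle] gives its mean. *)
Lemma integral_two_directions :
  (\int[mu]_(r in `]0%R, u]) \int[mu]_(phi in `]0%R, (2 * pi)%R])
     \int[mu]_(th in `]0%R, (2 * pi)%R])
     h (r * cos phi + (u - r) * cos th, r * sin phi + (u - r) * sin th)%R =
   \int[mu]_x \int[mu]_y
     ((if x ^+ 2 + y ^+ 2 < u ^+ 2 then
         2 * pi / Num.sqrt (u ^+ 2 - x ^+ 2 - y ^+ 2) else 0)%:E * h (x, y)))%E.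
Proof.
pose f r phi := (\int[mu]_(th in ang)
    turn phi (r + (u - r) * cos th, (u - r) * sin th)%R)%E.
have mf : measurable_fun setT (fun p : R * R => f p.1 p.2).
  rewrite /f; apply: (@measurable_integral_param _ _ _ _ _ mu _ (fun (p : R * R) (th : R) =>
    turn p.2 (p.1 + (u - p.1) * cos th, (u - p.1) * sin th)%R)) => //.
  by rewrite /turn /=; meas.
have f0 r phi : (0 <= f r phi)%E by apply: integral_ge0 => *; exact: turn_ge0.
transitivity (\int[mu]_(r in `]0%R, u]) \int[mu]_(phi in ang) f r phi)%E.
  by apply: eq_integral => r _; apply: eq_integral => phi; exact: first_turn.
rewrite (@tonelli_on _ _ _ _ _ mu mu _ _ f (measurable_itv _) mang mf f0).
pose F3 phi psi r := ((c r psi)%:E * h (r * cos (phi + psi), r * sin (phi + psi))%R)%E.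
have F30 phi psi r : (0 <= F3 phi psi r)%E by rewrite mule_ge0// lee_fin.
transitivity (\int[mu]_(phi in ang) \int[mu]_(psi in ang)
    \int[mu]_(r in `]0%R, +oo[) F3 phi psi r)%E.
  apply: eq_integral => phi _; rewrite /f.
  rewrite (integral_fixed_first_direction u0 (measurable_turn phi) (turn_ge0 phi)).
  pose k (z : R * R) := ((if z.1 ^+ 2 + z.2 ^+ 2 < u ^+ 2 then (u - z.1)^-1
   else 0)%:E * turn phi z)%E.
  have mk : measurable_fun setT k by rewrite /k /turn; meas.
  have k0 z : (0 <= k z)%E.
    rewrite mule_ge0// lee_fin; case: ifP => // zu; rewrite invr_ge0 subr_ge0.
    rewrite (le_trans (ler_norm _))// -ler_sqr ?nnegrE ?(ltW u0)//.
    by rewrite real_normK ?num_real// (le_trans _ (ltW zu))// lerDl sqr_ge0.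
  rewrite (ge0_integral_polar mk k0); apply: eq_integral => psi _.
  apply: eq_integral => r; rewrite inE/= in_itv/= andbT => r0.
  have wE : (r * cos psi) ^+ 2 + (r * sin psi) ^+ 2 = r ^+ 2.
    by rewrite !exprMn -mulrDr cos2Dsin2 mulr1.
  rewrite /k/= wE ltr_sqr ?nnegrE ?ltW// /F3 /c r0/=.
  case: ifPn => ru; last by rewrite !mul0e mule0.
  rewrite muleA -EFinM /turn/= cosD sinD; congr (_ * h (_, _))%E; ring.
have mF3 : measurable_fun setT (fun p : R * R * R => F3 p.1.1 p.1.2 p.2).
  by rewrite /F3 /c; meas.
pose F2 phi psi := (\int[mu]_(r in `]0%R, +oo[) F3 phi psi r)%E.
have mF2 : measurable_fun setT (fun p : R * R => F2 p.1 p.2).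
  by rewrite /F2; apply: (@measurable_integral_param _ _ _ _ _ mu _ (fun (p : R * R) (r : R) => F3 p.1 p.2 r)).
have F20 phi psi : (0 <= F2 phi psi)%E by apply: integral_ge0 => *; exact: F30.
rewrite (@tonelli_on _ _ _ _ _ mu mu _ _ F2 mang mang mF2 F20) /F2.
pose cM r psi := ((c r psi)%:E * M r)%E.
have mcM : measurable_fun setT (fun p : R * R => cM p.1 p.2).
  by rewrite /cM /c; meas.
have cM0 r psi : (0 <= cM r psi)%E by rewrite mule_ge0// lee_fin.
transitivity (\int[mu]_(psi in ang) \int[mu]_(r in `]0%R, +oo[) cM r psi)%E.
  apply: eq_integral => psi psiang.
  rewrite (@tonelli_on _ _ _ _ _ mu mu _ _ (fun phi r => F3 phi psi r) mang (measurable_itv _))//; last first.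
    by rewrite /F3 /c; meas.
  apply: eq_integral => r _.
  rewrite ge0_integralZl//; last 2 first.
  - by apply: measurable_funTS; meas.
  - by rewrite lee_fin.
  by rewrite ang_shift.
rewrite -(@tonelli_on _ _ _ _ _ mu mu _ _ cM (measurable_itv _) mang mcM cM0).
pose dd (r : R) : R := if (0 < r) && (r < u) then r * (2 * pi / Num.sqrt (u ^+ 2 - r ^+ 2)) else 0.
have dd0 r : 0 <= dd r.
  rewrite /dd; case: ifPn => // /andP[r0 _]; rewrite mulr_ge0 ?(ltW r0)//.
  by rewrite divr_ge0 ?mulr_ge0 ?pi_ge0 ?sqrtr_ge0.
pose dh r phi := ((dd r)%:E * h (r * cos phi, r * sin phi)%R)%E.
have mdh : measurable_fun setT (fun p : R * R => dh p.1 p.2).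
  by rewrite /dh /dd; meas.
have dh0 r phi : (0 <= dh r phi)%E by rewrite mule_ge0// lee_fin.
transitivity (\int[mu]_(r in `]0%R, +oo[) \int[mu]_(phi in ang) dh r phi)%E.
  apply: eq_integral => r _; rewrite /cM /dh.
  rewrite ge0_integralZr//; last 2 first.
  - by apply: measurable_funTS; rewrite /c; meas.
  - by move=> psi _; rewrite lee_fin.
  rewrite integral_c ge0_integralZl//; last 2 first.
  - by apply: measurable_funTS; meas.
  - by rewrite lee_fin.
rewrite (@tonelli_on _ _ _ _ _ mu mu _ _ dh (measurable_itv _) mang mdh dh0).
pose k (z : R * R) := ((if z.1 ^+ 2 + z.2 ^+ 2 < u ^+ 2 then
   2 * pi / Num.sqrt (u ^+ 2 - z.1 ^+ 2 - z.2 ^+ 2) else 0)%:E * h z)%E.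
have mk : measurable_fun setT k by rewrite /k; meas.
have k0 z : (0 <= k z)%E.
  rewrite mule_ge0// lee_fin; case: ifP => // zu.
  by rewrite divr_ge0 ?mulr_ge0 ?pi_ge0 ?sqrtr_ge0.
rewrite -[RHS]/(\int[mu]_x \int[mu]_y k (x, y))%E (ge0_integral_polar mk k0).
apply: eq_integral => phi _; apply: eq_integral => r.
rewrite inE/= in_itv/= andbT => r0.
have wE : (r * cos phi) ^+ 2 + (r * sin phi) ^+ 2 = r ^+ 2.
  by rewrite !exprMn -mulrDr cos2Dsin2 mulr1.
rewrite /k/= -addrA -opprD wE ltr_sqr ?nnegrE ?ltW// /dh /dd r0/=.
by case: ifPn => ru; rewrite ?mul0e ?mule0// muleA -EFinM.
Qed.

End two_directions.

(** * The kernel (u^2 - |z|^2)^(k/2 - 1) *)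

Section flight_kernel.
Context {R : realType}.
Notation mu := (@lebesgue_measure R).

(** The function (u^2 - |z|^2)^(k/2 - 1) on the open disk of radius u, written with
a natural power of the square root. *)
Definition flight_kernel (k : nat) (u : R) (z : R * R) : R :=
  let m := u ^+ 2 - z.1 ^+ 2 - z.2 ^+ 2 in
  if (0 < u) && (0 < m) then Num.sqrt m ^+ k / m else 0.

Lemma flight_kernel_ge0 k u z : 0 <= flight_kernel k u z.
Proof.
rewrite /flight_kernel; case: ifPn => // /andP[_ /ltW m0].
by rewrite divr_ge0// exprn_ge0// sqrtr_ge0.
Qed.

Lemma measurable_flight_kernel k :
  measurable_fun setT (fun p : R * (R * R) => flight_kernel k p.1 p.2).
Proof. by rewrite /flight_kernel /=; meas. Qed.

(** The kernel along a ray in the direction opposite to the flight, where the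
difference u^2 - |z|^2 becomes m + 2 v q. *)
Let slope (m q v : R) (k : nat) : R :=
  if 0 < m + 2 * v * q then Num.sqrt (m + 2 * v * q) ^+ k / (m + 2 * v * q) else 0.

(** The substitution y^2 = m + 2 v q gives the integrand y^k / q. *)
Let integral_slope (m q : R) (k : nat) : 0 < m -> 0 < q ->
  (\int[mu]_(v in `](- (m / (2 * q)))%R, 0%R]) (slope m q v k.+1)%:E =
   (Num.sqrt m ^+ k.+1 / (k.+1%:R * q))%:E)%E.
Proof.
move=> m0 q0.
set s := Num.sqrt m.
have s0 : 0 < s by rewrite sqrtr_gt0.
have sE : s ^+ 2 = m by rewrite sqr_sqrtr// ltW.
have qn0 : q != 0 by rewrite gt_eqF.
pose F (y : R) := (2 * q)^-1 * y ^+ 2 + (- (m / (2 * q))).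
pose f (y : R) := q^-1 * y.
have dF (y : R) : is_derive y (1 : R) F (f y).
  have d1 := is_deriveX 2 (is_derive_id y (1 : R)).
  have d2 := is_deriveZ (2 * q)^-1 d1.
  have d3 := is_deriveD d2 (is_derive_cst (- (m / (2 * q))) y (1 : R)).
  refine (is_derive_eq d3 _); rewrite /f /GRing.scale/= expr1; field.
  by rewrite qn0.
have cf : continuous f.
  by move=> y; apply: (@continuousM _ _ (cst q^-1) id) => //; exact: cst_continuous.
have f0 y : 0 < y -> y <= s -> 0 < f y.
  by move=> y0 _; rewrite mulr_gt0// invr_gt0.
have mh : measurable_fun setT (fun v => (slope m q v k.+1)%:E).
  by rewrite /slope; meas.
have h0 v : (0 <= (slope m q v k.+1)%:E)%E.
  rewrite lee_fin /slope; case: ifPn => // /ltW a0.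
  by rewrite divr_ge0// exprn_ge0// sqrtr_ge0.
have := ge0_integral_substitution_smooth dF cf (ltW s0) f0 mh h0.
have -> : F 0 = - (m / (2 * q)) by rewrite /F expr0n mulr0 add0r.
have -> : F s = 0 by rewrite /F sE mulrC subrr.
move=> <-.
pose G (y : R) := (k.+1%:R * q)^-1 * y ^+ k.+1.
pose g (y : R) := q^-1 * y ^+ k.
have k0 : k.+1%:R != 0 :> R by rewrite pnatr_eq0.
have dG (y : R) : is_derive y (1 : R) G (g y).
  have d1 := is_deriveX k.+1 (is_derive_id y (1 : R)).
  have d2 := is_deriveZ (k.+1%:R * q)^-1 d1.
  rewrite (_ : G = (k.+1%:R * q)^-1 \*: (id ^+ k.+1)); last first.
    by apply/funext => z; rewrite /G /= exprfctE.
  refine (is_derive_eq d2 _); rewrite /g /GRing.scale/=.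
  by rewrite mulr1 invfM mulrACA mulVf// mul1r.
have cg : continuous g.
  move=> y; apply: (@continuousM _ _ (cst q^-1) (fun y : R => y ^+ k)) => //.
    exact: cst_continuous.
  exact: exprn_continuous.
transitivity (\int[mu]_(y in `]0%R, s]) (g y)%:E)%E.
  apply: eq_integral => y; rewrite inE/= in_itv/= => /andP[y0 ys].
  have yn0 : y != 0 by rewrite gt_eqF.
  have E : m + 2 * F y * q = y ^+ 2 by rewrite /F; field; rewrite qn0.
  rewrite /slope E exprn_gt0// sqrtr_sqr gtr0_norm// -EFinM; congr (_%:E).
  by rewrite /f /g exprS; field; rewrite yn0 qn0.
rewrite (integral_is_derive dG cg (ltW s0)) /G expr0n/= mulr0 subr0.
by rewrite mulrC.
Qed.

(** The squares of r cancel in (u - r)^2 - |z - r e|^2 for a unit vector e, so this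
difference is the affine function m - 2 r q of r, with m = u^2 - |z|^2 and
q = u - z.e. *)
Let kernel_ray (k : nat) (u x y th : R) : 0 < u -> x ^+ 2 + y ^+ 2 < u ^+ 2 ->
  (\int[mu]_(r in `]0%R, u])
     (flight_kernel k.+1 (u - r) (x - r * cos th, y - r * sin th)%R)%:E =
   (Num.sqrt (u ^+ 2 - x ^+ 2 - y ^+ 2) ^+ k.+1 / k.+1%:R *
     (u - (x * cos th + y * sin th))^-1)%:E)%E.
Proof.
move=> u0 xyu.
set m := u ^+ 2 - x ^+ 2 - y ^+ 2; set q := u - (x * cos th + y * sin th).
have m0 : 0 < m by rewrite /m; lra.
have q0 : 0 < q by rewrite subr_gt0 dot_lt.
have resE r : (u - r) ^+ 2 - (x - r * cos th) ^+ 2 - (y - r * sin th) ^+ 2 =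
    m - 2 * r * q.
  rewrite /m /q; have := cos2Dsin2 th => H.
  rewrite [LHS](_ : _ = u ^+ 2 - x ^+ 2 - y ^+ 2 - 2 * r * (u - (x * cos th + y * sin th)) + r ^+ 2 * (1 - (cos th ^+ 2 + sin th ^+ 2))); last by ring.
  by rewrite H subrr mulr0 addr0.
have mq : m <= 2 * u * q.
  have := resE u; rewrite subrr expr0n/= sub0r => /eqP.
  rewrite -subr_ge0; move: (sqr_ge0 (x - u * cos th)) (sqr_ge0 (y - u * sin th)).
  by move=> ? ? /eqP; lra.
have condE r : 0 < r -> (r <= u) && ((0 < u - r) && (0 < m - 2 * r * q)) = (r < m / (2 * q)).
  move=> r0; rewrite ltr_pdivlMr ?mulr_gt0// subr_gt0 [X in _ && (_ && X)]subr_gt0.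
  rewrite mulrA [r * 2]mulrC.
  have [rm|] := ltP (2 * r * q) m; last by rewrite !andbF.
  have ru : r < u.
    rewrite ltNge; apply/negP => ur.
    suff : m <= 2 * r * q by rewrite leNgt rm.
    by rewrite (le_trans mq)// ler_pM2r// ler_pM2l.
  by rewrite ru (ltW ru).
have -> : Num.sqrt m ^+ k.+1 / k.+1%:R * q^-1 = Num.sqrt m ^+ k.+1 / (k.+1%:R * q).
  by rewrite invfM mulrA.
rewrite -integral_slope//.
have ms : measurable_fun setT (fun v => (slope m q v k.+1)%:E).
  by rewrite /slope; meas.
rewrite -[RHS]integral_itv_bndo_bndc; last exact: measurable_funTS.
rewrite [LHS]integral_mkcond [RHS]integral_mkcond -[RHS]ge0_integral_opp; last 2 first.
- by apply/(measurable_restrictT _ _).1 => //; exact: measurable_funTS.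
- move=> v; rewrite patchE; case: ifPn => // _.
  rewrite lee_fin /slope; case: ifPn => // /ltW a0.
  by rewrite divr_ge0// exprn_ge0// sqrtr_ge0.
apply: eq_integral => r _; rewrite !patchE !mem_setE !in_itv/= oppr_lt0 ltrN2 andbC.
have [r0|r0] := ltP 0 r; last by rewrite !andbF.
rewrite !andbT /= -condE// /flight_kernel /= resE.
have [ru|ru] /= := leP r u => //.
have E : m + 2 * - r * q = m - 2 * r * q by ring.
by case: ifPn => // /andP[_ a0]; rewrite /slope E a0.
Qed.

(** Integrating along the rays first leaves the factor 1 / (u - z.e), whose
integral over the circle is [integral_angle].  For z outside the disk of radius
u, the point z - r e is outside the disk of radius u - r. *)
Lemma flight_kernel_step (k : nat) (u x y : R) : 0 < u ->
  (\int[mu]_(r in `]0%R, u]) \int[mu]_(th in `]0%R, (2 * pi)%R])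
     (flight_kernel k.+1 (u - r) (x - r * cos th, y - r * sin th)%R)%:E =
   (2 * pi / k.+1%:R * flight_kernel k.+2 u (x, y))%:E)%E.
Proof.
move=> u0.
pose f r th := (flight_kernel k.+1 (u - r) (x - r * cos th, y - r * sin th)%R)%:E.
have mf : measurable_fun setT (fun p : R * R => f p.1 p.2).
  by rewrite /f /flight_kernel /=; meas.
have f0 r th : (0 <= f r th)%E by rewrite lee_fin flight_kernel_ge0.
rewrite (@tonelli_on _ _ _ _ _ mu mu _ _ f (measurable_itv _) (measurable_itv _) mf f0).
have [xyu|uxy] := ltP (x ^+ 2 + y ^+ 2) (u ^+ 2); last first.
  rewrite /flight_kernel/= [X in _ && X](_ : _ = false) ?andbF ?mulr0; last first.
    by apply/negbTE; rewrite -leNgt -addrA -opprD subr_le0.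
  rewrite integral0_eq// => th _; rewrite integral0_eq// => r.
  rewrite /= in_itv/= => /andP[r0 ru]; rewrite /f /flight_kernel/=.
  case: ifPn => // /andP[]; rewrite subr_gt0 => ur.
  have H := cos2Dsin2 th.
  have := sqr_add_sqr_dot (x - r * cos th) (y - r * sin th) th.
  rewrite (_ : _ * _ + _ = x * cos th + y * sin th - r * (cos th ^+ 2 + sin th ^+ 2)); last by ring.
  rewrite H mulr1; set w := x * cos th + y * sin th.
  have -> : (x - r * cos th) ^+ 2 + (y - r * sin th) ^+ 2 =
      x ^+ 2 + y ^+ 2 - 2 * r * w + r ^+ 2.
    rewrite [LHS](_ : _ = x ^+ 2 + y ^+ 2 - 2 * r * w + r ^+ 2 * (cos th ^+ 2 + sin th ^+ 2)); last by rewrite /w; ring.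
    by rewrite H mulr1.
  rewrite (_ : (u - r) ^+ 2 - _ - _ = u ^+ 2 - x ^+ 2 - y ^+ 2 - 2 * r * (u - w) + r ^+ 2 * (1 - (cos th ^+ 2 + sin th ^+ 2))); last by rewrite /w; ring.
  rewrite H subrr mulr0 addr0 => A B.
  have uw : u < w.
    rewrite ltNge; apply/negP => wu.
    have : 0 <= 2 * r * (u - w) by rewrite !mulr_ge0 ?(ltW r0)// subr_ge0.
    by move=> ?; move: B; lra.
  have C : x ^+ 2 + y ^+ 2 - 2 * r * w + r ^+ 2 < (u - r) ^+ 2.
    rewrite (_ : (u - r) ^+ 2 = u ^+ 2 - 2 * r * u + r ^+ 2); last by ring.
    by move: B; rewrite mulrBr; lra.
  have : (u - r) ^+ 2 < (w - r) ^+ 2.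
    by rewrite ltr_sqr ?nnegrE ?subr_ge0 ?(ltW ur) ?ltrD2r// (ltW (lt_trans ur uw)).
  by move=> /lt_trans/(_ (le_lt_trans A C)); rewrite ltxx.
under eq_integral do rewrite (kernel_ray _ _ u0 xyu) EFinM.
have s0 : 0 < u ^+ 2 - x ^+ 2 - y ^+ 2 by lra.
rewrite ge0_integralZl//; last 2 first.
- by apply: measurable_funTS; meas.
- by move=> th _; rewrite lee_fin invr_ge0 subr_ge0 ltW// dot_lt.
rewrite integral_angle// -EFinM /flight_kernel/= u0 s0/=; congr (_%:E).
set s := Num.sqrt _.
have -> : u ^+ 2 - x ^+ 2 - y ^+ 2 = s ^+ 2 by rewrite sqr_sqrtr// ltW.
have sn0 : s != 0 by rewrite gt_eqF// sqrtr_gt0.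
by rewrite [s ^+ k.+2]exprS; field; rewrite sn0 /= addrC natr1 pnatr_eq0.
Qed.

End flight_kernel.

(** * The walk of unit speed *)

Section plane_measure.
Context {R : realType}.
Notation mu := (@lebesgue_measure R).

Let product_sigma_finite : sigma_finite setT (mu \x mu)%E.
Proof.
pose I (n : nat) := `[(- n%:R : R), n%:R]%classic.
exists (fun n => I n `*` I n).
  apply/seteqP; split => // -[x y] _.
  exists (Num.truncn (Num.max `|x| `|y|)).+1 => //=.
  have := ltW (truncnS_gt (Num.max `|x| `|y|)); rewrite ge_max => /andP[hx hy].
  by split; rewrite /I/= in_itv/= -ler_norml.
move=> n; split; first by apply: measurableX; exact: measurable_itv.
rewrite product_measure1E; [|exact: measurable_itv..].
have finI : (mu (I n) < +oo)%E.
  by rewrite lebesgue_measure_itv/=; case: ifP => _; rewrite ?ltry// -EFinD ltry.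
by rewrite lte_mul_pinfty// ge0_fin_numE.
Qed.

(** The product of the Lebesgue measures, together with its sigma-finiteness, which
Tonelli's theorem requires. *)
Definition plane_measure : {sigma_finite_measure set _ -> \bar R} :=
  HB.pack (mu \x mu)%E
    (Measure_isSigmaFinite.Build _ _ _ (mu \x mu)%E product_sigma_finite).

End plane_measure.

Section flight_value.
Context {R : realType}.
Notation mu := (@lebesgue_measure R).
Notation mu2 := (@plane_measure R).

Lemma ge0_integral_shift2 (h : R * R -> \bar R) (a b : R) :
  measurable_fun setT h -> (forall z, 0 <= h z)%E ->
  (\int[mu2]_z h (z.1 + a, z.2 + b)%R = \int[mu2]_z h z)%E.
Proof.
move=> mh h0.
have mh' : measurable_fun setT (fun z : R * R => h (z.1 + a, z.2 + b)) by meas.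
rewrite (@fubini_tonelli1 _ _ _ _ _ mu mu _ mh' (fun=> h0 _)).
rewrite (@fubini_tonelli1 _ _ _ _ _ mu mu _ mh h0) /fubini_F/=.
rewrite -[RHS](@ge0_integral_shift _ _ a); last 2 first.
- by apply: (@measurable_integral_param _ _ _ _ _ mu setT (fun x y : R => h (x, y))) => //; meas.
- by move=> x; exact: integral_ge0.
apply: eq_integral => x _.
by rewrite -[RHS](@ge0_integral_shift _ _ b)//; meas.
Qed.

Variables (lam : R) (h : R * R -> \bar R).
Hypotheses (lam0 : 0 < lam) (mh : measurable_fun setT h) (h0 : forall z, (0 <= h z)%E).

Definition angle_mean (f : R -> \bar R) : \bar R :=
  (((2 * pi)^-1)%:E * \int[mu]_(th in `]0%R, (2 * pi)%R]) f th)%E.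

(** The expectation of h at the end of a walk of unit speed that starts from z and
lasts for the time u, on the event of exactly k changes of direction.  The first
flight has the duration r and the direction th; the value is 0 when u < 0, so
that first flights longer than u do not count. *)
Fixpoint flight_value (k : nat) (u : R) (z : R * R) : \bar R :=
  match k with
  | 0 => ((if 0 <= u then expR (- lam * u) else 0)%:E *
      angle_mean (fun th => h (z.1 + u * cos th, z.2 + u * sin th)%R))%E
  | k'.+1 => (\int[mu]_(r in `[0%R, +oo[) ((lam * expR (- lam * r))%:E *
      angle_mean (fun th => flight_value k' (u - r)
        (z.1 + r * cos th, z.2 + r * sin th)%R)))%E
  end.

Let c2pi : 0 <= (2 * pi)^-1 :> R.
Proof. by rewrite invr_ge0 mulr_ge0// pi_ge0. Qed.

Lemma angle_mean_ge0 f : (forall th, 0 <= f th)%E -> (0 <= angle_mean f)%E.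
Proof. by move=> f0; rewrite mule_ge0 ?lee_fin// integral_ge0. Qed.

Lemma measurable_angle_mean d (T : measurableType d) (f : T -> R -> \bar R) :
  measurable_fun setT (fun p : T * R => f p.1 p.2) ->
  (forall x th, 0 <= f x th)%E ->
  measurable_fun setT (fun x => angle_mean (f x)).
Proof.
move=> mf f0; apply: fun_measurableMe; first exact: measurable_cst.
exact: (@measurable_integral_param _ _ _ _ _ mu).
Qed.

Lemma angle_meanZ (c : R) f : 0 <= c -> measurable_fun setT f ->
  (forall th, 0 <= f th)%E ->
  angle_mean (fun th => c%:E * f th)%E = (c%:E * angle_mean f)%E.
Proof.
move=> c0 mf f0; rewrite /angle_mean ge0_integralZl//; last exact: measurable_funTS.
by rewrite muleCA.
Qed.

Lemma flight_value_ge0 k u z : (0 <= flight_value k u z)%E.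
Proof.
elim: k u z => [|k IH] u z /=.
  by rewrite mule_ge0// ?angle_mean_ge0// lee_fin; case: ifP => // _; exact: expR_ge0.
apply: integral_ge0 => r _; rewrite mule_ge0 ?angle_mean_ge0// lee_fin.
by rewrite mulr_ge0 ?expR_ge0// ltW.
Qed.

Lemma measurable_flight_value k :
  measurable_fun setT (fun p : R * (R * R) => flight_value k p.1 p.2).
Proof.
elim: k => [|k IH] /=.
  apply: fun_measurableMe; first by meas.
  apply: (@measurable_angle_mean _ _ (fun (p : R * (R * R)) th =>
    h (p.2.1 + p.1 * cos th, p.2.2 + p.1 * sin th)%R)) => //.
  by meas.
pose g (p : R * (R * R)) (r : R) := ((lam * expR (- lam * r))%:E *
      angle_mean (fun th => flight_value k (p.1 - r)
        (p.2.1 + r * cos th, p.2.2 + r * sin th)%R))%E.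
apply: (@measurable_integral_param _ _ _ _ _ mu _ g) => //; last first.
  move=> p r; rewrite /g mule_ge0 ?angle_mean_ge0// => *; last exact: flight_value_ge0.
  by rewrite lee_fin mulr_ge0 ?expR_ge0// ltW.
apply: fun_measurableMe; first by meas.
apply: (@measurable_angle_mean _ _ (fun (p : R * (R * R) * R) th =>
  flight_value k (p.1.1 - p.2)
        (p.1.2.1 + p.2 * cos th, p.1.2.2 + p.2 * sin th)%R)).
  apply: (measurableT_comp IH (g := fun p : R * (R * R) * R * R =>
   (p.1.1.1 - p.1.2, (p.1.1.2.1 + p.1.2 * cos p.2, p.1.1.2.2 + p.1.2 * sin p.2)))).
  by meas.
by move=> *; exact: flight_value_ge0.
Qed.

Let flight_value_cut k u z :
  (forall v z', v < 0 -> flight_value k v z' = 0%E) ->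
  flight_value k.+1 u z =
  (\int[mu]_(r in `]0%R, u]) ((lam * expR (- lam * r))%:E *
      angle_mean (fun th => flight_value k (u - r)
        (z.1 + r * cos th, z.2 + r * sin th)%R)))%E.
Proof.
move=> V0 /=.
have mV : measurable_fun setT (fun r : R => ((lam * expR (- lam * r))%:E *
      angle_mean (fun th => flight_value k (u - r)
        (z.1 + r * cos th, z.2 + r * sin th)%R))%E).
  apply: fun_measurableMe; first by meas.
  apply: (@measurable_angle_mean _ _ (fun (r : R) th => flight_value k (u - r)
        (z.1 + r * cos th, z.2 + r * sin th)%R)) => [|*]; last exact: flight_value_ge0.
  apply: (measurableT_comp (measurable_flight_value k) (g := fun p : R * R =>
   (u - p.1, (z.1 + p.1 * cos p.2, z.2 + p.1 * sin p.2)))).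
  by meas.
rewrite -integral_itv_obnd_cbnd; last exact: measurable_funTS.
rewrite integral_mkcond [RHS]integral_mkcond; apply: eq_integral => r _.
rewrite !patchE !mem_setE !in_itv/= andbT.
have [r0|//] := ltP 0 r; have [//|ur] /= := leP r u.
rewrite /angle_mean integral0_eq ?mule0// => th _.
by rewrite V0// subr_lt0.
Qed.

(** The factor of the density of the displacement that does not depend on the
position, for k + 1 changes of direction. *)
Definition flight_constant (k : nat) (u : R) : R :=
  expR (- lam * u) * lam ^+ k.+1 / (2 * pi * k`!%:R).

Lemma flight_constant_ge0 k u : 0 <= flight_constant k u.
Proof.
rewrite /flight_constant divr_ge0 ?mulr_ge0 ?expR_ge0 ?exprn_ge0 ?pi_ge0//.
exact: ltW.
Qed.

Let kernel_part k u z w :=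
  ((flight_constant k u * flight_kernel k.+1 u w)%:E *
    h (z.1 + w.1, z.2 + w.2)%R)%E.

Let flight_value1 u z :
  flight_value 1 u z = (\int[mu2]_w kernel_part 0 u z w)%E.
Proof.
rewrite flight_value_cut => [|v z' v0 /=]; last by rewrite leNgt v0/= mul0e.
have [u0|u0] := ltP 0 u; last first.
  rewrite set_itv_ge ?bnd_simp -?leNgt// integral_set0 integral0_eq// => w _.
  by rewrite /kernel_part /flight_kernel ltNge u0/= mulr0 mul0e.
pose H w := h (z.1 + w.1, z.2 + w.2).
have mH : measurable_fun setT H by rewrite /H; meas.
pose f3 (r phi th : R) :=
  H (r * cos phi + (u - r) * cos th, r * sin phi + (u - r) * sin th).
have mf3 : measurable_fun setT (fun p : R * R * R => f3 p.1.1 p.1.2 p.2).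
  by rewrite /f3; meas.
pose f2 r phi := (\int[mu]_(th in `]0%R, (2 * pi)%R]) f3 r phi th)%E.
have mf2 : measurable_fun setT (fun p : R * R => f2 p.1 p.2).
  rewrite /f2; apply: (@measurable_integral_param _ _ _ _ _ mu _
    (fun (p : R * R) (th : R) => f3 p.1 p.2 th)) => // *.
  exact: h0.
have f20 r phi : (0 <= f2 r phi)%E by apply: integral_ge0 => *; exact: h0.
pose f1 r := (\int[mu]_(phi in `]0%R, (2 * pi)%R]) f2 r phi)%E.
have mf1 : measurable_fun setT f1.
  by rewrite /f1; apply: (@measurable_integral_param _ _ _ _ _ mu _ f2).
have f10 r : (0 <= f1 r)%E by apply: integral_ge0.
(* The densities of the first interarrival time and of the two directions, and
   the probability that the second interarrival time exceeds u - r; the two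
   exponentials in r cancel. *)
pose C := lam * expR (- lam * u) * (2 * pi)^-1 * (2 * pi)^-1.
have C0 : 0 <= C by rewrite /C !mulr_ge0 ?expR_ge0// ltW.
transitivity (C%:E * \int[mu]_(r in `]0%R, u]) f1 r)%E.
  rewrite -ge0_integralZl//; last exact: measurable_funTS.
  apply: eq_integral => r; rewrite inE/= in_itv/= => /andP[r0 ru].
  rewrite /= subr_ge0 ru.
  have -> : (fun phi => (expR (- lam * (u - r)))%:E * angle_mean (fun th =>
      h ((z.1 + r * cos phi) + (u - r) * cos th,
         (z.2 + r * sin phi) + (u - r) * sin th)%R))%E =
      (fun phi => (expR (- lam * (u - r)) * (2 * pi)^-1)%:E * f2 r phi)%E.
    apply/funext => phi; rewrite EFinM -muleA; congr (_ * (_ * _))%E.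
    by apply: eq_integral => th _; rewrite /f3 /H/= !addrA.
  rewrite angle_meanZ//; last 2 first.
  - by rewrite mulr_ge0// expR_ge0.
  - by apply: (measurableT_comp mf2 (g := fun phi : R => (r, phi))); meas.
  rewrite /angle_mean -/(f1 r) !muleA -!EFinM; congr (_%:E * _)%E.
  rewrite /C (_ : - lam * u = - lam * r + - lam * (u - r)); last by ring.
  by rewrite expRD; ring.
rewrite (integral_two_directions u0 mH (fun=> h0 _)).
pose K (w : R * R) := ((if w.1 ^+ 2 + w.2 ^+ 2 < u ^+ 2 then
  2 * pi / Num.sqrt (u ^+ 2 - w.1 ^+ 2 - w.2 ^+ 2) else 0)%:E * H w)%E.
have mK : measurable_fun setT K by rewrite /K; meas.
have K0 w : (0 <= K w)%E.
  rewrite mule_ge0 ?h0// lee_fin; case: ifP => // _.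
  by rewrite divr_ge0 ?mulr_ge0 ?pi_ge0 ?sqrtr_ge0.
have -> : (\int[mu]_x \int[mu]_y
     ((if x ^+ 2 + y ^+ 2 < u ^+ 2 then
         2 * pi / Num.sqrt (u ^+ 2 - x ^+ 2 - y ^+ 2) else 0)%:E * H (x, y)) =
   \int[mu2]_w K w)%E.
  by rewrite (@fubini_tonelli1 _ _ _ _ _ mu mu _ mK K0).
rewrite -(@ge0_integralZl _ _ _ mu2 _ measurableT K mK)//.
apply: eq_integral => w _; rewrite /K /kernel_part muleA -EFinM; congr (_%:E * _)%E.
rewrite /flight_kernel u0 -addrA -opprD subr_gt0/=; case: ifPn => wu; last by rewrite !mulr0.
set m := u ^+ 2 - _; have m0 : 0 < m by rewrite subr_gt0.
have sn0 : Num.sqrt m != 0 by rewrite gt_eqF// sqrtr_gt0.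
have -> : m = Num.sqrt m ^+ 2 by rewrite sqr_sqrtr// ltW.
rewrite sqrtr_sqr ger0_norm ?sqrtr_ge0// /C /flight_constant fact0 !expr1.
have pn0 : pi != 0 :> R by rewrite gt_eqF// pi_gt0.
by move: pn0; generalize (@pi R) => p pn0; field; rewrite sn0 pn0.
Qed.

(** Two flights are [integral_two_directions].  A further flight is a mean over the
translates of the kernel by r e; exchanging the integrals leaves, at each point,
the integral of [flight_kernel_step], which raises the index of the kernel by
one. *)
Lemma flight_valueE k u z :
  flight_value k.+1 u z =
  (\int[mu2]_w ((flight_constant k u * flight_kernel k.+1 u w)%:E *
    h (z.1 + w.1, z.2 + w.2)%R))%E.
Proof.
elim: k u z => [|k IH] u z; first exact: flight_value1.
rewrite flight_value_cut => [|v z' v0]; last first.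
  rewrite IH integral0_eq// => w _.
  by rewrite /flight_kernel ltNge (ltW v0)/= mulr0 mul0e.
have [u0|u0] := ltP 0 u; last first.
  rewrite set_itv_ge ?bnd_simp -?leNgt// integral_set0 integral0_eq// => w _.
  by rewrite /flight_kernel ltNge u0/= mulr0 mul0e.
pose H w := h (z.1 + w.1, z.2 + w.2).
have mH : measurable_fun setT H by rewrite /H; meas.
have H0 w : (0 <= H w)%E by exact: h0.
pose C := lam * expR (- lam * u) * lam ^+ k.+1 / (2 * pi * k`!%:R) / (2 * pi).
have C0 : 0 <= C.
  rewrite /C !divr_ge0 ?mulr_ge0 ?expR_ge0 ?exprn_ge0 ?pi_ge0//.
    exact: ltW.
  exact: ltW.
pose ker r th (w : R * R) :=
  (flight_kernel k.+1 (u - r) (w.1 - r * cos th, w.2 - r * sin th)%R)%:E.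
have mker : measurable_fun setT (fun p : R * R * (R * R) => ker p.1.1 p.1.2 p.2).
  apply/measurable_EFinP.
  apply: (measurableT_comp (measurable_flight_kernel k.+1)
   (g := fun p : R * R * (R * R) => (u - p.1.1, (p.2.1 - p.1.1 * cos p.1.2, p.2.2 - p.1.1 * sin p.1.2)))).
  by meas.
have ker0 r th w : (0 <= ker r th w)%E by rewrite lee_fin flight_kernel_ge0.
pose kH r th w := (ker r th w * H w)%E.
have mkH : measurable_fun setT (fun p : R * R * (R * R) => kH p.1.1 p.1.2 p.2).
  by apply: fun_measurableMe => //; meas.
have kH0 r th w : (0 <= kH r th w)%E by rewrite mule_ge0.
have mkH1 r : measurable_fun setT (fun p : R * (R * R) => kH r p.1 p.2).
  by apply: (measurableT_comp mkH (g := fun p : R * (R * R) => (r, p.1, p.2))); meas.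
pose g2 r th := (\int[mu2]_w kH r th w)%E.
have mg2 : measurable_fun setT (fun p : R * R => g2 p.1 p.2).
  by rewrite /g2; apply: (@measurable_integral_param _ _ _ _ _ mu2 setT (fun (p : R * R) (w : R * R) => kH p.1 p.2 w)).
have g20 r th : (0 <= g2 r th)%E by exact: integral_ge0.
pose G r w := (\int[mu]_(th in `]0%R, (2 * pi)%R]) kH r th w)%E.
have mG : measurable_fun setT (fun p : R * (R * R) => G p.1 p.2).
  rewrite /G; apply: (@measurable_integral_param _ _ _ _ _ mu _ (fun (p : R * (R * R)) (th : R) => kH p.1 th p.2)) => //.
  by apply: (measurableT_comp mkH (g := fun p : R * (R * R) * R => (p.1.1, p.2, p.1.2))); meas.
have G0 r w : (0 <= G r w)%E by exact: integral_ge0.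
transitivity (C%:E * \int[mu]_(r in `]0%R, u])
    \int[mu]_(th in `]0%R, (2 * pi)%R]) g2 r th)%E.
  rewrite -ge0_integralZl//; last 2 first.
  - apply: measurable_funTS.
    exact: (@measurable_integral_param _ _ _ _ _ mu _ g2).
  - by move=> r _; exact: integral_ge0.
  apply: eq_integral => r; rewrite inE/= in_itv/= => /andP[r0 ru].
  have -> : (fun th => flight_value k.+1 (u - r)
        (z.1 + r * cos th, z.2 + r * sin th)%R) =
      (fun th => (flight_constant k (u - r))%:E * g2 r th)%E.
    apply/funext => th; rewrite IH.
    have mq : measurable_fun setT (kH r th).
      by apply: (measurableT_comp (mkH1 r) (g := fun w : R * R => (th, w))); meas.
    rewrite /g2 -(@ge0_integral_shift2 _ (r * cos th) (r * sin th) mq)//.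
    rewrite -ge0_integralZl//; last 2 first.
    - by apply: (measurableT_comp mq (g := fun w : R * R => (w.1 + r * cos th, w.2 + r * sin th))); meas.
    - by rewrite lee_fin flight_constant_ge0.
    apply: eq_integral => w _; rewrite /kH /ker /H/= !addrK EFinM -muleA.
    by rewrite [w.1 + _]addrC [w.2 + _]addrC !addrA; case: w.
  rewrite angle_meanZ ?flight_constant_ge0//; last first.
    by apply: (measurableT_comp mg2 (g := fun th : R => (r, th))); meas.
  rewrite /angle_mean !muleA -!EFinM; congr (_%:E * _)%E.
  rewrite /C /flight_constant (_ : - lam * u = - lam * r + - lam * (u - r)); last by ring.
  have pn0 : pi != 0 :> R by rewrite gt_eqF// pi_gt0.
  have kn0 : k`!%:R != 0 :> R by rewrite pnatr_eq0 -lt0n fact_gt0.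
  rewrite expRD; move: pn0; generalize (@pi R) => p pn0.
  by field; rewrite pn0 kn0.
transitivity (C%:E * \int[mu]_(r in `]0%R, u]) \int[mu2]_w G r w)%E.
  congr (_ * _)%E; apply: eq_integral => r _.
  exact: (@tonelli_on _ _ _ _ _ mu mu2 _ _ (kH r) (measurable_itv _) measurableT (mkH1 r) (kH0 r)).
rewrite (@tonelli_on _ _ _ _ _ mu mu2 _ _ G (measurable_itv _) measurableT mG G0).
rewrite -ge0_integralZl//; last 2 first.
- apply: (@measurable_integral_param _ _ _ _ _ mu _ (fun (w : R * R) (r : R) => G r w)) => //.
  by apply: (measurableT_comp mG (g := fun p : R * R * R => (p.2, p.1))); meas.
- by move=> w _; exact: integral_ge0.
apply: eq_integral => -[x y] _; set w := (x, y).
have mker1 r : measurable_fun setT (fun th => ker r th w).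
  by apply: (measurableT_comp mker (g := fun th : R => (r, th, w))); meas.
have mker2 : measurable_fun setT (fun r => \int[mu]_(th in `]0%R, (2 * pi)%R]) ker r th w)%E.
  apply: (@measurable_integral_param _ _ _ _ _ mu _ (fun r th : R => ker r th w)) => //.
  by apply: (measurableT_comp mker (g := fun p : R * R => (p.1, p.2, w))); meas.
have -> : (\int[mu]_(r in `]0%R, u]) G r w = (\int[mu]_(r in `]0%R, u])
    \int[mu]_(th in `]0%R, (2 * pi)%R]) ker r th w) * H w)%E.
  rewrite -ge0_integralZr//; last 2 first.
  - exact: measurable_funTS.
  - by move=> r _; exact: integral_ge0.
  apply: eq_integral => r _; rewrite /G /kH ge0_integralZr//.
  exact: (measurable_funTS (mker1 r)).
rewrite /ker /= flight_kernel_step// muleA -EFinM /C /flight_constant; congr (_%:E * _)%E.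
have pn0 : pi != 0 :> R by rewrite gt_eqF// pi_gt0.
have kn0 : k`!%:R != 0 :> R by rewrite pnatr_eq0 -lt0n fact_gt0.
have k1n0 : k.+1%:R != 0 :> R by rewrite pnatr_eq0.
rewrite factS natrM [lam ^+ k.+2]exprS.
move: k1n0; move: (k.+1%:R) => k1 k1n0.
move: pn0; generalize (@pi R) => p pn0.
by field; rewrite pn0 kn0 k1n0.
Qed.

End flight_value.

(** * Travel times along a path *)

Section travel_time.
Context {R : realType}.
Notation mu := (@lebesgue_measure R).
Variable c : R -> R.
Hypotheses (c_gt0 : forall x, 0 < c x) (c_finite : finite_travel_time c).

Let ci x := (c x)^-1.

Let integrable_right b : 0 <= b -> mu.-integrable `[0, b] (EFin \o ci).
Proof. by move=> b0; have := c_finite b; rewrite min_l// max_r. Qed.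

Let integrable_left a : a <= 0 -> mu.-integrable `[a, 0] (EFin \o ci).
Proof. by move=> a0; have := c_finite a; rewrite min_r// max_l. Qed.

Lemma measurable_slowness : measurable_fun setT ci.
Proof.
have -> : [set: R] = \bigcup_n (`[(- n%:R : R), 0] `|` `[0, n%:R])%classic.
  apply/seteqP; split => // x _; exists (Num.truncn `|x|).+1 => //=.
  have := ltW (truncnS_gt `|x|); rewrite !in_itv/= ler_norml => /andP[-> ->].
  by rewrite andbT; apply/orP; exact: le_total.
apply/measurable_fun_bigcup => [n|n]; first by apply: measurableU; exact: measurable_itv.
apply/measurable_funU => //; split; apply/measurable_EFinP.
  by have := @integrable_left (- n%:R); rewrite oppr_le0 ler0n => /(_ isT)/integrableP[].
by have := @integrable_right n%:R; rewrite ler0n => /(_ isT)/integrableP[].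
Qed.

Lemma measurable_speed : measurable_fun setT c.
Proof.
have -> : c = fun x => (ci x)^-1 by apply/funext => x; rewrite /ci invrK.
by have mci := measurable_slowness; meas.
Qed.

Let ci_fin a b : a <= b -> (\int[mu]_(x in `]a, b]) (ci x)%:E < +oo)%E.
Proof.
move=> ab.
have m0 : Num.min a 0 <= 0 by rewrite ge_min lexx orbT.
have M0 : 0 <= Num.max b 0 by rewrite le_max lexx orbT.
have mci : measurable_fun setT (EFin \o ci).
  by apply/measurable_EFinP; exact: measurable_slowness.
have ci0 x : (0 <= (EFin \o ci) x)%E by rewrite lee_fin invr_ge0 ltW.
have le_ab : (\int[mu]_(x in `]a, b]) (ci x)%:E <=
    \int[mu]_(x in `](Num.min a 0)%R, (Num.max b 0)%R]) (EFin \o ci) x)%E.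
  apply: ge0_subset_integral => //; first exact: measurable_funTS.
    by move=> x _; exact: ci0.
  move=> x /=; rewrite !in_itv/= => /andP[ax xb].
    by rewrite gt_min ax le_max xb.
rewrite (le_lt_trans le_ab)//.
rewrite (ge0_integral_itv_split m0 M0 mci ci0).
have fin d e : mu.-integrable `[d, e] (EFin \o ci) ->
    (\int[mu]_(x in `]d, e]) (EFin \o ci) x < +oo)%E.
  move=> /integrableP[_]; rewrite -integral_itv_obnd_cbnd; last first.
    by apply: measurable_funTS; apply: measurableT_comp.
  by under eq_integral do rewrite gee0_abs//.
by rewrite lte_add_pinfty ?fin// ?integrable_left ?integrable_right.
Qed.

Let I a b : R := fine (\int[mu]_(x in `]a, b]) (ci x)%:E)%E.

Let IE a b : a <= b -> (\int[mu]_(x in `]a, b]) (ci x)%:E = (I a b)%:E)%E.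
Proof.
move=> ab; rewrite fineK// ge0_fin_numE ?ci_fin//.
by apply: integral_ge0 => x _; rewrite lee_fin invr_ge0 ltW.
Qed.

Let ID a b d : a <= b -> b <= d -> I a d = I a b + I b d.
Proof.
move=> ab bd; apply: EFin_inj; rewrite EFinD -!IE//; last exact: le_trans bd.
apply: ge0_integral_itv_split => //.
  by apply/measurable_EFinP; exact: measurable_slowness.
by move=> x; rewrite lee_fin invr_ge0 ltW.
Qed.

Let travel_timeE x :
  travel_time c x = if 0 <= x then I 0 x else - I x 0.
Proof.
have m (a b : R) : measurable_fun `]a, b] (EFin \o ci).
  by apply/measurable_EFinP/measurable_funTS; exact: measurable_slowness.
rewrite /travel_time /I /Rintegral; case: ifP => _; rewrite -?integral_itv_obnd_cbnd//.
Qed.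

Lemma travel_time0 : travel_time c 0 = 0.
Proof. by rewrite travel_timeE lexx /I set_itvoc0 integral_set0. Qed.

Lemma travel_time_increment u v : u <= v ->
  (\int[mu]_(x in `]u, v]) (c x)^-1%:E = (travel_time c v - travel_time c u)%:E)%E.
Proof.
move=> uv; rewrite IE// !travel_timeE; congr (_%:E).
have [u0|u0] := leP 0 u.
  by rewrite (le_trans u0 uv) (ID u0 uv); ring.
have [v0|v0] := leP 0 v.
  by rewrite (ID (ltW u0) v0); ring.
by rewrite (ID uv (ltW v0)); ring.
Qed.

Lemma travel_time_increasing u v : u < v -> travel_time c u < travel_time c v.
Proof.
move=> uv; apply: (@primitive_increasing _ u v _ ci) => //.
- by apply: measurable_funTS; exact: measurable_slowness.
- by move=> x _ _; rewrite invr_gt0.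
- by move=> ? ? _ ? _; exact: travel_time_increment.
Qed.

Lemma measurable_travel_time : measurable_fun setT (travel_time c).
Proof.
apply: nondecreasing_measurable => // u v; rewrite le_eqVlt => /predU1P[->//|uv].
exact/ltW/travel_time_increasing.
Qed.

Section stage.
Variables (Z : R -> R) (a b p : R).
Hypotheses (ab : a <= b) (cZ : mu.-integrable `[a, b] (EFin \o (fun r => c (Z r))))
  (ZE : forall s, a <= s -> s <= b ->
    Z s = Z a + (\int[mu]_(r in `]a, s[) c (Z r))%R * p).

Let mcZ : measurable_fun `]a, b] (fun r => c (Z r)).
Proof.
have /integrableP[/measurable_EFinP m _] := cZ.
apply: measurable_funS m => // x /=.
by rewrite !in_itv/= => /andP[/ltW-> ->].
Qed.

Let cZ_increment u v : a <= u -> u <= v -> v <= b ->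
  (\int[mu]_(r in `]u, v]) (c (Z r))%:E)%E =
  ((\int[mu]_(r in `]a, v[) c (Z r))%R - (\int[mu]_(r in `]a, u[) c (Z r))%R)%:E.
Proof.
move=> au uv vb.
have int d e : a <= d -> e <= b -> mu.-integrable `]d, e] (EFin \o (fun r => c (Z r))).
  move=> ad eb; apply: integrableS cZ => // x /=; rewrite !in_itv/=.
  by move=> /andP[dx xe]; rewrite (le_trans ad (ltW dx)) (le_trans xe eb).
have av := le_trans au uv.
have E e : e <= b -> (\int[mu]_(r in `]a, e[) c (Z r))%R = (\int[mu]_(r in `]a, e]) c (Z r))%R.
  move=> eb; rewrite Rintegral_itv_bndo_bndc//.
  apply: integrableS (int _ _ (lexx a) eb) => //.
  by move=> x /=; rewrite !in_itv/= => /andP[-> /ltW].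
rewrite !E//; last exact: le_trans vb.
have -> : `]a, v]%classic = `]a, u] `|` `]u, v].
  by rewrite -itv_bndbnd_setU// bnd_simp.
rewrite Rintegral_setU//.
- rewrite addrC addKr /Rintegral fineK// integrable_fin_num//.
  exact: int.
- by rewrite -itv_bndbnd_setU ?bnd_simp//; exact: int.
- rewrite disj_set2E; apply/eqP; rewrite -subset0 => x []/=.
  by rewrite !in_itv/= => /andP[_ xv] /andP[/lt_le_trans/(_ xv)]; rewrite ltxx.
Qed.

(** In integrated form, Z has the derivative p c (Z), so [travel_time c] of Z has the
derivative p.  For p > 0 this is the substitution x = Z r in the integral of
1 / c; for p < 0 it is the same substitution for - Z. *)
Lemma stage_travel_time :
  travel_time c (Z b) = travel_time c (Z a) + (b - a) * p.
Proof.
have mci : measurable_fun setT (fun x => (ci x)%:E).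
  by apply/measurable_EFinP; exact: measurable_slowness.
have ci0 x : (0 <= (ci x)%:E)%E by rewrite lee_fin invr_ge0 ltW.
have Ef (q : R) : 0 < q -> forall u v, a <= u -> u <= v -> v <= b ->
    (\int[mu]_(r in `]u, v]) (q * c (Z r))%:E = (q * ((\int[mu]_(r in `]a, v[) c (Z r))%R - (\int[mu]_(r in `]a, u[) c (Z r))%R))%:E)%E.
  move=> q0 u v au uv vb.
  under eq_integral do rewrite EFinM.
  rewrite ge0_integralZl//.
  - by rewrite cZ_increment// EFinM.
  - apply/measurable_EFinP; apply: measurable_funS mcZ => // x /=; rewrite !in_itv/=.
    by move=> /andP[ux xv]; rewrite (le_lt_trans au ux) (le_trans xv vb).
  - by move=> x _; rewrite lee_fin ltW.
  - by rewrite lee_fin ltW.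
have Eq (q : R) (g : R -> R) : (forall r, g (Z r) = c (Z r)) ->
   (\int[mu]_(r in `]a, b]) ((q * c (Z r))%:E * (g (Z r))^-1%:E) = ((b - a) * q)%:E)%E.
  move=> gE; transitivity (\int[mu]_(r in `]a, b]) (cst q%:E r))%E.
    by apply: eq_integral => r _; rewrite gE -EFinM -mulrA mulfV ?gt_eqF// mulr1.
  rewrite integral_cst; last exact: measurable_itv.
  rewrite /= lebesgue_measure_itv/= lte_fin mulrC.
  have [ab'|ba] := ltP a b; first by rewrite -EFinD -EFinM mulrC.
  have -> : b - a = 0 by apply/eqP; rewrite subr_eq0 eq_le ba.
  by rewrite mulr0 mule0.
have [p0|p0|p0] := ltgtP p 0; last first.
- by rewrite (ZE ab (lexx b)) p0 !mulr0 !addr0.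
- have FE u v : a <= u -> u <= v -> v <= b ->
      (\int[mu]_(x in `]u, v]) (p * c (Z x))%:E = (Z v - Z u)%:E)%E.
    move=> au uv vb; rewrite Ef//; congr (_%:E).
    rewrite [Z v]ZE ?[Z u]ZE//; [ring|exact: le_trans uv vb|exact: le_trans au uv].
  have mf : measurable_fun `]a, b] (fun r => p * c (Z r)).
    by apply: measurable_funM => //; exact: measurable_cst.
  have f0 x : a < x -> x <= b -> 0 < p * c (Z x) by move=> _ _; rewrite mulr_gt0.
  have := ge0_integral_substitution ab mf f0 FE mci ci0.
  rewrite (Eq p c)// travel_time_increment; last first.
    exact: (primitive_nondecreasing mf f0 FE).
  by move=> [->]; ring.
- have p0' : 0 < - p by rewrite oppr_gt0.
  have FE u v : a <= u -> u <= v -> v <= b ->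
      (\int[mu]_(x in `]u, v]) (- p * c (Z x))%:E = (- Z v - (- Z u))%:E)%E.
    move=> au uv vb; rewrite Ef//; congr (_%:E).
    rewrite [Z v]ZE ?[Z u]ZE//; [ring|exact: le_trans uv vb|exact: le_trans au uv].
  have mf : measurable_fun `]a, b] (fun r => - p * c (Z r)).
    by apply: measurable_funM => //; exact: measurable_cst.
  have f0 x : a < x -> x <= b -> 0 < - p * c (Z x) by move=> _ _; rewrite mulr_gt0.
  have mcN : measurable_fun setT (fun x : R => (ci (- x))%:E).
    by apply: (measurableT_comp mci (g := fun x : R => - x)); meas.
  have := ge0_integral_substitution ab mf f0 FE mcN (fun=> ci0 _).
  rewrite /= /ci; under eq_integral do rewrite opprK.
  rewrite (Eq (- p) c)//.
  have ZZ : Z b <= Z a.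
    by rewrite -lerN2; exact: (primitive_nondecreasing mf f0 FE).
  have -> : (\int[mu]_(x in `](- Z a)%R, (- Z b)%R]) (c (- x)%R)^-1%:E =
      \int[mu]_(x in `]Z b, Z a]) (c x)^-1%:E)%E.
    by rewrite (@ge0_integral_opp_itv _ (fun x => (ci x)%:E))// !opprK.
  by rewrite travel_time_increment// => -[E]; move: E; rewrite mulrN; lra.
Qed.

End stage.

End travel_time.

Section path.
Context {R : realType}.
Notation mu := (@lebesgue_measure R).
Variables (c : R -> R) (N : R -> nat) (tau p : nat -> R) (t : R) (Z : R -> R).
Hypotheses (c_gt0 : forall x, 0 < c x) (c_finite : finite_travel_time c)
  (tau0 : tau 0%N = 0) (tau_lt : forall k, tau k < tau k.+1)
  (count : forall s, 0 <= s -> forall k, (k <= N s)%N = (tau k <= s))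
  (t0 : 0 <= t)
  (cZ : mu.-integrable `[0, t] (EFin \o (fun r => c (Z r))))
  (ZE : forall s, 0 <= s <= t -> Z s = \sum_(0 <= j < (N s).+1)
     (\int[mu]_(r in `](if (j <= N s)%N then tau j else s),
                       (if (j.+1 <= N s)%N then tau j.+1 else s)[) c (Z r)) * p j).

Let tau_ge0 k : 0 <= tau k.
Proof. by elim: k => [|k IH]; rewrite ?tau0// (le_trans IH)// ltW. Qed.

Let counted n s : tau n <= s -> s < tau n.+1 -> N s = n.
Proof.
move=> ns sn; have s0 := le_trans (tau_ge0 n) ns.
by apply/eqP; rewrite eqn_leq [(n <= _)%N]count// ns andbT -ltnS ltnNge count// -ltNge.
Qed.

Let full n := \sum_(0 <= j < n) (\int[mu]_(r in `]tau j, tau j.+1[) c (Z r)) * p j.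

Let Z_counted n s : N s = n -> tau n <= s -> s <= t ->
  Z s = full n + (\int[mu]_(r in `]tau n, s[) c (Z r)) * p n.
Proof.
move=> Ns ns st; rewrite ZE; last by rewrite (le_trans (tau_ge0 n)).
rewrite Ns big_nat_recr//= leqnn ltnn; congr (_ + _).
by apply: eq_big_nat => j /= jn; rewrite jn (ltnW jn).
Qed.

(** At the epoch itself the next stage has begun, with an empty interval. *)
Let Z_epoch n : tau n <= t -> Z (tau n) = full n.
Proof.
move=> nt; rewrite (@Z_counted n) ?lexx//; last exact: counted.
by rewrite set_itv_ge ?bnd_simp -?leNgt// Rintegral_set0 mul0r addr0.
Qed.

Let stage n b : tau n <= b -> b <= tau n.+1 -> b <= t ->
  travel_time c (Z b) = travel_time c (Z (tau n)) + (b - tau n) * p n.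
Proof.
move=> nb bn bt; apply: stage_travel_time => //.
  apply: integrableS cZ => // x /=; rewrite !in_itv/= => /andP[nx xb].
  by rewrite (le_trans (tau_ge0 n) nx) (le_trans xb bt).
move=> s ns sb; rewrite Z_epoch; last exact: le_trans nb bt.
have [sn|] := ltP s (tau n.+1).
  by rewrite (@Z_counted n)//; [exact: counted|exact: le_trans sb bt].
move=> ns1; have -> : s = tau n.+1 by apply/eqP; rewrite eq_le ns1 (le_trans sb bn).
rewrite Z_epoch; last by rewrite (le_trans ns1)// (le_trans sb).
by rewrite /full big_nat_recr.
Qed.

(** The increments over the stages add up. *)
Lemma path_travel_time : travel_time c (Z t) =
  \sum_(0 <= j < N t) (tau j.+1 - tau j) * p j + (t - tau (N t)) * p (N t).
Proof.
have Nt : tau (N t) <= t by rewrite -count.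
have tN : t < tau (N t).+1 by rewrite ltNge -count// ltnn.
have E n : tau n <= t -> travel_time c (Z (tau n)) = \sum_(0 <= j < n) (tau j.+1 - tau j) * p j.
  elim: n => [|n IH] nt.
    by rewrite Z_epoch// /full !big_nil travel_time0.
  have nt' := le_trans (ltW (tau_lt n)) nt.
  by rewrite (@stage n) ?(ltW (tau_lt n))// big_nat_recr//= IH.
by rewrite (@stage (N t) t)// ?(ltW tN)// E.
Qed.

End path.

(** * From travel times to positions *)

(** The measurable rectangles are stable under intersection. *)
Lemma eq_measure_rectangles d1 d2 (T1 : measurableType d1) (T2 : measurableType d2)
    (R : realType) (m1 m2 : {measure set (T1 * T2) -> \bar R}) :
  (m1 setT < +oo)%E ->
  (forall A B, measurable A -> measurable B -> m1 (A `*` B) = m2 (A `*` B)) ->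
  forall X, measurable X -> m1 X = m2 X.
Proof.
move=> m1oo m12 X mX.
pose C : set (set (T1 * T2)) := [set C | exists A B, [/\ measurable A, measurable B & C = A `*` B]].
apply: (measure_unique C (fun=> setT)) => //.
- rewrite measurable_prod_measurableType //; congr (<<s _ >>).
  apply/seteqP; split => [_ [A mA [B mB <-]]|_ [A [B [mA mB ->]]]]; first by exists A, B.
  by exists A => //; exists B.
- move=> _ _ [A [B [mA mB ->]]] [A' [B' [mA' mB' ->]]].
  exists (A `&` A'), (B `&` B'); split; [exact: measurableI..|by rewrite setXI].
- by move=> _; exists setT, setT; split => //; rewrite setXTT.
- by rewrite bigcup_const.
- by move=> _ [A [B [mA mB ->]]]; exact: m12.
Qed.

Section transfer.
Context {R : realType}.
Notation mu := (@lebesgue_measure R).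
Notation mu2 := (@plane_measure R).

Section one_axis.
Variable c : R -> R.
Hypotheses (c_gt0 : forall x, 0 < c x) (c_finite : finite_travel_time c).

(** An increasing function turns half-open intervals into preimages of half-open
intervals, and the preimages of the measurable sets form a sigma-algebra. *)
Lemma travel_time_preimage (A : set R) : measurable A ->
  exists2 B, measurable B & A = travel_time c @^-1` B.
Proof.
move=> mA.
have sub : (@ocitv R) `<=` preimage_set_system setT (travel_time c) measurable.
  move=> _ [[a b] _ <-]; exists `]travel_time c a, travel_time c b]%classic.
    exact: measurable_itv.
  have incr := travel_time_increasing c_gt0 c_finite.
  have le_incr u v : (travel_time c u <= travel_time c v) = (u <= v).
    by apply: (le_mono (f := travel_time c)) => x y; exact: incr.
  have lt_incr u v : (travel_time c u < travel_time c v) = (u < v).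
    by rewrite !ltNge le_incr.
  by apply/seteqP; split => x; rewrite /= !in_itv/= le_incr lt_incr => // -[].
have sig : sigma_algebra setT (preimage_set_system setT (travel_time c) measurable).
  by apply: sigma_algebra_preimage; exact: sigma_algebra_measurable.
have [B mB <-] := smallest_sub sig sub mA.
by exists B => //; rewrite setTI.
Qed.

Lemma ge0_integral_travel_timeT (h : R -> \bar R) :
  measurable_fun setT h -> (forall x, 0 <= h x)%E ->
  (\int[mu]_x ((c x)^-1%:E * h (travel_time c x)) =
   \int[mu]_(u in range (travel_time c)) h u)%E.
Proof.
move=> mh h0; apply: ge0_integral_primitiveT => //.
- exact: measurable_slowness.
- by move=> x; rewrite invr_gt0.
- by move=> u v; exact: travel_time_increment.
Qed.

Lemma measurable_range_travel_time : measurable (range (travel_time c)).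
Proof.
have H x y z : travel_time c x <= z -> z <= travel_time c y -> range (travel_time c) z.
  move=> xz zy.
  have xy : x <= y.
    rewrite leNgt; apply/negP => /(travel_time_increasing c_gt0 c_finite).
    by rewrite ltNge (le_trans xz zy).
  have [u _ <-] : exists2 u, u \in `[x, y]%R & travel_time c u = z.
    apply: (IVT xy); last by rewrite ge_min le_max xz zy orbT.
    apply: (@primitive_continuous _ _ _ _ (fun x => (c x)^-1)) => //.
    - by apply: measurable_funTS; exact: measurable_slowness.
    - by move=> w _ _; rewrite invr_gt0.
    - by move=> w v _ wv _; exact: travel_time_increment.
  by exists u.
by apply: is_interval_measurable => _ _ [x _ <-] [y _ <-] z /andP[]; exact: H.
Qed.

End one_axis.

Variables c1 c2 : R -> R.
Hypotheses (c1_gt0 : forall x, 0 < c1 x) (c1_finite : finite_travel_time c1)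
  (c2_gt0 : forall x, 0 < c2 x) (c2_finite : finite_travel_time c2).

Let G (z : R * R) := (travel_time c1 z.1, travel_time c2 z.2).

Lemma measurable_travel_times : measurable_fun setT G.
Proof.
have m1 := measurable_travel_time c1_gt0 c1_finite.
have m2 := measurable_travel_time c2_gt0 c2_finite.
by rewrite /G; meas.
Qed.

Let rng := range (travel_time c1) `*` range (travel_time c2).

(** The one-dimensional change of variables in each coordinate; the range of the
travel times may be bounded, whence the restriction on the right. *)
Lemma ge0_integral_travel_times (h : R * R -> \bar R) :
  measurable_fun setT h -> (forall z, 0 <= h z)%E ->
  (\int[mu2]_z (((c1 z.1 * c2 z.2)^-1)%:E * h (G z)) = \int[mu2]_(z in rng) h z)%E.
Proof.
move=> mh h0.
have m1 := measurable_travel_time c1_gt0 c1_finite.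
have m2 := measurable_travel_time c2_gt0 c2_finite.
have s1 := measurable_speed c1_finite.
have s2 := measurable_speed c2_finite.
have mr1 := measurable_range_travel_time c1_gt0 c1_finite.
have mr2 := measurable_range_travel_time c2_gt0 c2_finite.
pose K z := (((c1 z.1 * c2 z.2)^-1)%:E * h (G z))%E.
have mK : measurable_fun setT K by rewrite /K /G; meas.
have K0 z : (0 <= K z)%E.
  by rewrite mule_ge0// lee_fin invr_ge0 mulr_ge0// ltW.
rewrite (@fubini_tonelli1 _ _ _ _ _ mu mu _ mK K0) /fubini_F.
rewrite [RHS]integral_mkcond.
have mh' : measurable_fun setT (h \_ rng).
  apply/(measurable_restrictT _ _).1; first exact: measurableX.
  exact: measurable_funTS.
have h'0 z : (0 <= (h \_ rng) z)%E by rewrite patchE; case: ifPn.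
rewrite (@fubini_tonelli1 _ _ _ _ _ mu mu _ mh' h'0) /fubini_F.
pose J x := (\int[mu]_(y in range (travel_time c2)) h (x, y))%E.
have mJ : measurable_fun setT J.
  apply: (@measurable_integral_param _ _ _ _ _ mu _ (fun x y : R => h (x, y))) => //.
  by meas.
have J0 x : (0 <= J x)%E by exact: integral_ge0.
transitivity (\int[mu]_x ((c1 x)^-1%:E * J (travel_time c1 x)))%E.
  apply: eq_integral => x _; rewrite /J.
  rewrite -(ge0_integral_travel_timeT c2_gt0 c2_finite (h := fun y => h (travel_time c1 x, y)))//; last by meas.
  rewrite -ge0_integralZl//; last 3 first.
  - by meas.
  - by move=> y _; rewrite mule_ge0// lee_fin invr_ge0 ltW.
  - by rewrite lee_fin invr_ge0 ltW.
  by apply: eq_integral => y _; rewrite /K/= invfM EFinM muleA.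
rewrite (ge0_integral_travel_timeT c1_gt0 c1_finite mJ J0).
rewrite integral_mkcond; apply: eq_integral => x _.
rewrite patchE; case: ifPn => xr.
  rewrite /J [LHS]integral_mkcond.
  by congr (integral mu _ _); apply/funext => y; rewrite !patchE in_setX xr.
by rewrite integral0_eq// => y _; rewrite patchE in_setX (negbTE xr).
Qed.

(** Both sides are measures, so it suffices to compare them on rectangles, and a
rectangle is the preimage of a rectangle. *)
Lemma travel_times_density (m : {measure set (measurableTypeR R * measurableTypeR R) -> \bar R}) (f : R * R -> R) :
  (m setT < +oo)%E -> measurable_fun setT f -> (forall z, 0 <= f z) ->
  (forall B, measurable B -> m (G @^-1` B) = (\int[mu2]_(z in B) (f z)%:E)%E) ->
  forall A, measurable A -> m A =
    (\int[mu2]_(z in A) ((c1 z.1 * c2 z.2)^-1 * f (G z))%:E)%E.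
Proof.
move=> moo mf f0 mE A mA.
have mG := measurable_travel_times.
have s1 := measurable_speed c1_finite.
have s2 := measurable_speed c2_finite.
pose p z := (c1 z.1 * c2 z.2)^-1 * f (G z).
have mp : measurable_fun setT p by rewrite /p; meas.
have p0 z : 0 <= p z by rewrite /p mulr_ge0// invr_ge0 mulr_ge0// ltW.
rewrite -[RHS]/(weighted mu2 mp p0 A).
apply: eq_measure_rectangles => // {mA}A1 A2 mA1 mA2.
have [B1 mB1 A1E] := travel_time_preimage c1_gt0 c1_finite mA1.
have [B2 mB2 A2E] := travel_time_preimage c2_gt0 c2_finite mA2.
have mr1 := measurable_range_travel_time c1_gt0 c1_finite.
have mr2 := measurable_range_travel_time c2_gt0 c2_finite.
have mB : measurable (B1 `*` B2) by exact: measurableX.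
have mrng : measurable rng by exact: measurableX.
have -> : A1 `*` A2 = G @^-1` ((B1 `*` B2) `&` rng).
  rewrite A1E A2E; apply/seteqP; split => [z [/= z1 z2]|z [[]]//].
  by split; split => //=; [exists z.1|exists z.2].
rewrite mE; last exact: measurableI.
rewrite /= /weighted_set integral_mkcondl.
have mfB : measurable_fun setT ((EFin \o f) \_ (B1 `*` B2)).
  apply/(measurable_restrictT _ _).1 => //.
  by apply: measurable_funTS; exact/measurable_EFinP.
rewrite -ge0_integral_travel_times//; last first.
  by move=> z; rewrite patchE; case: ifPn => // _; rewrite lee_fin.
rewrite [RHS]integral_mkcond; apply: eq_integral => z _.
rewrite !patchE /p.
have -> : (z \in G @^-1` ((B1 `*` B2) `&` rng)) = (G z \in B1 `*` B2).
  apply/idP/idP; rewrite !inE; [by case|move=> H].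
  by split; [exact: H|split; [exists z.1|exists z.2]].
by case: ifPn => _; rewrite ?mule0// EFinM.
Qed.

End transfer.

(** * Laws, and independence of the past and the future *)

Section law.
Context d d' (T : measurableType d) (U : measurableType d') (R : realType).
Variables (P : probability T R) (f : T -> U).
Hypothesis mf : measurable_fun setT f.

Let f_mfun : {mfun T >-> U} := HB.pack f (isMeasurableFun.Build _ _ _ _ f mf).

Definition law : probability U R := distribution P f_mfun.

Lemma ge0_integral_law (h : U -> \bar R) :
  measurable_fun setT h -> (forall x, 0 <= h x)%E ->
  (\int[law]_y h y = \int[P]_x h (f x))%E.
Proof. by move=> mh h0; rewrite (ge0_integral_pushforward mf). Qed.

End law.

Section laws.
Context {d : measure_display} {T : measurableType d} {R : realType}.
Variable P : probability T R.
Notation mu := (@lebesgue_measure R).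

Lemma integral_exponential_law (lam : R) (Z : T -> measurableTypeR R)
    (mZ : measurable_fun setT Z) (f : R -> \bar R) : 0 < lam ->
  has_law P Z (exponential_prob lam) ->
  measurable_fun setT f -> (forall x, 0 <= f x)%E ->
  (\int[law P mZ]_x f x =
   \int[mu]_(x in `[0%R, +oo[) ((lam * expR (- lam * x))%:E * f x))%E.
Proof.
move=> lam0 Zlaw mf f0.
rewrite (@ge0_integral_density _ _ _ mu (law P mZ) (exponential_pdf lam))//; last 2 first.
- exact: measurable_exponential_pdf.
- by move=> x; apply: exponential_pdf_ge0; exact: ltW.
rewrite [RHS]integral_mkcond; apply: eq_integral => x _.
rewrite patchE mem_setE in_itv/= andbT; have [x0|x0] := leP 0 x.
  by rewrite exponential_pdfE.
by rewrite lt0_exponential_pdf// mul0e.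
Qed.

Lemma integral_uniform_law (Z : T -> measurableTypeR R)
    (mZ : measurable_fun setT Z) (f : R -> \bar R) :
  has_law P Z (uniform_prob (two_pi_gt0 (R := R))) ->
  measurable_fun setT f -> (forall x, 0 <= f x)%E ->
  (\int[law P mZ]_x f x = angle_mean f)%E.
Proof.
move=> Zlaw mf f0.
transitivity (\int[uniform_prob (two_pi_gt0 (R := R))]_x f x)%E.
  by apply: eq_measure_integral => A mA _; exact: Zlaw.
rewrite integral_uniform// subr0 /angle_mean -integral_itv_obnd_cbnd//.
exact: measurable_funTS.
Qed.

Lemma integral_exponential_tail (lam u : R) : 0 < lam -> 0 <= u ->
  (\int[mu]_(x in `[0%R, +oo[) ((lam * expR (- lam * x))%:E *
     (if u < x then 1 else 0)%:E) = (expR (- lam * u))%:E)%E.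
Proof.
move=> lam0 u0.
have dF (x : R) : is_derive x (1 : R) (fun x => - expR (- lam * x)) (lam * expR (- lam * x)).
  have d1 := is_deriveZ (- lam) (is_derive_id x (1 : R)).
  have d2 := @is_derive1_comp _ (@expR R) _ x _ _ (is_derive_expR _) d1.
  have d3 := is_deriveN d2.
  refine (is_derive_eq d3 _); rewrite /GRing.scale/=; ring.
have cf : continuous (fun x : R => lam * expR (- lam * x)).
  move=> x; apply: (@continuousM _ _ (cst lam) (fun x => expR (- lam * x))).
    exact: cst_continuous.
  apply: (@continuous_comp _ _ _ (fun x : R => - lam * x) (@expR R)).
    by apply: (@continuousM _ _ (cst (- lam)) id) => //; exact: cst_continuous.
  exact: continuous_expR.
have cF : continuous (fun x : R => - expR (- lam * x)).
  move=> x; apply: differentiable_continuous; apply/derivable1_diffP.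
  by have [] := dF x.
transitivity (\int[mu]_(x in `]u, +oo[) (lam * expR (- lam * x))%:E)%E.
  rewrite [LHS]integral_mkcond [RHS]integral_mkcond; apply: eq_integral => x _.
  rewrite !patchE !mem_setE !in_itv/= !andbT.
  have [ux|xu] := ltP u x; last by rewrite mule0; case: ifP.
  by rewrite (le_trans u0 (ltW ux)) mule1.
rewrite integral_itv_obnd_cbnd; last first.
  by apply: measurable_funTS; apply/measurable_EFinP; exact: continuous_measurable_fun.
rewrite (@ge0_continuous_FTC2y _ _ (fun x => - expR (- lam * x)) u 0)//.
- by rewrite EFinN oppeK add0e.
- by move=> x _; rewrite mulr_ge0 ?expR_ge0// ltW.
- exact: continuous_subspaceT.
- rewrite -oppr0; apply: cvgN.
  rewrite (_ : (fun x => expR (- lam * x)) = (fun z => expR (- z)) \o (fun z => lam * z)); last first.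
    by apply/funext => x /=; rewrite mulNr.
  apply: (@cvg_comp _ _ _ _ _ _ (pinfty_nbhs R)); last exact: cvgr_expR.
  exact: gt0_cvgMry.
- by apply: cvg_at_right_filter; exact: cF.
- by move=> x _; rewrite derive1E; have [_] := dF x.
Qed.

End laws.

Section future_independence.
Context {d : measure_display} {T : measurableType d} {R : realType}.
Variables (P : probability T R) (zeta : nat -> T -> measurableTypeR R).
Hypothesis mzeta : forall i, measurable_fun setT (zeta i).

(** H is meant to be a function of the first k terms of the sequence zeta. *)
Definition independent_of_future {d' : measure_display} {E : measurableType d'}
    (k : nat) (H : T -> E) : Prop :=
  forall A, measurable A -> forall (s : seq nat) (B : nat -> set R), uniq s ->
    (forall i, i \in s -> (k <= i)%N) -> (forall i, measurable (B i)) ->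
    P (H @^-1` A `&` \bigcap_(i in [set` s]) (zeta i @^-1` B i)) =
    (P (H @^-1` A) * \prod_(i <- s) P (zeta i @^-1` B i))%E.

Lemma independent_of_future_map d1 (E1 : measurableType d1) d2
    (E2 : measurableType d2) k (H : T -> E1) (g : E1 -> E2) :
  measurable_fun setT g -> independent_of_future k H ->
  independent_of_future k (g \o H).
Proof.
move=> mg indH A mA s B us sk mB.
have mgA : measurable (g @^-1` A) by rewrite -[X in measurable X]setTI; exact: mg.
by have := indH _ mgA s B us sk mB.
Qed.

Lemma independent_of_future_cst d1 (E1 : measurableType d1) (x : E1) :
  mutually_independent P zeta -> independent_of_future 0 (fun=> x).
Proof.
move=> indz A mA s B us _ mB; rewrite preimage_cst.
case: ifPn => _; last by rewrite set0I !measure0 mul0e.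
by rewrite setTI probability_setT mul1e; exact: indz.
Qed.

Section extension.
Context d1 (E1 : measurableType d1) (k : nat) (H : T -> E1).
Hypotheses (mH : measurable_fun setT H) (indH : independent_of_future k H).

Let pair w := (H w, zeta k w).

Let mpair : measurable_fun setT pair.
Proof. by rewrite /pair; apply: measurable_fun_pair. Qed.

Let update (B : nat -> set R) (C : set R) i := if i == k then C else B i.

Let indH_pair A C (s : seq nat) B : measurable A -> measurable C ->
  uniq s -> (forall i, i \in s -> (k < i)%N) -> (forall i, measurable (B i)) ->
  P (pair @^-1` (A `*` C) `&` \bigcap_(i in [set` s]) (zeta i @^-1` B i)) =
  (P (H @^-1` A) * P (zeta k @^-1` C) * \prod_(i <- s) P (zeta i @^-1` B i))%E.
Proof.
move=> mA mC us sk mB.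
have ks : k \notin s by apply/negP => /sk; rewrite ltnn.
have := indH mA (s := k :: s) (B := update B C).
rewrite /= ks us => /(_ isT) HH.
have upd i : i \in s -> update B C i = B i.
  by move=> si; rewrite /update; case: eqP => // ik; move: ks; rewrite -ik si.
have updk : update B C k = C by rewrite /update eqxx.
rewrite big_cons updk muleA in HH.
have -> : (\prod_(i <- s) P (zeta i @^-1` B i) =
    \prod_(i <- s) P (zeta i @^-1` update B C i))%E.
  by apply: eq_big_seq => i si; rewrite upd.
rewrite -HH; last 2 first.
- by move=> i; rewrite inE => /predU1P[->//|/sk/ltnW].
- by move=> i; rewrite /update; case: ifP => _; [exact: mC|exact: mB].
congr (P _); apply/seteqP; split => w.
  move=> [[wA wC] wB]; split => // i; rewrite /= inE => /predU1P[->|si].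
    by rewrite /update eqxx.
  by rewrite upd//; exact: wB.
move=> [wA wB]; split; first split => //.
  by have := wB k; rewrite /= inE eqxx /update eqxx => /(_ isT).
by move=> i si; have := wB i; rewrite /= inE si orbT upd// => /(_ isT).
Qed.

Let indH_rectangle A C : measurable A -> measurable C ->
  P (pair @^-1` (A `*` C)) = (P (H @^-1` A) * P (zeta k @^-1` C))%E.
Proof.
move=> mA mC; have := @indH_pair A C [::] (fun=> setT) mA mC isT.
rewrite big_nil mule1 (_ : [set` [::]] = set0) ?bigcap_set0 ?setIT; last first.
  by apply/seteqP; split.
by move=> -> // _; exact: measurableT.
Qed.

(** The independence of H and of the next term, as a product law. *)
Lemma law_pair_future : forall X, measurable X ->
  law P mpair X =
  (law P mH \x law P (mzeta k))%E X.
Proof.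
apply: eq_measure_rectangles.
  by apply: (@le_lt_trans _ _ 1%E); [exact: probability_le1|exact: ltry].
move=> A B mA mB.
transitivity (law P mH A * law P (mzeta k) B)%E; last first.
  by apply/esym; exact: product_measure1E.
exact: indH_rectangle.
Qed.

(** For a fixed event of the future, both sides are finite measures of the set X.
On a rectangle, the condition on the next term can be moved into the event of
the future of H. *)
Lemma independent_of_future_pair : independent_of_future k.+1 pair.
Proof.
move=> X mX s B us sk mB.
pose F := \bigcap_(i in [set` s]) (zeta i @^-1` B i).
have mF : measurable F.
  apply: fin_bigcap_measurable => // i _.
  by rewrite -[X in measurable X]setTI; apply: (mzeta i) => //; exact: mB.
pose q : {nonneg R} := NngNum (fine_ge0 (measure_ge0 P F)).
have Fq : (\prod_(i <- s) P (zeta i @^-1` B i) = q%:num%:E)%E.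
  have := @indH_pair setT setT s B measurableT measurableT us sk mB.
  rewrite !preimage_setT probability_setT !mul1e => <-.
  by rewrite setXTT preimage_setT setTI /= fineK// fin_num_measure.
have mpX : measurable (pair @^-1` X).
  by rewrite -[X in measurable X]setTI; exact: mpair.
rewrite Fq.
pose m1 := image_measure (mrestr P mF) mpair.
pose m2 := mscale q (law P mpair).
suff : m1 X = m2 X by rewrite /m1 /m2 /= /mscale /pushforward /mrestr muleC.
apply: eq_measure_rectangles => //.
  rewrite /m1 /= /pushforward /mrestr preimage_setT setTI.
  by rewrite (le_lt_trans (probability_le1 P mF)) ?ltry.
move=> A C mA mC; rewrite /m1 /m2 /= /mscale /pushforward /mrestr.
rewrite indH_pair// Fq muleC; congr (_ * _)%E.
by rewrite -indH_rectangle.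
Qed.

Lemma integral_pair_future (f : E1 * R -> \bar R) :
  measurable_fun setT f -> (forall z, 0 <= f z)%E ->
  (\int[P]_w f (H w, zeta k w) =
   \int[P]_w \int[law P (mzeta k)]_x f (H w, x))%E.
Proof.
move=> mf f0.
rewrite -(@ge0_integral_law _ _ _ _ _ P _ mpair)//.
transitivity (\int[law P mH \x law P (mzeta k)]_z f z)%E.
  by apply: eq_measure_integral => X mX _; exact: law_pair_future.
rewrite (@fubini_tonelli1 _ _ _ _ R (law P mH) (law P (mzeta k)) f mf f0).
rewrite ge0_integral_law//.
- exact: (@measurable_fun_fubini_tonelli_F _ _ _ _ R (law P (mzeta k)) f mf f0).
- by move=> x; exact: integral_ge0.
Qed.

End extension.

End future_independence.

(** * Epochs as counting events *)

Section ae_completion.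
Context {d : measure_display} {T : measurableType d} {R : realType}.
Variable P : probability T R.

Lemma ae_eq_measure (A B : set T) : measurable A -> measurable B ->
  {ae P, forall w, A w <-> B w} -> P A = P B.
Proof.
have le (A' B' : set T) : measurable A' -> measurable B' ->
    {ae P, forall w, A' w <-> B' w} -> (P A' <= P B')%E.
  move=> mA mB [N [mN N0 sub]].
  apply: (@le_trans _ _ (P (B' `|` N))).
    apply: le_measure; rewrite ?inE//; first exact: measurableU.
    move=> w Aw; have [Nw|Nw] := pselect (N w); [by right|left].
    have : ~ (~` [set w | A' w <-> B' w]) w by move=> /sub.
    by move=> /contrapT [AB _]; exact: AB.
  rewrite (le_trans (measureU2 _ mB mN))//.
  by rewrite [X in (_ + X)%E](_ : _ = 0%E) ?adde0.
move=> mA mB AB; apply/eqP; rewrite eq_le le//= le//.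
by apply: filterS AB => w [].
Qed.

(** The counting process determines the epochs only up to null events, so its
sigma-algebra is enlarged by the events that are almost surely equal to one of
its members. *)
Definition ae_completion (F : set (set T)) : set (set T) :=
  [set A | exists2 G, F G & {ae P, forall w, A w <-> G w}].

Lemma sigma_algebra_ae_completion F :
  sigma_algebra setT F -> sigma_algebra setT (ae_completion F).
Proof.
move=> [F0 FC FU]; split.
- by exists set0 => //; exact: aeW.
- move=> A [G FG AG]; exists (~` G); first by rewrite -setTD; exact: FC.
  by apply: filterS AG => w AGw; split => [[_ nA] /AGw//|nG]; split => // /AGw.
- move=> A HA.
  have /choice[G HG] : forall n, exists G, F G /\ {ae P, forall w, A n w <-> G w}.
    by move=> n; have [G ? ?] := HA n; exists G.
  exists (\bigcup_n G n); first by apply: FU => n; have [] := HG n.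
  have : {ae P, forall w, forall n, A n w <-> G n w}.
    by apply: ae_foralln => n; have [] := HG n.
  apply: filterS => w AGw; split => [[n _ /AGw]|[n _ /AGw]]; by exists n.
Qed.

End ae_completion.

Section poisson_process_facts.
Context {d : measure_display} {T : measurableType d} {R : realType}.
Variables (P : probability T R) (lam : R) (N : R -> {RV P >-> nat})
  (tau : nat -> {RV P >-> R}).
Hypotheses (lam0 : 0 < lam) (N_poisson : poisson_process lam N tau).
Notation mu := (@lebesgue_measure R).

Definition interarrival (k : nat) (w : T) : measurableTypeR R := tau k.+1 w - tau k w.

Lemma measurable_interarrival k : measurable_fun setT (interarrival k).
Proof. exact: (measurable_funB (measurable_funPT (tau k.+1)) (measurable_funPT (tau k))). Qed.

(** An exponential variable is almost surely positive. *)
Lemma epochs_increasing : {ae P, forall w, forall k, tau k w < tau k.+1 w}.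
Proof.
apply: ae_foralln => k.
have mS : measurable (interarrival k @^-1` `]-oo, 0]).
  by rewrite -[X in measurable X]setTI; exact: measurable_interarrival.
exists (interarrival k @^-1` `]-oo, 0]); split => //.
  apply: (etrans (interarrival_law N_poisson k (measurable_itv `]-oo, 0%R]))).
  rewrite /exponential_prob -integral_itv_bndo_bndc; last first.
    by apply: measurable_funTS; apply/measurable_EFinP; exact: measurable_exponential_pdf.
  apply: integral0_eq => x; rewrite /= in_itv/= => x0.
  by rewrite lt0_exponential_pdf.
move=> w /= /negP; rewrite -leNgt => H.
by rewrite in_itv/= /interarrival subr_le0.
Qed.

Lemma epochs_ge0 : {ae P, forall w, forall k, 0 <= tau k w}.
Proof.
apply: filterS epochs_increasing => w inc k.
elim: k => [|k IH]; first by rewrite (epoch0 N_poisson).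
exact: le_trans IH (ltW (inc k)).
Qed.

Notation counting_events :=
  (generated_sigma_algebra [set s : R | 0 <= s] (fun s => N s : T -> nat)).

(** For s >= 0, this is almost surely the event that k <= N s. *)
Lemma epoch_counting_event (k : nat) (s : R) :
  ae_completion P counting_events [set w | tau k w <= s].
Proof.
have [s0|s0] := leP 0 s; last first.
  exists set0; first by have [] := @smallest_sigma_algebra T setT (\bigcup_(i in [set s : R | 0 <= s]) preimage_set_system setT (N i : T -> nat) measurable).
  apply: filterS epochs_ge0 => w /(_ k) t0; split => // /= ts.
  by have := lt_le_trans (le_lt_trans ts s0) t0; rewrite ltxx.
exists (N s @^-1` [set n | (k <= n)%N]).
  apply: sub_sigma_algebra; exists s => //.
  by exists [set n | (k <= n)%N] => //; rewrite setTI.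
by apply: filterS (counting_epochs N_poisson) => w /(_ s s0 k) /= <-.
Qed.

Lemma interarrival_counting_event k (B : set R) : measurable B ->
  ae_completion P counting_events (interarrival k @^-1` B).
Proof.
have sig : sigma_algebra setT (ae_completion P counting_events).
  by apply: sigma_algebra_ae_completion; exact: smallest_sigma_algebra.
pose T' := g_sigma_algebraType (ae_completion P counting_events).
have T'E (A : set T) : (@measurable _ T') A = ae_completion P counting_events A.
  by rewrite -[LHS]/(<<s ae_completion P counting_events >> A) sigma_algebra_id.
have mtau j : measurable_fun setT (tau j : T' -> R).
  apply: (measurability _ (RGenOInfty.measurableE R)) => _ [_ [x ->] <-].
  rewrite setTI T'E.
  have [_ HC _] := sig.
  have := HC _ (epoch_counting_event j x).
  congr (ae_completion _ _ _); apply/seteqP; split => w /=.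
    by move=> [_ /negP]; rewrite -ltNge in_itv/= andbT.
  by rewrite in_itv/= andbT ltNge => /negP H; split.
move=> mB.
have mE : measurable_fun setT (interarrival k : T' -> R).
  exact: (measurable_funB (mtau k.+1) (mtau k)).
have := mE measurableT _ mB.
by rewrite setTI T'E.
Qed.

Lemma finite_interarrival_counting_event (s : seq nat) (B : nat -> set R) :
  (forall i, measurable (B i)) ->
  ae_completion P counting_events
    (\bigcap_(i in [set` s]) (interarrival i @^-1` B i)).
Proof.
move=> mB.
have sig : sigma_algebra setT (ae_completion P counting_events).
  by apply: sigma_algebra_ae_completion; exact: smallest_sigma_algebra.
pose T' := g_sigma_algebraType (ae_completion P counting_events).
have T'E (A : set T) : (@measurable _ T') A = ae_completion P counting_events A.
  by rewrite -[LHS]/(<<s ae_completion P counting_events >> A) sigma_algebra_id.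
rewrite -T'E; apply: fin_bigcap_measurable => // i _.
by rewrite T'E; exact: interarrival_counting_event.
Qed.

End poisson_process_facts.

(** * The sequence of flights *)

Section alternating_sequence.
Context {d : measure_display} {T : measurableType d} {R : realType}.
Variables (P : probability T R) (lam : R) (N : R -> {RV P >-> nat})
  (tau theta : nat -> {RV P >-> R}).
Hypotheses (N_poisson : poisson_process lam N tau)
  (theta_directions : random_directions N theta).

(** The flights in chronological order: the duration of each one is followed by its
direction. *)
Definition alternating (i : nat) (w : T) : measurableTypeR R :=
  if odd i then theta i./2 w else interarrival tau i./2 w.

Lemma measurable_alternating i : measurable_fun setT (alternating i).
Proof.
rewrite /alternating; case: odd; last exact: measurable_interarrival.
exact: (measurable_funPT (theta i./2)).
Qed.

Lemma counting_event_measurable G :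
  generated_sigma_algebra [set s : R | 0 <= s] (fun s => N s : T -> nat) G ->
  measurable G.
Proof.
apply: smallest_sub; first exact: sigma_algebra_measurable.
move=> _ [s _ [B mB <-]]; exact: (measurable_funPT (N s)).
Qed.

Lemma finite_direction_event (s : seq nat) (B : nat -> set R) :
  (forall i, measurable (B i)) ->
  generated_sigma_algebra setT (fun j => theta j : T -> R)
    (\bigcap_(i in [set` s]) (theta i @^-1` B i)).
Proof.
move=> mB; rewrite /generated_sigma_algebra.
set F := \bigcup_(i in _) _.
change (measurable ((\bigcap_(i in [set` s]) (theta i @^-1` B i)) : set (g_sigma_algebraType F))).
apply: fin_bigcap_measurable => // i _; apply: sub_sigma_algebra.
by exists i => //; exists (B i); [exact: mB|rewrite setTI].
Qed.

(** A product event splits into an event on the directions and an event on the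
interarrival times.  The latter is almost surely a counting event, hence
independent of the former; each of them is a product by hypothesis. *)
Lemma alternating_independent : mutually_independent P alternating.
Proof.
move=> s B us mB.
pose odds := [seq i./2 | i <- s & odd i].
pose evens := [seq i./2 | i <- s & ~~ odd i].
pose A := \bigcap_(j in [set` odds]) (theta j @^-1` B j.*2.+1).
pose C := \bigcap_(j in [set` evens]) (interarrival tau j @^-1` B j.*2).
have uodds : uniq odds.
  rewrite map_inj_in_uniq ?filter_uniq// => i j.
  rewrite !mem_filter => /andP[oi _] /andP[oj _] ij.
  by rewrite -(odd_double_half i) -(odd_double_half j) oi oj ij.
have uevens : uniq evens.
  rewrite map_inj_in_uniq ?filter_uniq// => i j.
  rewrite !mem_filter => /andP[/negbTE oi _] /andP[/negbTE oj _] ij.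
  by rewrite -(odd_double_half i) -(odd_double_half j) oi oj ij.
have -> : \bigcap_(i in [set` s]) (alternating i @^-1` B i) = A `&` C.
  apply/seteqP; split => w /=.
    move=> H; split => _ /= /mapP[i + ->]; rewrite mem_filter => /andP[oi si].
      by have := H _ si; rewrite /= /alternating oi -[in B i](odd_double_half i) oi.
    have := H _ si; rewrite /= /alternating (negbTE oi).
    by rewrite -[in B i](odd_double_half i) (negbTE oi).
  move=> [wA wC] i si /=; rewrite /alternating; case: ifPn => oi.
    rewrite -[in B i](odd_double_half i) oi; apply: wA => /=.
    by apply: map_f; rewrite mem_filter oi.
  rewrite -[in B i](odd_double_half i) (negbTE oi); apply: wC => /=.
  by apply: map_f; rewrite mem_filter oi.
have mpre (Z : T -> measurableTypeR R) D : measurable_fun setT Z -> measurable D ->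
    measurable (Z @^-1` D).
  by move=> mZ mD; rewrite -[X in measurable X]setTI; exact: mZ.
have mA : measurable A.
  apply: fin_bigcap_measurable => // i _; apply: mpre; last exact: mB.
  exact: (measurable_funPT (theta i)).
have mC : measurable C.
  apply: fin_bigcap_measurable => // i _; apply: mpre; last exact: mB.
  exact: measurable_interarrival.
have [G HG CG] := finite_interarrival_counting_event N_poisson evens
  (fun j => mB j.*2).
have mG := counting_event_measurable HG.
have AE : P A = (\prod_(j <- odds) P (theta j @^-1` B j.*2.+1))%E.
  exact: (direction_independent theta_directions uodds (fun j => mB j.*2.+1)).
have CE : P C = (\prod_(j <- evens) P (interarrival tau j @^-1` B j.*2))%E.
  exact: (interarrival_independent N_poisson uevens (fun j => mB j.*2)).
have -> : P (A `&` C) = (P A * P C)%E.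
  transitivity (P (A `&` G)).
    apply: ae_eq_measure; [exact: measurableI|exact: measurableI|].
    by apply: filterS CG => w CGw; split => -[? /CGw].
  rewrite (ae_eq_measure mC mG CG).
  apply: (direction_independent_of_process theta_directions) => //.
  by apply: finite_direction_event => j; exact: mB.
rewrite AE CE !big_map !big_filter [in RHS](bigID odd)/=.
congr (_ * _)%E; apply: eq_bigr => i oi; rewrite /alternating.
  by rewrite oi -[in B i](odd_double_half i) oi.
by rewrite (negbTE oi) -[in B i](odd_double_half i) (negbTE oi).
Qed.

End alternating_sequence.

Section embedded_chain.
Context {d : measure_display} {T : measurableType d} {R : realType}.
Variables (P : probability T R) (lam : R) (N : R -> {RV P >-> nat})
  (tau theta : nat -> {RV P >-> R}).
Hypotheses (lam0 : 0 < lam) (N_poisson : poisson_process lam N tau)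
  (theta_directions : random_directions N theta).
Notation mu := (@lebesgue_measure R).
Notation E := (measurableTypeR R * (measurableTypeR R * measurableTypeR R))%type.

Definition displacement (n : nat) (w : T) : measurableTypeR R * measurableTypeR R :=
  (\sum_(0 <= j < n) (tau j.+1 w - tau j w) * cos (theta j w),
   \sum_(0 <= j < n) (tau j.+1 w - tau j w) * sin (theta j w)).

(** The epoch and the position of the walk of unit speed after n flights. *)
Definition flight_state (n : nat) (w : T) : E := (tau n w, displacement n w).

(** The arguments are a state, the duration and the direction of the next flight. *)
Definition advance (p : E * measurableTypeR R * measurableTypeR R) : E :=
  (p.1.1.1 + p.1.2,
   (p.1.1.2.1 + p.1.2 * cos p.2, p.1.1.2.2 + p.1.2 * sin p.2)).

Lemma measurable_advance : measurable_fun setT advance.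
Proof. by rewrite /advance; meas. Qed.

Lemma flight_state0 : flight_state 0 = cst (0, (0, 0)).
Proof.
apply/funext => w.
by rewrite /flight_state /displacement (epoch0 N_poisson) !big_nil.
Qed.

Lemma flight_stateS n : flight_state n.+1 = advance \o
  (fun w => (flight_state n w, alternating tau theta n.*2 w,
             alternating tau theta n.*2.+1 w)).
Proof.
apply/funext => w; rewrite /flight_state /displacement /advance /alternating /=.
rewrite odd_double /= uphalf_double doubleK /interarrival.
by rewrite addrC subrK !big_nat_recr.
Qed.

Lemma measurable_flight_state n : measurable_fun setT (flight_state n).
Proof.
elim: n => [|n IH]; first by rewrite flight_state0; exact: measurable_cst.
rewrite flight_stateS; apply: measurableT_comp; first exact: measurable_advance.
apply: measurable_fun_pair; last exact: measurable_alternating.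
by apply: measurable_fun_pair => //; exact: measurable_alternating.
Qed.

Let mpair n : measurable_fun setT
  (fun w => (flight_state n w, alternating tau theta n.*2 w)).
Proof.
apply: measurable_fun_pair; last exact: measurable_alternating.
exact: measurable_flight_state.
Qed.

(** The state after n flights is a function of the first 2 n terms of the
alternating sequence. *)
Lemma flight_state_independent n :
  independent_of_future P (alternating tau theta) n.*2 (flight_state n).
Proof.
have mz := measurable_alternating tau theta.
elim: n => [|n IH].
  rewrite flight_state0; apply: independent_of_future_cst.
  exact: alternating_independent N_poisson theta_directions.
rewrite flight_stateS doubleS.
apply: independent_of_future_map; first exact: measurable_advance.
apply: independent_of_future_pair => //.
by apply: independent_of_future_pair => //; exact: measurable_flight_state.
Qed.

(** Given the state after n flights, the next duration is exponential and the next
direction is uniform. *)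
Lemma integral_next_flight n (g : E * measurableTypeR R * measurableTypeR R -> \bar R) :
  measurable_fun setT g -> (forall p, 0 <= g p)%E ->
  (\int[P]_w g (flight_state n w, interarrival tau n w, theta n w : R) =
   \int[P]_w \int[mu]_(r in `[0%R, +oo[) ((lam * expR (- lam * r))%:E *
     angle_mean (fun th => g (flight_state n w, r, th))))%E.
Proof.
move=> mg g0.
have mz := measurable_alternating tau theta.
have indS := @flight_state_independent n.
transitivity (\int[P]_w g (flight_state n w, alternating tau theta n.*2 w,
    alternating tau theta n.*2.+1 w))%E.
  apply: eq_integral => w _.
  by rewrite /alternating /= odd_double /= uphalf_double doubleK.
rewrite (@integral_pair_future _ _ _ P _ mz _ _ n.*2.+1
  (fun w => (flight_state n w, alternating tau theta n.*2 w)) (mpair n) _ g mg g0);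
  last first.
  by apply: independent_of_future_pair => //; exact: measurable_flight_state.
pose f (p : E * measurableTypeR R) := angle_mean (fun th => g (p, th)).
have mf : measurable_fun setT f.
  apply: (@measurable_angle_mean _ _ _ (fun p th => g (p, th))) => //.
  by rewrite (_ : (fun _ => _) = g)//; apply/funext => -[].
have f0 p : (0 <= f p)%E by apply: angle_mean_ge0.
transitivity (\int[P]_w f (flight_state n w, alternating tau theta n.*2 w))%E.
  apply: eq_integral => w _; rewrite /f integral_uniform_law//.
  - move=> A mA; rewrite -(direction_law theta_directions n mA).
    by rewrite /alternating/= odd_double/= uphalf_double.
  - by apply: (measurableT_comp mg); apply: measurable_fun_pair => //; exact: measurable_cst.
rewrite (@integral_pair_future _ _ _ P _ mz _ _ n.*2 _
  (@measurable_flight_state n) indS f mf f0).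
apply: eq_integral => w _.
rewrite (integral_exponential_law _ lam0)//.
- move=> A mA; rewrite -(interarrival_law N_poisson n mA).
  by rewrite /alternating odd_double/= doubleK.
- by apply: (measurableT_comp mf); apply: measurable_fun_pair => //; exact: measurable_cst.
Qed.

End embedded_chain.

(** * The walk at a fixed time *)

Section stopped_chain.
Context {d : measure_display} {T : measurableType d} {R : realType}.
Variables (P : probability T R) (lam : R) (N : R -> {RV P >-> nat})
  (tau theta : nat -> {RV P >-> R}).
Hypotheses (lam0 : 0 < lam) (N_poisson : poisson_process lam N tau)
  (theta_directions : random_directions N theta).
Notation mu := (@lebesgue_measure R).
Notation E := (measurableTypeR R * (measurableTypeR R * measurableTypeR R))%type.

(** The recursion that defines [flight_value] is the integral over the next flight,
so one more past flight compensates for one less future flight. *)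
Lemma expected_flight_value (h : R * R -> \bar R) (t : R) n k :
  measurable_fun setT h -> (forall z, 0 <= h z)%E ->
  (\int[P]_w flight_value lam h k (t - tau n w) (displacement tau theta n w) =
   flight_value lam h (n + k) t (0%R, 0%R))%E.
Proof.
move=> mh h0; elim: n k => [|n IH] k.
  transitivity (\int[P]_w (cst (flight_value lam h k t (0%R, 0%R)) w))%E.
    apply: eq_integral => w _.
    by rewrite /displacement !big_nil (epoch0 N_poisson) subr0.
  rewrite integral_cst//.
  transitivity (flight_value lam h k t (0%R, 0%R) * 1)%E; last by rewrite mule1.
  by congr (_ * _)%E; exact: probability_setT.
rewrite addSnnS -IH.
pose g (p : E * measurableTypeR R * measurableTypeR R) :=
  flight_value lam h k (t - (p.1.1.1 + p.1.2))
    (p.1.1.2.1 + p.1.2 * cos p.2, p.1.1.2.2 + p.1.2 * sin p.2).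
have mg : measurable_fun setT g.
  rewrite /g; apply: (measurableT_comp (measurable_flight_value lam0 mh h0 k)
    (g := fun p : E * measurableTypeR R * measurableTypeR R =>
     ((t - (p.1.1.1 + p.1.2)), (p.1.1.2.1 + p.1.2 * cos p.2,
      p.1.1.2.2 + p.1.2 * sin p.2)))).
  by meas.
have g0 p : (0 <= g p)%E by exact: flight_value_ge0.
transitivity (\int[P]_w g (flight_state tau theta n w, interarrival tau n w,
    theta n w : R))%E.
  apply: eq_integral => w _; rewrite /g /= /interarrival /displacement.
  by rewrite [_ + (_ - _)]addrC subrK !big_nat_recr.
rewrite (integral_next_flight lam0 N_poisson theta_directions n mg g0).
apply: eq_integral => w _; rewrite /=; apply: eq_integral => r _.
by rewrite /g /= opprD addrA.
Qed.

(** The position at the time t, when the last flight is the one after n changes of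
direction. *)
Definition flight_end (t : R) (n : nat) (w : T) : R * R :=
  ((displacement tau theta n w).1 + (t - tau n w) * cos (theta n w),
   (displacement tau theta n w).2 + (t - tau n w) * sin (theta n w)).

Lemma measurable_count t n : measurable [set w | N t w = n].
Proof.
rewrite -[X in measurable X]setTI.
by have := @measurable_funPT _ _ _ _ (N t) measurableT [set n] I.
Qed.

Lemma measurable_flight_data n : measurable_fun setT (fun w =>
  (flight_state tau theta n w, interarrival tau n w, theta n w : measurableTypeR R)).
Proof.
apply: measurable_fun_pair; last exact: (measurable_funPT (theta n)).
apply: measurable_fun_pair; last exact: measurable_interarrival.
exact: (measurable_flight_state theta N_poisson).
Qed.

Lemma measurable_flight_end t n : measurable_fun setT (flight_end t n).
Proof.
pose g (p : E * measurableTypeR R * measurableTypeR R) :=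
  (p.1.1.2.1 + (t - p.1.1.1) * cos p.2, p.1.1.2.2 + (t - p.1.1.1) * sin p.2).
have mg : measurable_fun setT g by rewrite /g; meas.
exact: (measurableT_comp mg (measurable_flight_data n)).
Qed.

(** The event N t = n means that tau n <= t and that the next interarrival time
exceeds u = t - tau n.  Given the state after n flights, the latter has the
probability exp (- lam u) and is independent of the direction, so the conditional
expectation is [flight_value] with no future change of direction. *)
Lemma integral_flight_end (h : R * R -> \bar R) (t : R) n : 0 <= t ->
  measurable_fun setT h -> (forall z, 0 <= h z)%E ->
  (\int[P]_(w in [set w | N t w = n]) h (flight_end t n w) =
   flight_value lam h n t (0%R, 0%R))%E.
Proof.
move=> t0 mh h0; rewrite -[n in RHS]addn0 -(expected_flight_value t n 0 mh h0).
pose a (p : E * measurableTypeR R) : \bar R :=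
  h (p.1.2.1 + (t - p.1.1) * cos p.2, p.1.2.2 + (t - p.1.1) * sin p.2)%R.
have ma : measurable_fun setT a by rewrite /a; meas.
pose g (p : E * measurableTypeR R * measurableTypeR R) : \bar R :=
  ((if p.1.1.1 <= t then 1 else 0)%:E *
   ((if t - p.1.1.1 < p.1.2 then 1 else 0)%:E * a (p.1.1, p.2)))%E.
have mg : measurable_fun setT g.
  rewrite /g; apply: fun_measurableMe; first by meas.
  apply: fun_measurableMe; first by meas.
  apply: (measurableT_comp ma (g := fun p : E * measurableTypeR R * measurableTypeR R =>
    (p.1.1, p.2))).
  by meas.
have g0 p : (0 <= g p)%E.
  rewrite /g !mule_ge0 ?lee_fin//; first by case: ifP.
    by case: ifP.
  exact: h0.
transitivity (\int[P]_w g (flight_state tau theta n w, interarrival tau n w,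
    theta n w : R))%E.
  rewrite integral_mkcond; apply: ae_eq_integral => //.
  - apply/(measurable_restrictT _ _).1.
      exact: measurable_count.
    apply: measurable_funTS; apply: (measurableT_comp mh).
    exact: measurable_flight_end.
  - by apply: (measurableT_comp mg); exact: measurable_flight_data.
  - apply: filterS (counting_epochs N_poisson) => w cnt _.
    have H k := cnt t t0 k.
    rewrite /g /= patchE; case: ifPn => [|].
      rewrite inE /= => Nn; rewrite -H -Nn leqnn.
      rewrite /interarrival ltrBDr subrK ltNge -H Nn ltnn mul1e mul1e.
      by rewrite /a /flight_end.
    rewrite notin_setE /= => Nn; rewrite -H.
    case: leqP => [nN|]; last by rewrite mul0e.
    rewrite /interarrival ltrBDr subrK ltNge -H ltn_neqAle nN andbT eq_sym.
    by move/eqP: Nn => ->; rewrite /= mul0e mule0.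
rewrite (integral_next_flight lam0 N_poisson theta_directions n mg g0).
apply: eq_integral => w _; rewrite [RHS]/=.
set u := t - tau n w; set b := angle_mean _.
transitivity (\int[mu]_(r in `[0%R, +oo[) ((if 0 <= u then 1 else 0)%:E * b *
    ((lam * expR (- lam * r))%:E * (if u < r then 1 else 0)%:E)))%E.
  apply: eq_integral => r _.
  have mb : measurable_fun setT (fun th : R => a ((flight_state tau theta n w), th)).
    by apply: (measurableT_comp ma); apply: measurable_fun_pair => //; exact: measurable_cst.
  have ind0 (c : bool) : 0 <= (if c then 1 else 0) :> R by case: c.
  transitivity ((lam * expR (- lam * r))%:E * ((if 0 <= u then 1 else 0)%:E *
      ((if (u < r)%R then 1 else 0)%:E * b)))%E.
    have b1 := @angle_meanZ _ _ _ (ind0 (u < r)) mb (fun=> h0 _).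
    have m1 := fun_measurableMe (@measurable_cst _ _ _ _ setT (if u < r then 1 else 0)%:E) mb.
    have p1 th : (0 <= (if (u < r)%R then 1 else 0)%:E * a (flight_state tau theta n w, th))%E.
      by rewrite mule_ge0 ?lee_fin//; exact: h0.
    have b2 := @angle_meanZ _ _ _ (ind0 (0 <= u)) m1 p1.
    rewrite -[b]/(angle_mean (fun th : R => a (flight_state tau theta n w, th))).
    rewrite -b1 -b2; congr (_ * angle_mean _)%E; apply/funext => th.
    by rewrite /g /= subr_ge0.
  by rewrite muleCA -muleA; congr (_ * _)%E; rewrite [RHS]muleC -muleA; congr (_ * _)%E.
have b0 : (0 <= b)%E by exact: angle_mean_ge0.
have [u0|u0] := leP 0 u; last first.
  by rewrite !mul0e; apply: integral0_eq => r _; rewrite !mul0e.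
rewrite ge0_integralZl//.
- by rewrite mul1e integral_exponential_tail// muleC.
- by apply: measurable_funTS; meas.
- move=> r _; rewrite mule_ge0// lee_fin ?mulr_ge0 ?expR_ge0 ?(ltW lam0)//.
  by case: ifP.
- by rewrite mul1e.
Qed.

End stopped_chain.

(** * The Poisson probabilities *)

Section poisson_mass.
Context {R : realType}.
Variables (lam : R).
Notation mu := (@lebesgue_measure R).

Lemma angle_mean_cst (c : \bar R) : angle_mean (fun=> c) = c.
Proof.
have p0 := @two_pi_gt0 R.
rewrite /angle_mean.
transitivity (((2 * pi)^-1)%:E * (c * (2 * pi)%:E))%E.
  congr (_ * _)%E; rewrite (@integral_cst _ _ _ mu)//; congr (_ * _)%E.
  apply: (etrans (lebesgue_measure_itv _)).
  by rewrite /= lte_fin p0 oppr0 adde0.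
by rewrite muleCA -EFinM mulVf ?mule1// gt_eqF.
Qed.

(** These are the Poisson probabilities of k events in the time u; the induction
integrates (u - r)^k. *)
Lemma flight_value_cst1 k u z : flight_value lam (fun=> 1%E) k u z =
  (if 0 <= u then expR (- lam * u) * (lam * u) ^+ k / k`!%:R else 0)%:E.
Proof.
elim: k u z => [|k IH] u z; first by rewrite /= angle_mean_cst mule1 expr0 mulr1 divr1.
have kn0 : k`!%:R != 0 :> R by rewrite pnatr_eq0 -lt0n fact_gt0.
pose C := expR (- lam * u) * lam ^+ k.+1 / k`!%:R.
transitivity (\int[mu]_(r in `[0%R, +oo[)
    (if r <= u then C * (u - r) ^+ k else 0)%:E)%E.
  apply: eq_integral => r _.
  rewrite (_ : (fun th => _) = (fun=> (if 0 <= u - r then expR (- lam * (u - r)) *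
    (lam * (u - r)) ^+ k / k`!%:R else 0)%:E)); last first.
    by apply/funext => th; exact: IH.
  rewrite angle_mean_cst subr_ge0; case: ifPn => _; last by rewrite mule0.
  rewrite -EFinM; congr (_%:E).
  rewrite /C (_ : - lam * u = - lam * r + - lam * (u - r)); last by ring.
  by rewrite expRD exprMn exprS; field.
have [u0|u0] := leP 0 u; last first.
  apply: integral0_eq => r /=; rewrite in_itv/= andbT => r0.
  by rewrite leNgt (lt_le_trans u0 r0).
transitivity (\int[mu]_(r in `]0%R, u]) (C * (u - r) ^+ k)%:E)%E.
  rewrite -integral_itv_obnd_cbnd; last first.
    by apply: measurable_funTS; meas.
  rewrite integral_mkcond [RHS]integral_mkcond; apply: eq_integral => r _.
  rewrite !patchE !mem_setE !in_itv/= andbT.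
  by case: (0 < r) => //=; case: (r <= u).
pose F (r : R) := - (C / k.+1%:R) * (u - r) ^+ k.+1.
have dF (r : R) : is_derive r (1 : R) F (C * (u - r) ^+ k).
  have d1 := is_deriveB (is_derive_cst u r (1 : R)) (is_derive_id r (1 : R)).
  have d2 := is_deriveZ (- (C / k.+1%:R)) (is_deriveX k.+1 d1).
  have -> : F = - (C / k.+1%:R) \*: (cst u - id) ^+ k.+1.
    by apply/funext => x; rewrite /F /GRing.scale /= exprfctE.
  apply: (is_derive_eq d2); rewrite /GRing.scale/=.
  have k1 : k.+1%:R != 0 :> R by rewrite pnatr_eq0.
  rewrite /= sub0r.
  by field.
have cf : continuous (fun r : R => C * (u - r) ^+ k).
  move=> r; apply: (@continuousM _ _ (cst C) (fun r : R => (u - r) ^+ k)).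
    exact: cst_continuous.
  apply: (@continuous_comp _ _ _ (fun r : R => u - r) (fun x => x ^+ k)).
    by apply: (@continuousB _ _ _ (cst u) id) => //; exact: cst_continuous.
  exact: exprn_continuous.
rewrite (integral_is_derive dF cf u0) /F; congr (_%:E).
rewrite subrr expr0n /= mulr0 sub0r subr0 /C exprMn factS natrM.
have k1 : k.+1%:R != 0 :> R by rewrite pnatr_eq0.
by field; rewrite kn0 nat1r k1.
Qed.

End poisson_mass.

(** * The position on the event of n changes of direction *)

Section motion.
Context {d : measure_display} {T : measurableType d} {R : realType}.
Variables (P : probability T R) (lam : R) (c1 c2 : R -> R)
  (N : R -> {RV P >-> nat}) (tau theta : nat -> {RV P >-> R})
  (X Y : R -> {RV P >-> R}) (t : R).
Hypotheses (lam0 : 0 < lam) (c1_gt0 : forall x, 0 < c1 x)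
  (c2_gt0 : forall y, 0 < c2 y) (c1_finite : finite_travel_time c1)
  (c2_finite : finite_travel_time c2) (N_poisson : poisson_process lam N tau)
  (theta_directions : random_directions N theta) (t0 : 0 < t)
  (X_motion : coordinate_motion P N tau theta c1 cos t X)
  (Y_motion : coordinate_motion P N tau theta c2 sin t Y).
Notation mu2 := (@plane_measure R).
Notation plane := (measurableTypeR R * measurableTypeR R)%type.

Lemma count_probability n : P [set w | N t w = n] =
  (expR (- lam * t) * (lam * t) ^+ n / n`!%:R)%:E.
Proof.
have := integral_flight_end lam0 N_poisson theta_directions n (ltW t0)
  (@measurable_cst _ _ _ _ setT 1%E) (fun=> lee01).
rewrite flight_value_cst1 (ltW t0) => <-.
rewrite (integral_cst P); last exact: measurable_count.
by rewrite mul1e.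
Qed.

Let G (z : plane) : plane := (travel_time c1 z.1, travel_time c2 z.2).

Definition final_position (w : T) : plane := (X t w, Y t w).

Lemma measurable_final_position : measurable_fun setT final_position.
Proof.
exact: (measurable_fun_pair (measurable_funPT (X t)) (measurable_funPT (Y t))).
Qed.

Let coordinate_travel_time (c proj : R -> R) (Z : R -> {RV P >-> R}) :
  (forall x, 0 < c x) -> finite_travel_time c ->
  coordinate_motion P N tau theta c proj t Z ->
  {ae P, forall w, travel_time c (Z t w) =
    \sum_(0 <= j < N t w) (tau j.+1 w - tau j w) * proj (theta j w) +
    (t - tau (N t w) w) * proj (theta (N t w) w)}.
Proof.
move=> c_gt0 c_finite Zmotion.
have inc := epochs_increasing N_poisson.
apply: filterS (filterI Zmotion (filterI (counting_epochs N_poisson) inc)).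
move=> w [[cZ ZE] [cnt incw]].
exact: (@path_travel_time R c (N ^~ w) (tau ^~ w) (fun j => proj (theta j w)) t
  (Z ^~ w) c_gt0 c_finite (epoch0 N_poisson w) incw cnt (ltW t0) cZ ZE).
Qed.

Lemma travel_times_final_position :
  {ae P, forall w, G (final_position w) = flight_end tau theta t (N t w) w}.
Proof.
apply: filterS2 (coordinate_travel_time c1_gt0 c1_finite X_motion)
  (coordinate_travel_time c2_gt0 c2_finite Y_motion) => w EX EY.
by rewrite /G /= EX EY.
Qed.

Let measurable_preimage d1 d2 (T1 : measurableType d1) (T2 : measurableType d2)
    (f : T1 -> T2) B :
  measurable_fun setT f -> measurable B -> measurable (f @^-1` B).
Proof. by move=> mf mB; rewrite -[X in measurable X]setTI; exact: mf. Qed.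

Let mG : measurable_fun setT G :=
  measurable_travel_times c1_gt0 c1_finite c2_gt0 c2_finite.

(** Up to a null event, the travel times of the position are the end of the walk of
unit speed, whose law on this event is known from [flight_valueE]. *)
Lemma position_count_probability n (A : set plane) : measurable A ->
  P (final_position @^-1` A `&` [set w | N t w = n.+1]) =
  (\int[mu2]_(z in A) ((c1 z.1 * c2 z.2)^-1 *
     (flight_constant lam n t * flight_kernel n.+1 t (G z)))%:E)%E.
Proof.
move=> mA.
have mN := measurable_count N t n.+1.
have mpos := measurable_final_position.
have mend : measurable_fun setT (flight_end tau theta t n.+1 : T -> plane).
  exact: (measurable_flight_end theta N_poisson).
pose m := image_measure (mrestr P mN) mpos.
transitivity (m A); first by [].
pose f z := flight_constant lam n t * flight_kernel n.+1 t z.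
have f0 z : 0 <= f z.
  by rewrite mulr_ge0 ?flight_kernel_ge0//; exact: flight_constant_ge0.
have mf : measurable_fun setT f.
  by rewrite /f /flight_kernel /=; meas.
apply: (@travel_times_density _ c1 c2 c1_gt0 c1_finite c2_gt0 c2_finite m f) => //.
  rewrite /m /= /pushforward /mrestr preimage_setT setTI.
  by rewrite (le_lt_trans (probability_le1 P mN)) ?ltry.
move=> B mB.
transitivity (P (flight_end tau theta t n.+1 @^-1` B `&` [set w | N t w = n.+1])).
  apply: ae_eq_measure.
  - apply: measurableI => //; apply: measurable_preimage => //.
    exact: measurable_preimage.
  - by apply: measurableI => //; exact: measurable_preimage.
  apply: filterS travel_times_final_position => w E.
  by split => -[+ Nw] => /= Bw; split => //=; move: Bw;
    rewrite -/(final_position w) -/(G (final_position w)) E Nw.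
have mindB : measurable_fun setT (fun z : plane => (\1_B z)%:E : \bar R).
  by apply/measurable_EFinP; exact: measurable_indic.
have indB0 (z : plane) : (0 <= (\1_B z)%:E :> \bar R)%E by rewrite lee_fin.
have := integral_flight_end lam0 N_poisson theta_directions n.+1 (ltW t0) mindB indB0.
rewrite (flight_valueE lam0 mindB indB0) => E.
transitivity (\int[P]_(w in [set w | N t w = n.+1])
  (\1_B (flight_end tau theta t n.+1 w))%:E)%E.
  have mE := measurable_preimage mend mB.
  by rewrite -(integral_indic P mN mE).
rewrite E [RHS]integral_mkcond; apply: eq_integral => z _.
rewrite !add0r patchE indicE /f; case: ifP => zB.
  by rewrite -surjective_pairing zB mule1.
by rewrite -surjective_pairing zB mule0.
Qed.

End motion.

(** * Closed forms of the densities *)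

Section closed_forms.
Context {R : realType}.
Variables (lam : R) (c1 c2 : R -> R) (t : R).
Hypotheses (lam0 : 0 < lam) (c1_gt0 : forall x, 0 < c1 x)
  (c2_gt0 : forall y, 0 < c2 y) (t0 : 0 < t).
Notation D := (reachable c1 c2 t).
Notation r := (residual c1 c2 t).

Lemma reachableE z : (z \in D) = (0 < r z).
Proof.
apply/idP/idP; first by rewrite inE /reachable/residual/= => H; lra.
by move=> H; rewrite inE /reachable/=; move: H; rewrite /residual => H; lra.
Qed.

Lemma flight_kernel_travel_times k z :
  flight_kernel k t (travel_time c1 z.1, travel_time c2 z.2) =
  zero_outside D (fun z => Num.sqrt (r z) ^+ k / r z) z.
Proof.
rewrite /zero_outside patchE reachableE /flight_kernel /= t0 /=.
by rewrite /residual !real_normK ?num_real.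
Qed.

Lemma conditional_densityE n z :
  zero_outside D (conditional_density n.+1 c1 c2 t) z =
  (expR (- lam * t) * (lam * t) ^+ n.+1 / n.+1`!%:R)^-1 *
  ((c1 z.1 * c2 z.2)^-1 * (flight_constant lam n t *
     flight_kernel n.+1 t (travel_time c1 z.1, travel_time c2 z.2))).
Proof.
rewrite flight_kernel_travel_times /zero_outside !patchE reachableE.
case: ifPn => r0; last by rewrite !mulr0.
have -> : conditional_density n.+1 c1 c2 t z =
    n.+1%:R / (2 * pi * t ^+ n.+1) * (Num.sqrt (r z) ^+ n.+1 / r z) / (c1 z.1 * c2 z.2).
  rewrite /conditional_density; congr (_ * _ / _).
  rewrite powRD ?(gt_eqF r0) ?implybT// powRN powRr1 ?(ltW r0)//.
  by rewrite mulrC [_ / 2]mulrC powRrM powR12_sqrt ?(ltW r0)// powR_mulrn ?sqrtr_ge0// mulrC.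
rewrite /flight_constant exprMn factS natrM.
have k1 : n.+1%:R != 0 :> R by rewrite pnatr_eq0.
have kn0 : n`!%:R != 0 :> R by rewrite pnatr_eq0 -lt0n fact_gt0.
have e0 : expR (- lam * t) != 0 by rewrite gt_eqF// expR_gt0.
have l0 : lam != 0 by rewrite gt_eqF.
have u0 : t != 0 by rewrite gt_eqF.
have c10 : c1 z.1 != 0 by rewrite gt_eqF.
have c20 : c2 z.2 != 0 by rewrite gt_eqF.
have pn0 : pi != 0 :> R by rewrite gt_eqF// pi_gt0.
have rn0 : r z != 0 by rewrite gt_eqF.
move: k1 kn0 e0 l0 u0 c10 c20 pn0 rn0; rewrite -nat1r !exprS.
generalize (@pi R) (expR (- lam * t)) => p e k1 kn0 e0 l0 u0 c10 c20 pn0 rn0.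
field; by rewrite rn0 kn0 pn0 c20 c10 k1 !expf_neq0// l0 u0 e0.
Qed.

(** With s the square root of the residual, the term of index n is proportional to
(lam s)^n / n!. *)
Lemma motion_densityE z :
  (zero_outside D (motion_density lam c1 c2 t) z)%:E =
  (\sum_(0 <= n <oo) ((c1 z.1 * c2 z.2)^-1 * (flight_constant lam n t *
     flight_kernel n.+1 t (travel_time c1 z.1, travel_time c2 z.2)))%:E)%E.
Proof.
rewrite /zero_outside patchE reachableE; case: ifPn => r0; last first.
  rewrite eseries0// => n _ _.
  by rewrite flight_kernel_travel_times /zero_outside patchE reachableE (negbTE r0) !mulr0.
set s := Num.sqrt (r z).
pose C := lam / (2 * pi * c1 z.1 * c2 z.2) * (expR (- lam * t) / s).
have s0 : 0 < s by rewrite sqrtr_gt0.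
have rE : r z = s ^+ 2 by rewrite sqr_sqrtr// ltW.
transitivity (C%:E * \sum_(0 <= n <oo) (exp_coeff (lam * s) n)%:E)%E.
  have s1 : (0 <= lam * s)%R by rewrite mulr_ge0// ltW.
  have -> : (\sum_(0 <= n <oo) (exp_coeff (lam * s) n)%:E = (expR (lam * s))%:E)%E.
    rewrite /expR -EFin_lim; last exact: is_cvg_series_exp_coeff.
    by apply: congr_lim; apply/funext => n; rewrite /= sumEFin.
  by rewrite -EFinM /motion_density /C -/s expRD; congr (_%:E); ring.
rewrite -nneseriesZl//; last first.
  by move=> n _; rewrite lee_fin exp_coeff_ge0// mulr_ge0// ltW.
apply: eq_eseriesr => n _; rewrite -EFinM; congr (_%:E).
rewrite flight_kernel_travel_times /zero_outside patchE reachableE r0 -/s rE.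
rewrite /C /flight_constant /exp_coeff/= !exprMn [s ^+ n.+1]exprS [lam ^+ n.+1]exprS.
have kn0 : n`!%:R != 0 :> R by rewrite pnatr_eq0 -lt0n fact_gt0.
have c10 : c1 z.1 != 0 by rewrite gt_eqF.
have c20 : c2 z.2 != 0 by rewrite gt_eqF.
have pn0 : pi != 0 :> R by rewrite gt_eqF// pi_gt0.
have sn0 : s != 0 by rewrite gt_eqF.
move: pn0 kn0 c10 c20 sn0.
generalize (@pi R) => p pn0 kn0 c10 c20 sn0.
by field; rewrite sn0 kn0 pn0 c20 c10.
Qed.

Lemma support_motion_density :
  [set z | zero_outside D (motion_density lam c1 c2 t) z != 0] = D.
Proof.
apply/seteqP; split => z /=.
  rewrite /zero_outside patchE; case: ifPn; first by rewrite inE.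
  by rewrite eqxx.
move=> /mem_set zD; rewrite /zero_outside patchE zD.
rewrite reachableE in zD; rewrite gt_eqF// /motion_density mulr_gt0//.
  by rewrite divr_gt0// !mulr_gt0// pi_gt0.
by rewrite divr_gt0 ?expR_gt0// sqrtr_gt0.
Qed.

Lemma motion_density_ge0 z : 0 <= zero_outside D (motion_density lam c1 c2 t) z.
Proof.
rewrite /zero_outside patchE; case: ifP => // _.
apply: mulr_ge0; last by apply: divr_ge0; [exact: expR_ge0|exact: sqrtr_ge0].
by apply: divr_ge0; rewrite ?(ltW lam0)// !mulr_ge0 ?pi_ge0// ltW.
Qed.

Hypotheses (c1_finite : finite_travel_time c1) (c2_finite : finite_travel_time c2).

Lemma measurable_motion_density : measurable_fun setT
  (zero_outside D (motion_density lam c1 c2 t) : R * R -> R).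
Proof.
have m1 := measurable_travel_time c1_gt0 c1_finite.
have m2 := measurable_travel_time c2_gt0 c2_finite.
have s1 := measurable_speed c1_finite.
have s2 := measurable_speed c2_finite.
have mr : measurable_fun setT (r : R * R -> R).
  rewrite (_ : (r : R * R -> R) = fun z =>
      t ^+ 2 - travel_time c1 z.1 ^+ 2 - travel_time c2 z.2 ^+ 2); first by meas.
  by apply/funext => z; rewrite /residual !real_normK ?num_real.
rewrite (_ : zero_outside _ _ = fun z => if 0 < r z
  then motion_density lam c1 c2 t z else 0); first by rewrite /motion_density; meas.
by apply/funext => z; rewrite /zero_outside patchE reachableE.
Qed.

Let S : set (R * R) :=
  [set z | travel_time c1 z.1 ^+ 2 + travel_time c2 z.2 ^+ 2 = t ^+ 2].

Lemma measurable_wave_front : measurable S.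
Proof.
have m1 := measurable_travel_time c1_gt0 c1_finite.
have m2 := measurable_travel_time c2_gt0 c2_finite.
have mf : measurable_fun setT (fun z : R * R =>
  travel_time c1 z.1 ^+ 2 + travel_time c2 z.2 ^+ 2) by meas.
have := mf measurableT [set t ^+ 2] (measurable_set1 _).
by rewrite setTI.
Qed.

(** As [travel_time c2] is injective, each section has at most two points. *)
Lemma wave_front_null : (@lebesgue_measure2 R) S = 0%E.
Proof.
rewrite /lebesgue_measure2 /product_measure1/=.
apply: integral0_eq => x _ /=.
apply: countable_lebesgue_measure0.
apply: finite_set_countable.
pose a := Num.sqrt (t ^+ 2 - travel_time c1 x ^+ 2).
apply: (@sub_finite_set _ _ (travel_time c2 @^-1` [set a; - a])).
  move=> y; rewrite /xsection/= inE /S/= => E.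
  have : travel_time c2 y ^+ 2 = a ^+ 2.
    rewrite /a sqr_sqrtr; first by rewrite -E; ring.
    by rewrite -E addrAC subrr add0r sqr_ge0.
  by move/eqP; rewrite eqf_sqr => /orP[] /eqP ->; [left|right].
apply: finite_preimage => // y z _ _.
have incr := travel_time_increasing c2_gt0 c2_finite.
case: (ltgtP y z) => // /incr; lra.
Qed.

End closed_forms.

(** * The components of the law of the position *)

Section decomposition.
Context {d : measure_display} {T : measurableType d} {R : realType}.
Variables (P : probability T R) (lam : R) (c1 c2 : R -> R)
  (N : R -> {RV P >-> nat}) (tau theta : nat -> {RV P >-> R})
  (X Y : R -> {RV P >-> R}) (t : R).
Hypotheses (lam0 : 0 < lam) (c1_gt0 : forall x, 0 < c1 x)
  (c2_gt0 : forall y, 0 < c2 y) (c1_finite : finite_travel_time c1)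
  (c2_finite : finite_travel_time c2) (N_poisson : poisson_process lam N tau)
  (theta_directions : random_directions N theta) (t0 : 0 < t)
  (X_motion : coordinate_motion P N tau theta c1 cos t X)
  (Y_motion : coordinate_motion P N tau theta c2 sin t Y).
Notation mu2 := (@plane_measure R).
Notation plane := (measurableTypeR R * measurableTypeR R)%type.
Notation position := (final_position X Y t).
Notation D := (reachable c1 c2 t).

Let mpos : measurable_fun setT position := measurable_final_position X Y t.

Let mpreimage (A : set plane) : measurable A -> measurable (position @^-1` A).
Proof. by move=> mA; rewrite -[X in measurable X]setTI; exact: mpos. Qed.

Let density n (z : plane) : R := (c1 z.1 * c2 z.2)^-1 *
  (flight_constant lam n t *
    flight_kernel n.+1 t (travel_time c1 z.1, travel_time c2 z.2)).

Let density_ge0 n z : 0 <= density n z.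
Proof.
apply: mulr_ge0; first by rewrite invr_ge0 mulr_ge0// ltW.
by apply: mulr_ge0; [exact: flight_constant_ge0|exact: flight_kernel_ge0].
Qed.

Let measurable_density n : measurable_fun setT (density n).
Proof.
have m1 := measurable_travel_time c1_gt0 c1_finite.
have m2 := measurable_travel_time c2_gt0 c2_finite.
have s1 := measurable_speed c1_finite.
have s2 := measurable_speed c2_finite.
by rewrite /density /flight_kernel /=; meas.
Qed.

Let moving_probability n (A : set plane) : measurable A ->
  P (position @^-1` A `&` [set w | N t w = n.+1]) =
  (\int[mu2]_(z in A) (density n z)%:E)%E.
Proof.
exact: (position_count_probability lam0 c1_gt0 c2_gt0 c1_finite c2_finite
  N_poisson theta_directions t0 X_motion Y_motion).
Qed.

Lemma conditional_law n (A : set plane) : measurable A ->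
  conditional_probability P (position @^-1` A) [set w | N t w = n.+1] =
  (\int[mu2]_(z in A) (zero_outside D (conditional_density n.+1 c1 c2 t) z)%:E)%E.
Proof.
move=> mA.
rewrite /conditional_probability moving_probability//.
rewrite (count_probability lam0 N_poisson theta_directions t0).
under [RHS]eq_integral do rewrite (conditional_densityE lam0 c1_gt0 c2_gt0 t0) EFinM.
rewrite ge0_integralZl//; first by rewrite muleC.
- by apply: measurable_funTS; apply/measurable_EFinP; exact: measurable_density.
- by move=> z _; rewrite lee_fin; exact: density_ge0.
- rewrite lee_fin invr_ge0; apply: divr_ge0 => //; apply: mulr_ge0; first exact: expR_ge0.
  by rewrite exprn_ge0// mulr_ge0// ltW.
Qed.

Let mstill := measurable_count N t 0.

Let still := image_measure (mrestr P mstill) mpos.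

(** The densities on the events N t = n + 1 are summed under the integral. *)
Let moving_law (A : set plane) : measurable A ->
  P (position @^-1` A `&` ~` [set w | N t w = 0%N]) =
  (\int[mu2]_(z in A) (zero_outside D (motion_density lam c1 c2 t) z)%:E)%E.
Proof.
move=> mA.
under eq_integral do rewrite (motion_densityE lam0 c1_gt0 c2_gt0 t0).
rewrite integral_nneseries//; last 2 first.
- by move=> n; apply: measurable_funTS; apply/measurable_EFinP; exact: measurable_density.
- by move=> n z _; rewrite lee_fin; exact: density_ge0.
pose F n := position @^-1` A `&` [set w | N t w = n.+1].
transitivity (P (\bigcup_n F n)).
  congr (P _); apply/seteqP; split => w.
    move=> [Aw /=]; case E : (N t w) => [|n]//= _.
    by exists n => //; split.
  by move=> [n _ [Aw /= E]]; split => //=; rewrite E.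
rewrite measure_bigcup//; last 2 first.
- by move=> n _; apply: measurableI; [exact: mpreimage|exact: measurable_count].
- apply/trivIsetP => i j _ _ ij; apply/seteqP; split => // w [[_ Ni] [_ Nj]].
  have [eij] : i.+1 = j.+1 := etrans (esym Ni) Nj.
  by move: ij; rewrite eij eqxx.
rewrite (@eq_eseriesl R _ (fun=> true)); last by move=> n; rewrite in_setT.
by apply: eq_eseriesr => n _; exact: moving_probability.
Qed.

(** Without a change of direction, the walk of unit speed ends at the distance t
from the origin. *)
Let still_singular : mutually_singular (@lebesgue_measure2 R) still.
Proof.
exists [set z | travel_time c1 z.1 ^+ 2 + travel_time c2 z.2 ^+ 2 = t ^+ 2].
have mS := measurable_wave_front t c1_gt0 c2_gt0 c1_finite c2_finite.
split => //.
  exact: wave_front_null.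
rewrite /still /= /pushforward /mrestr.
transitivity (P set0); last exact: measure0.
apply: ae_eq_measure => //.
  apply: measurableI => //; apply: mpreimage; exact: measurableC.
apply: filterS (travel_times_final_position c1_gt0 c2_gt0 c1_finite c2_finite
  N_poisson t0 X_motion Y_motion) => w E; split => // -[/= + Nw]; apply.
move: E; rewrite Nw /flight_end /displacement !big_nil (epoch0 N_poisson) subr0 !add0r.
move=> [-> ->].
by rewrite !exprMn -mulrDr cos2Dsin2 mulr1.
Qed.

Lemma position_law_decomposition :
  ac_component_density (@lebesgue_measure2 R) (fun A => P (position @^-1` A))
    (zero_outside D (motion_density lam c1 c2 t)).
Proof.
split.
- exact: measurable_motion_density.
- exact: motion_density_ge0.
exists still; split; first exact: still_singular.
move=> A mA.
transitivity (P (position @^-1` A `&` ~` [set w | N t w = 0%N]) +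
    P (position @^-1` A `&` [set w | N t w = 0%N]))%E; last first.
  by rewrite moving_law.
rewrite -measureU.
- by rewrite -setIUr setvU setIT.
- by apply: measurableI; [exact: mpreimage|exact: measurableC].
- by apply: measurableI; [exact: mpreimage|].
- by rewrite setIACA setICl setI0.
Qed.

End decomposition.

Theorem mainTheorem5 (R : realType) (d : measure_display)
    (T : measurableType d) (P : probability T R)
    (lam : R) (c1 c2 : R -> R)
    (N : R -> {RV P >-> nat}) (tau theta : nat -> {RV P >-> R})
    (X Y : R -> {RV P >-> R}) (t : R)
    (lam_gt0 : 0 < lam)
    (c1_gt0 : forall x, 0 < c1 x) (c2_gt0 : forall y, 0 < c2 y)
    (c1_finite : finite_travel_time c1) (c2_finite : finite_travel_time c2)
    (N_poisson : poisson_process lam N tau)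
    (theta_directions : random_directions N theta)
    (t_gt0 : 0 < t)
    (X_motion : coordinate_motion P N tau theta c1 cos t X)
    (Y_motion : coordinate_motion P N tau theta c2 sin t Y) :
  let position := fun w => (X t w, Y t w) in
  let D := reachable c1 c2 t in
  [/\ ac_component_density lebesgue_measure2
        (fun A => P (position @^-1` A))
        (zero_outside D (motion_density lam c1 c2 t)),
      [set z | zero_outside D (motion_density lam c1 c2 t) z != 0] = D &
      forall n : nat, (1 <= n)%N -> forall A : set (R * R), measurable A ->
        conditional_probability P (position @^-1` A) [set w | N t w = n] =
        (\int[lebesgue_measure2]_(z in A)
           (zero_outside D (conditional_density n c1 c2 t) z)%:E)%E].
Proof.
move=> position D; split.
- exact: (position_law_decomposition lam_gt0 c1_gt0 c2_gt0 c1_finite c2_finite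
    N_poisson theta_directions t_gt0 X_motion Y_motion).
- exact: support_motion_density.
- case=> // n _ A mA.
  exact: (conditional_law lam_gt0 c1_gt0 c2_gt0 c1_finite c2_finite
    N_poisson theta_directions t_gt0 X_motion Y_motion).
Qed.
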